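(* There are exactly $455$ minimal incidence tables of octic arrangements in $\mathbb{P}^3$ (over $\mathbb{C}$); that is, the set of all lists $\mathcal{T}$ of quadruples which occur as the minimal incidence table of some octic arrangement in $\mathbb{P}^3_{\mathbb{C}}$ has cardinality $455$.
   Context: An octic arrangement is a union $D=P_1\cup\dots\cup P_8$ of eight (pairwise distinct) planes in $\mathbb{P}^3=\mathbb{P}^3_{\mathbb{C}}$ such that (i) the intersection of any six of the planes (six distinct indices) is empty, and (ii) the intersection of any four of the planes (four distinct indices) does not contain a line, i.e. it is empty or a single point. The incidence table of an octic arrangement $D=P_1\cup\dots\cup P_8$ (with ordered planes) is the lexicographically sorted list of all quadruples $1\le i_1<i_2<i_3<i_4\le 8$ such that $P_{i_1}\cap P_{i_2}\cap P_{i_3}\cap P_{i_4}\neq\emptyset$. A permutation of the planes may change the incidence table. The minimal incidence table of an octic arrangement is the minimum, with respect to lexicographic order on lists of quadruples (quadruples themselves being ordered lexicographically), of the incidence tables obtained over all $8!$ orderings of its planes. *)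

(* Defs.v *)
From mathcomp Require Import all_boot all_order all_fingroup all_algebra.
From mathcomp Require Import complex.
From mathcomp Require Import classical_sets cardinality reals.

Set Implicit Arguments.
Unset Strict Implicit.
Unset Printing Implicit Defensive.

Import Order.TTheory GRing.Theory.

(* A vector subspace W of K^4 stands for the linear subspace P(W) of P^3: its
   projective dimension is \dim W - 1, P(W) is empty iff W = 0, and
   intersections and inclusions are those of the vector subspaces. *)
Notation subspace K := {vspace 'rV[K]_4}.

Section OcticArrangements.
Variable K : fieldType.
Implicit Type P : 'I_8 -> subspace K.

Definition octic_arrangement P : Prop :=
  [/\ forall i, \dim (P i) = 3,
      injective P,
      forall S : {set 'I_8}, #|S| = 6 -> (\bigcap_(i in S) P i)%VS = 0%VS
    & forall S : {set 'I_8}, #|S| = 4 ->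
        ~ exists2 L : subspace K, \dim L = 2 & (L <= \bigcap_(i in S) P i)%VS].

(* The indices 1, ..., 8 are shifted to 0, ..., 7. *)
Definition quadruple := 4.-tuplelexi 'I_8.

Definition incident P (q : quadruple) : bool :=
  sorted <%O (q : seq 'I_8) && ((\bigcap_(i <- (q : seq 'I_8)) P i)%VS != 0%VS).

Definition table := seqlexi quadruple.

Definition incidence_table P : table :=
  sort <=%O [seq q <- enum {: quadruple} | incident P q].

(* The default value of the minimum is the table of the given ordering, that
   is, the one for the identity permutation. *)
Definition minimal_incidence_table P : table :=
  \big[Order.min / incidence_table P]_(s : 'S_8) incidence_table (P \o s).

Definition minimal_incidence_tables : set table :=
  [set T | exists2 P, octic_arrangement P & minimal_incidence_table P = T]%classic.

End OcticArrangements.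

(* Main.v *)
(* Dually, an octic arrangement is a family of eight vectors of K^4, and its incidence table
   lists the vanishing 4x4 minors ("brackets"), i.e. the non-bases of a matroid of rank 4.
   Minimal tables correspond to orbits of such matroids under relabelling, so it suffices to
   produce 455 realizable matroids, pairwise separated by an invariant, to which every
   octic arrangement is isomorphic.  Completeness: reorder the planes so that the word of the
   vanishing brackets is lexicographically maximal, and branch on the brackets in turn; every
   branch not ending at one of the 455 words violates a Pluecker relation, an axiom of octic
   arrangements or maximality, or it is one of 60 combinatorial types without realization.  In
   these, the three-term Pluecker relations with one vanishing term are binomials, and a
   product of such binomials shows that two terms of another relation agree up to sign, which
   leaves a contradiction in characteristic 0. *)
From HB Require Import structures.
From Stdlib Require Import BinNums BinPos BinNat BinInt Nnat Znat FMapPositive.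
Require Import Defs.
From mathcomp Require Import all_boot all_order all_fingroup all_algebra.
From mathcomp Require Import ring zify.
From mathcomp Require Import complex ssrZ.
From mathcomp Require Import boolp classical_sets cardinality reals.

Set Implicit Arguments.
Unset Strict Implicit.
Unset Printing Implicit Defensive.

Import Order.TTheory GRing.Theory Num.Theory.

(** * Codes of quadruples *)

(** No minimal table is ever computed. A table and a word determine each other, and the minimum over
    all orderings depends only on the orbit, so the theorem becomes a count of orbits of words. To
    make this count computable, the axioms on two, four and six planes are unified: 2k planes have
    rank at least k + 1 for k = 1, 2, 3, that is, some basis contains at least k + 1 of them. In
    this form they depend only on which quadruples are bases, so they can be refuted on a partial
    word and verified on a complete one. Linear algebra enters through brackets alone. On the
    negative side only signs, vanishing and products of brackets occur; on the positive side
    coordinates lie in Z[alpha] for a root alpha of an integral monic quadratic polynomial, and a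
    nonzero norm certifies that a bracket does not vanish. The case distinction and the coordinates
    are plain data that the kernel rechecks. The words at the leaves appear in the order of the
    configurations, so a single equality of lists joins completeness to realizability. *)

Lemma pos_eqP : Equality.axiom Pos.eqb.
Proof. by move=> p q; apply: (iffP idP) => [/Pos.eqb_eq|/Pos.eqb_eq]. Qed.
HB.instance Definition _ := hasDecEq.Build positive pos_eqP.

Definition bit (i : nat) : positive := iter i xO xH.
(** A set of planes is encoded as a bit mask, and masks are positive numbers so that they can be
    keys of a [PositiveMap]. The empty list has no such mask; [xH] is a mere default there. *)
Definition code (l : seq nat) : positive :=
  if l is i :: l' then foldl (fun c j => Pos.add c (bit j)) (bit i) l' else xH.

(* Colexicographic order: the quadruples among the first n planes come first. *)
Definition quads : seq (seq nat) := Eval compute in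
  flatten [seq flatten [seq flatten [seq [seq [:: a; b; c; d] | a <- iota 0 b]
    | b <- iota 0 c] | c <- iota 0 d] | d <- iota 0 8].
Definition codes : seq positive := Eval compute in map code quads.

Definition mem_code (n : N) (i : nat) : bool := N.testbit n (N.of_nat i).
Definition elements (p : positive) : seq nat :=
  [seq i <- iota 0 8 | mem_code (Npos p) i].

Fixpoint pos_card (p : positive) : nat :=
  match p with xH => 1 | xO q => pos_card q | xI q => (pos_card q).+1 end.
Definition card (n : N) : nat := if n is Npos p then pos_card p else 0.
Definition common (p q : positive) : nat := card (Pos.land p q).

Definition indices l := uniq l && all (fun i => i < 8) l.

Definition compare_swap i j (sl : bool * seq nat) :=
  let: (s, l) := sl in
  if nth 0 l j < nth 0 l i
  then (~~ s, set_nth 0 (set_nth 0 l i (nth 0 l j)) j (nth 0 l i)) else sl.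

(* A sorting network for four entries, together with the sign of the sorting permutation. *)
Definition sort4 l := compare_swap 1 2 (compare_swap 2 3 (compare_swap 0 1
  (compare_swap 1 2 (compare_swap 2 3 (compare_swap 1 2 (compare_swap 0 1 (false, l))))))).

Definition all_lists4 : seq (seq nat) :=
  flatten [seq flatten [seq flatten [seq [seq [:: a; b; c; d] | a <- iota 0 8]
    | b <- iota 0 8] | c <- iota 0 8] | d <- iota 0 8].

Lemma mem_all_lists4 l : size l = 4 -> all (fun i => i < 8) l -> l \in all_lists4.
Proof.
case: l => [|a [|b [|c [|d []]]]] // _ /= /and5P[ha hb hc hd _].
apply/flattenP; exists (flatten [seq flatten [seq [seq [:: a; b; c; d] | a <- iota 0 8]
    | b <- iota 0 8] | c <- iota 0 8]); first by apply/mapP; exists d; rewrite ?mem_iota.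
apply/flattenP; exists (flatten [seq [seq [:: a; b; c; d] | a <- iota 0 8]
    | b <- iota 0 8]); first by apply/mapP; exists c; rewrite ?mem_iota.
apply/flattenP; exists [seq [:: a; b; c; d] | a <- iota 0 8];
  first by apply/mapP; exists b; rewrite ?mem_iota.
by apply/mapP; exists a; rewrite ?mem_iota.
Qed.

(** Enumeration of the 8 ^ 4 lists takes the place of a theory of masks and of the sorting network:
    everything used later about codes of quadruples is read off from this check. *)
Lemma code_checks : all (fun l => uniq l ==>
  [&& elements (code l) == (sort4 l).2, perm_eq (elements (code l)) l,
      code l \in codes & sorted ltn l ==> (l \in quads)]) all_lists4.
Proof. by vm_compute. Qed.

Lemma card_land_check : all (fun x => all (fun c => card (N.land (N.of_nat x) (Npos c)) ==
    count (fun i => mem_code (N.of_nat x) i && mem_code (Npos c) i) (iota 0 8)) codes)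
  (iota 0 256).
Proof. by vm_compute. Qed.

Lemma elements_codes : map elements codes = quads.
Proof. by vm_compute. Qed.

Lemma quads_indices : all (fun l => indices l && (size l == 4)) quads.
Proof. by vm_compute. Qed.

Section Code.
Variable l : seq nat.
Hypotheses (il : indices l) (l4 : size l = 4).

Let check : [&& elements (code l) == (sort4 l).2, perm_eq (elements (code l)) l,
  code l \in codes & sorted ltn l ==> (l \in quads)].
Proof.
have [ul l8] := andP il; have := allP code_checks l (mem_all_lists4 l4 l8).
by rewrite ul.
Qed.

Lemma elements_code : elements (code l) = (sort4 l).2.
Proof. by case/and4P: check => /eqP. Qed.

Lemma elements_code_perm : perm_eq (elements (code l)) l.
Proof. by case/and4P: check. Qed.

Lemma code_in : code l \in codes.
Proof. by case/and4P: check. Qed.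

Lemma sorted_quads : sorted ltn l -> l \in quads.
Proof. by move=> sl; case/and4P: check => _ _ _ /implyP/(_ sl). Qed.
End Code.

Lemma elements_in c : c \in codes -> elements c \in quads.
Proof. by rewrite -elements_codes; apply: map_f. Qed.

Lemma indices_elements c : c \in codes -> indices (elements c).
Proof. by move=> /elements_in/(allP quads_indices)/andP[]. Qed.

Lemma size_elements c : c \in codes -> size (elements c) = 4.
Proof. by move=> /elements_in/(allP quads_indices)/andP[_ /eqP]. Qed.

Lemma indices_nth l s : indices l -> uniq s -> all (fun i => i < size l) s ->
  indices (map (nth 0 l) s).
Proof.
move=> /andP[ul /allP l8] us /allP sl; apply/andP; split.
  by rewrite map_inj_in_uniq // => i j /sl il /sl jl /eqP; rewrite nth_uniq // => /eqP.
by apply/allP => _ /mapP[i /sl il ->]; apply: l8; apply: mem_nth.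
Qed.

(** * Determinants and hyperplanes *)

Section Det4.
Variables (T : Type) (add sub mul : T -> T -> T).
Definition vec := (T * T * T * T)%type.

(** Laplace expansion, from the last two rows upwards, over arbitrary operations: the same formula
    is used in a field for the proofs and on pairs of integers for the computation. *)
Definition minor2 (x y : vec) :=
  let: (x1, x2, x3, x4) := x in let: (y1, y2, y3, y4) := y in
  (sub (mul x1 y2) (mul x2 y1), sub (mul x1 y3) (mul x3 y1), sub (mul x1 y4) (mul x4 y1),
   sub (mul x2 y3) (mul x3 y2), sub (mul x2 y4) (mul x4 y2), sub (mul x3 y4) (mul x4 y3)).

Definition minor3 (x : vec) m :=
  let: (x1, x2, x3, x4) := x in let: (m12, m13, m14, m23, m24, m34) := m in
  (add (sub (mul x2 m34) (mul x3 m24)) (mul x4 m23),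
   add (sub (mul x1 m34) (mul x3 m14)) (mul x4 m13),
   add (sub (mul x1 m24) (mul x2 m14)) (mul x4 m12),
   add (sub (mul x1 m23) (mul x2 m13)) (mul x3 m12)).

Definition minor4 (x : vec) n :=
  let: (x1, x2, x3, x4) := x in let: (n1, n2, n3, n4) := n in
  sub (add (sub (mul x1 n1) (mul x2 n2)) (mul x3 n3)) (mul x4 n4).

Definition det4 x y z w := minor4 x (minor3 y (minor2 z w)).
End Det4.

Section Planes.
Variable K : fieldType.
Local Open Scope ring_scope.
Implicit Types (P : 'I_8 -> subspace K) (n : 'rV[K]_4).

Definition coords n : vec K := (n 0 0, n 0 1, n 0 2%:R, n 0 3%:R).

Definition bracket := det4 (fun x y : K => x + y) (fun x y => x - y) (fun x y => x * y).

Lemma det_rows (r : 'I_4 -> 'rV[K]_4) :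
  \det (\matrix_i r i) =
  bracket (coords (r 0)) (coords (r 1)) (coords (r 2%:R)) (coords (r 3%:R)).
Proof.
(* Indexing the entries by natural numbers lets the ordinals produced by the expansion reduce to
   numerals, so that [ring] recognizes equal entries. *)
pose a i j := r (inord i) 0 (inord j).
have ra (i j : 'I_4) : r i 0 j = a i j by rewrite /a !inord_val.
have -> : \matrix_i r i = \matrix_(i, j) a i j by apply/matrixP => i j; rewrite !mxE ra.
rewrite /coords !ra /= /bracket /det4 /=.
rewrite (expand_det_row _ 0) !big_ord_recl big_ord0 /cofactor.
rewrite !(expand_det_row _ 0) !big_ord_recl !big_ord0 /cofactor.
rewrite !(expand_det_row _ 0) !big_ord_recl !big_ord0 /cofactor.
rewrite !det_mx11 !mxE /= /bump /=.
rewrite !(addn0, add0n, add1n, addn1) /=.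
move: (a) => b.
ring.
Qed.

End Planes.
Arguments bracket : simpl never.
Arguments coords : simpl never.

Section Hyperplanes.
Variable K : fieldType.
Local Open Scope ring_scope.
Implicit Types (P : 'I_8 -> subspace K) (n : 'rV[K]_4).

Definition hyperplane n : subspace K := lker (linfun (mulmxr n^T : 'rV[K]_4 -> 'rV[K]_1)).

Lemma mem_hyperplane n x : (x \in hyperplane n) = (x *m n^T == 0).
Proof. by rewrite memv_ker lfunE. Qed.

Lemma dim_hyperplane n : n != 0 -> \dim (hyperplane n) = 3.
Proof.
move=> n0; have := limg_ker_dim (linfun (mulmxr n^T : 'rV[K]_4 -> 'rV[K]_1)) fullv.
rewrite capfv dimvf /dim /= mul1n.
suff -> : \dim (limg (linfun (mulmxr n^T : 'rV[K]_4 -> 'rV[K]_1))) = 1%N.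
  by rewrite addn1 => -[].
apply/eqP; rewrite eqn_leq (leq_trans (dimvS (subvf _))) ?dimvf /dim //=.
rewrite lt0n dimv_eq0; apply: contra_neq n0 => limg0.
apply/trmx_inj/row_matrixP => i; rewrite trmx0 row0 rowE.
have : delta_mx 0 i *m n^T \in limg (linfun (mulmxr n^T : 'rV[K]_4 -> 'rV[K]_1)).
  by apply/memv_imgP; exists (delta_mx 0 i); rewrite ?memvf ?lfunE.
by rewrite limg0 memv0 => /eqP.
Qed.

(** The three vectors of a basis of U impose three linear conditions on a normal vector in K^4, so a
    nonzero one exists; comparing dimensions turns the inclusion into an equality. *)
Lemma hyperplaneP (U : subspace K) : \dim U = 3 -> exists2 n, n != 0 & U = hyperplane n.
Proof.
move=> dU; pose M : 'M[K]_(3, 4) := \matrix_(i < 3) (vbasis U)`_i.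
have : kermx M^T != 0.
  by rewrite -mxrank_eq0 mxrank_ker mxrank_tr subn_eq0 -ltnNge (leq_ltn_trans (rank_leq_row M)).
case/rowV0Pn => n /sub_kermxP nM n0; exists n => //.
apply/eqP; rewrite eqEdim dim_hyperplane // dU leqnn andbT.
rewrite -{1}(span_basis (vbasisP U)); apply/span_subvP => x /tnthP[i ->].
have i3 : (i < 3)%N by case: i => i /=; rewrite dU.
rewrite mem_hyperplane (tnth_nth 0).
have := congr1 (fun N => row (Ordinal i3) N^T) nM.
by rewrite trmx_mul trmxK row_mul rowK trmx0 row0 /= => ->.
Qed.

(** For four planes this is linear dependence of their normal vectors. Indices are natural numbers
    because all computations run on plain lists. *)
Definition dep P (l : seq nat) : bool := (\bigcap_(i <- l) P (inord i))%VS != 0%VS.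

Lemma dep_perm P l l' : perm_eq l l' -> dep P l = dep P l'.
Proof. by move=> ll'; rewrite /dep (perm_big _ ll'). Qed.

Lemma mem_bigcap (I : Type) (l : seq I) (U : I -> subspace K) x :
  (x \in (\bigcap_(i <- l) U i)%VS) = all (fun i => x \in U i) l.
Proof.
by elim: l => [|i l IH]; rewrite ?big_nil ?memvf // big_cons memv_cap IH.
Qed.

(** A common point of the four planes is a nonzero vector orthogonal to the four normals, that is, a
    nonzero kernel vector of the transposed matrix of normals. *)
Lemma dep_bracket P (n : nat -> 'rV[K]_4) a b c d :
    (forall i, P (inord i) = hyperplane (n i)) ->
  dep P [:: a; b; c; d] =
  (bracket (coords (n a)) (coords (n b)) (coords (n c)) (coords (n d)) == 0).
Proof.
move=> Pn; pose r (i : 'I_4) := n (nth 0%N [:: a; b; c; d] i).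
rewrite -[bracket _ _ _ _](det_rows r) -det_tr; apply/idP/det0P => [|[x x0 xr]].
  rewrite /dep -vpick0; set U := (\bigcap_(i <- _) _)%VS => x0; exists (vpick U) => //.
  have := memv_pick U; rewrite mem_bigcap; move: (vpick U) => x /allP xP.
  apply/rowP => i; rewrite !mxE.
  have /xP : nth 0%N [:: a; b; c; d] i \in [:: a; b; c; d] by apply: mem_nth.
  rewrite Pn mem_hyperplane => /eqP/rowP/(_ 0); rewrite !mxE => e.
  by rewrite -[RHS]e; apply: eq_bigr => j _; rewrite !mxE.
apply: contraNneq x0 => U0; rewrite -memv0 -U0 mem_bigcap; apply/allP => k kl.
rewrite Pn mem_hyperplane; apply/eqP/rowP => j; rewrite {j}ord1 !mxE.
have k4 : (index k [:: a; b; c; d] < 4)%N by rewrite -index_mem in kl.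
have := congr1 (fun y : 'rV_4 => y 0 (Ordinal k4)) xr; rewrite !mxE => e.
rewrite -[RHS]e; apply: eq_bigr => j _; rewrite !mxE /r /=.
by rewrite -[in LHS](nth_index 0%N kl).
Qed.
End Hyperplanes.

(** * Rank conditions and bases of an octic arrangement *)

Section Spanning.
Variable K : fieldType.
Implicit Types (P : 'I_8 -> subspace K) (l : seq nat).

Definition meet P l : subspace K := (\bigcap_(i <- l) P (inord i))%VS.

Lemma meet_cons P x l : meet P (x :: l) = (P (inord x) :&: meet P l)%VS.
Proof. by rewrite /meet big_cons. Qed.

Lemma meet_le P x l : x \in l -> (meet P l <= P (inord x))%VS.
Proof.
by move=> xl; apply/subvP => y; rewrite mem_bigcap => /allP/(_ _ xl).
Qed.

(** Steinitz exchange, where [\dim (meet P l) + size l = 4] expresses independence of l. If all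
    planes of X contained the meet of l, the meet of X would be too large. A plane that does not
    contain the meet of l spans the whole space together with it, so the dimension drops by exactly
    one. *)
Lemma meet_drop P l X : (forall i, \dim (P i) = 3) ->
    \dim (meet P l) + size l = 4 -> \dim (meet P X) + size l < 4 ->
  exists2 x, x \in X & x \notin l /\ \dim (meet P (x :: l)) + size (x :: l) = 4.
Proof.
move=> P3 dl dX.
have /hasP[x xX xl] : has (fun x => ~~ (meet P l <= P (inord x))%VS) X.
  apply: contraLR dX => /hasPn lX; rewrite -leqNgt.
  apply: (@leq_trans (\dim (meet P l) + size l)); first by rewrite dl.
  rewrite leq_add2r dimvS //.
  by apply/subvP => y yl; rewrite mem_bigcap; apply/allP => x /lX /negPn/subvP; apply.
exists x => //; split; first by apply: contra xl; apply: meet_le.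
have := dimv_sum_cap (P (inord x)) (meet P l).
suff -> : \dim (P (inord x) + meet P l) = 4.
  by rewrite P3 meet_cons /=; move: dl; lia.
have := dimvS (subvf (P (inord x) + meet P l)%VS); rewrite dimvf /dim /= mul1n => le4.
apply/eqP; rewrite eqn_leq le4 /= ltnNge.
apply: contra xl => le3; have /eqP -> : P (inord x) == (P (inord x) + meet P l)%VS.
  by rewrite eqEdim addvSl P3.
exact: addvSr.
Qed.

(** Iterated exchange: the planes of X have rank at least r, so an independent list can be extended
    by planes of X until it has r members. *)
Lemma meet_grow P l X r : (forall i, \dim (P i) = 3) -> uniq l ->
    \dim (meet P l) + size l = 4 -> \dim (meet P X) + r <= 4 -> size l <= r ->
  exists l', [/\ {subset l' <= X}, uniq (l' ++ l), size (l' ++ l) = r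
    & \dim (meet P (l' ++ l)) + r = 4].
Proof.
move=> P3; have [m] := ubnP (r - size l); elim: m l => // m IH l em ul dl dX.
rewrite leq_eqVlt => /orP[/eqP lr|lr]; first by exists [::]; split => //=; rewrite -lr.
have [x xX [xl dxl]] : exists2 x, x \in X & x \notin l /\
    \dim (meet P (x :: l)) + size (x :: l) = 4 by apply: meet_drop => //; lia.
have em' : r - size (x :: l) < m by move: em lr => /=; lia.
have [|l' [l'X u s d]] := IH _ em' _ dxl dX lr; first by rewrite /= xl.
exists (rcons l' x); rewrite -cats1 -catA /=; split=> // y.
by rewrite mem_cat inE => /orP[/l'X|/eqP->].
Qed.

(** The bounds on the dimension are 2, 1 and 0 in the three cases: two planes are distinct, four
    contain no common line, six have no common point. *)
Lemma octic_meet P l : octic_arrangement P -> indices l -> size l \in [:: 2; 4; 6] ->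
  \dim (meet P l) + (size l)./2.+1 <= 4.
Proof.
case=> P3 Pinj P6 P4 /andP[ul /allP l8].
pose S := [set i : 'I_8 | val i \in l].
have lS : perm_eq [seq inord i | i <- l] (enum S).
  apply: uniq_perm; rewrite ?enum_uniq //.
    rewrite map_inj_in_uniq // => i j /l8 i8 /l8 j8 e.
    by rewrite -(inordK i8) e inordK.
  move=> i; rewrite mem_enum inE; apply/mapP/idP => [[j jl ->]|il].
    by rewrite /= inordK ?l8.
  by exists (val i); rewrite ?inord_val.
have cS : #|S| = size l by rewrite cardE -(perm_size lS) size_map.
have mS : meet P l = (\bigcap_(i in S) P i)%VS.
  by rewrite -big_enum /= -(perm_big _ lS) big_map.
rewrite !inE => /or3P[]/eqP sl; rewrite sl /=.
- case: l => [|a [|b []]] // in ul l8 sl {lS cS mS S} *.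
  rewrite !meet_cons /meet big_nil capvf.
  move: ul; rewrite /= inE andbT => ab.
  rewrite leqNgt; apply: contra ab => d3.
  have a8 : a < 8 by apply: l8; rewrite !inE eqxx.
  have b8 : b < 8 by apply: l8; rewrite !inE eqxx orbT.
  have /eqP eA : (P (inord a) :&: P (inord b))%VS == P (inord a).
    by rewrite eqEdim capvSl P3; move: d3; lia.
  have /eqP eB : (P (inord a) :&: P (inord b))%VS == P (inord b).
    by rewrite eqEdim capvSr P3; move: d3; lia.
  by rewrite -(inordK a8) -(inordK b8) (Pinj (inord a) (inord b)) // -eA eB.
(* A meet of dimension 2 or more contains a line, spanned by the first two vectors of a basis. *)
- rewrite mS leqNgt; apply/negP => d2; apply: (P4 S); first by rewrite cS.
  set U := (\bigcap_(i in S) P i)%VS in d2 *.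
  have fU := basis_free (vbasisP U).
  have s2 : size (take 2 (vbasis U)) = 2 by rewrite size_takel // size_tuple; move: d2; lia.
  exists <<take 2 (vbasis U)>>%VS.
    rewrite -[RHS]s2; apply/eqP; rewrite -/(free _).
    by move: fU; rewrite -{1}(cat_take_drop 2 (vbasis U)); apply: catl_free.
  by apply/span_subvP => x /mem_take /vbasis_mem.
- by rewrite mS P6 ?dimv0 ?cS ?sl.
Qed.

(** The rank conditions are expressed through bases, so that they can be tested on words. An
    independent part of T of the required size is completed to a basis by planes among all eight. *)
Lemma octic_basis P T : octic_arrangement P -> indices T -> size T \in [:: 2; 4; 6] ->
  exists l, [/\ indices l, size l = 4, ~~ dep P l & (size T)./2.+1 <= count (mem T) l].
Proof.
move=> oP iT sT; have [P3 _ P6 _] := oP; have dT := octic_meet oP iT sT.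
have [|l [lT ul sl dl]] := @meet_grow P [::] T (size T)./2.+1 P3 isT _ dT isT.
  by rewrite /meet big_nil dimvf.
rewrite cats0 in ul sl dl.
have d8 : \dim (meet P (iota 0 8)) + 4 <= 4.
  suff -> : meet P (iota 0 8) = 0%VS by rewrite dimv0.
  (* Already the first six planes have no common point. *)
  apply/eqP; rewrite -subv0 -(P6 [set i : 'I_8 | val i < 6]); last first.
    by rewrite -sum1_card big_mkcond !big_ord_recl big_ord0 !inE.
  apply/subvP => y; rewrite mem_bigcap => /allP yP.
  rewrite -big_enum /= mem_bigcap; apply/allP => i _.
  by rewrite -(inord_val i) yP // mem_iota /= ltn_ord.
have l4 : size l <= 4 by rewrite sl; move: dT; lia.
have [|l' [l'8 u s d]] := @meet_grow P l (iota 0 8) 4 P3 ul _ d8 l4.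
  by rewrite sl.
exists (l' ++ l); split=> //.
- apply/andP; split=> //; apply/allP => i; rewrite mem_cat => /orP[/l'8|/lT].
    by rewrite mem_iota.
  by move: i; apply/allP; case/andP: iT.
- by rewrite negbK -dimv_eq0; move: d; rewrite /meet; lia.
- rewrite -sl count_cat (leq_trans _ (leq_addl _ _)) //.
  by rewrite (eq_in_count (a2 := predT)) ?count_predT // => i /lT.
Qed.
End Spanning.

(** * Pluecker relations *)

Notation state := (PositiveMap.t bool).
(* [(s, (c, c'))] stands for (-1) ^ s times the product of the brackets of c and c'. *)
Definition monomial := (bool * (positive * positive))%type.

(** The Boolean [true] stands for dependence, that is, for a vanishing bracket. An undecided bracket
    is known neither to vanish nor to be nonzero. *)
Definition known (st : state) b c : bool :=
  if PositiveMap.find c st is Some b' then b == b' else false.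
Definition vanishes st (t : monomial) := known st true t.2.1 || known st true t.2.2.
Definition nonzero st (t : monomial) := known st false t.2.1 && known st false t.2.2.

(** The signs of the sorting permutations are absorbed into the coefficient, so that the same
    bracket always has the same code and products can be compared as multisets of codes. *)
Definition mono s l l' : monomial :=
  (s (+) ((sort4 l).1 (+) (sort4 l').1), (code l, code l')).

(** Six indices give the three-term relation with a and b common to all brackets. Seven give an
    exchange relation with a common index a: the entry b of the first bracket is exchanged with e, f
    and g of the second in turn. *)
Definition plucker (l : seq nat) : seq monomial :=
  match l with
  | [:: a; b; c; d; e; f] =>
     [:: mono false [:: a; b; c; d] [:: a; b; e; f];
         mono true [:: a; b; c; e] [:: a; b; d; f];
         mono false [:: a; b; c; f] [:: a; b; d; e]]
  | [:: a; b; c; d; e; f; g] =>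
     [:: mono false [:: a; b; c; d] [:: a; e; f; g];
         mono true [:: a; e; c; d] [:: a; b; f; g];
         mono true [:: a; f; c; d] [:: a; e; b; g];
         mono true [:: a; g; c; d] [:: a; e; f; b]]
  | _ => [::]
  end.

(** It suffices to let the first term be the only surviving one: up to sign the three-term relation
    is symmetric in c, d, e, f and the four-term relation in b, e, f, g, so any term can be brought
    to the front. *)
Definition clash st l :=
  indices l && if plucker l is t :: ts then nonzero st t && all (vanishes st) ts else false.

(** If the third term vanishes, the first two are opposite. The second is required to be nonzero
    because the right-hand sides are cancelled later. *)
Definition binomial_relation st (l : seq nat) : option (monomial * monomial) :=
  if indices l && (size l == 6) then
    if plucker l is [:: t; u; v] then
      if vanishes st v && nonzero st u then Some (t, u) else None
    else None
  else None.

(* The product of the given binomial relations, as an equation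
   prod x = (-1) ^ s * prod y between monomials in the brackets. *)
Fixpoint derive st (ls : seq (seq nat)) : option (bool * (seq positive * seq positive)) :=
  if ls is l :: ls' then
    match binomial_relation st l, derive st ls' with
    | Some ((s, (a, b)), (s', (a', b'))), Some (s0, (x, y)) =>
        Some (~~ (s (+) s') (+) s0, (a :: b :: x, a' :: b' :: y))
    | _, _ => None
    end
  else Some (false, ([::], [::])).

(** The result [Some b] certifies that u is (-1) ^ b times t. From x = ± y as products and the
    equality of u x and t y as multisets of brackets, cancelling y leaves u = ± t. *)
Definition bracket_ratio st ls (t u : monomial) : option bool :=
  if derive st ls is Some (s, (x, y)) then
    if perm_eq (u.2.1 :: u.2.2 :: x) (t.2.1 :: t.2.2 :: y)
    then Some (s (+) (t.1 (+) u.1)) else None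
  else None.

(** In a relation t + u + v = 0 with t nonzero, u = - t contradicts v being nonzero, while u = t
    gives 2 t = 0 if v vanishes and 3 t = 0 if also v = t. *)
Definition unrealizable st l ls ls' :=
  [&& indices l, size l == 6 &
  if plucker l is [:: t; u; v] then
    nonzero st t &&
    match bracket_ratio st ls t u with
    | Some true => nonzero st v
    | Some false => vanishes st v || (bracket_ratio st ls' t v == Some false)
    | None => false
    end
  else false].

Section Brackets.
Variable K : fieldType.
Local Open Scope ring_scope.
Implicit Types x y z w : vec K.

Lemma bracket_swap01 x y z w : bracket y x z w = - bracket x y z w.
Proof.
by move: x y z w => [[[? ?] ?] ?] [[[? ?] ?] ?] [[[? ?] ?] ?] [[[? ?] ?] ?];
  rewrite /bracket /det4 /=; ring.
Qed.

Lemma bracket_swap12 x y z w : bracket x z y w = - bracket x y z w.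
Proof.
by move: x y z w => [[[? ?] ?] ?] [[[? ?] ?] ?] [[[? ?] ?] ?] [[[? ?] ?] ?];
  rewrite /bracket /det4 /=; ring.
Qed.

Lemma bracket_swap23 x y z w : bracket x y w z = - bracket x y z w.
Proof.
by move: x y z w => [[[? ?] ?] ?] [[[? ?] ?] ?] [[[? ?] ?] ?] [[[? ?] ?] ?];
  rewrite /bracket /det4 /=; ring.
Qed.

Lemma plucker4 x y1 y2 y3 z1 z2 z3 :
  bracket x y1 y2 y3 * bracket x z1 z2 z3 =
  bracket x z1 y2 y3 * bracket x y1 z2 z3 + bracket x z2 y2 y3 * bracket x z1 y1 z3
  + bracket x z3 y2 y3 * bracket x z1 z2 y1.
Proof.
move: x y1 y2 y3 z1 z2 z3 => [[[? ?] ?] ?] [[[? ?] ?] ?] [[[? ?] ?] ?] [[[? ?] ?] ?].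
move=> [[[? ?] ?] ?] [[[? ?] ?] ?] [[[? ?] ?] ?].
rewrite /bracket /det4 /=. ring.
Qed.

Lemma bracket_eq x y z : bracket x y y z = 0.
Proof.
by move: x y z => [[[? ?] ?] ?] [[[? ?] ?] ?] [[[? ?] ?] ?];
  rewrite /bracket /det4 /=; ring.
Qed.

Lemma plucker3 x y a b c d :
  bracket x y a b * bracket x y c d - bracket x y a c * bracket x y b d
  + bracket x y a d * bracket x y b c = 0.
Proof.
move: x y a b c d => [[[? ?] ?] ?] [[[? ?] ?] ?] [[[? ?] ?] ?] [[[? ?] ?] ?].
move=> [[[? ?] ?] ?] [[[? ?] ?] ?].
rewrite /bracket /det4 /=. ring.
Qed.
End Brackets.

(** * Soundness of the criteria on brackets *)

Section Soundness.
Variable K : numFieldType.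
Local Open Scope ring_scope.
Variables (P : 'I_8 -> subspace K) (n : nat -> 'rV[K]_4).
Hypothesis Pn : forall i, P (inord i) = hyperplane (n i).

Definition agrees (st : state) :=
  forall c b, PositiveMap.find c st = Some b -> dep P (elements c) = b.

Let X (l : seq nat) : K := bracket (coords (n (nth 0%N l 0))) (coords (n (nth 0%N l 1)))
  (coords (n (nth 0%N l 2))) (coords (n (nth 0%N l 3))).
Let Y c := X (elements c).
Let value (t : monomial) := (-1) ^+ t.1 * (Y t.2.1 * Y t.2.2).

Lemma dep_X l : size l = 4%N -> dep P l = (X l == 0).
Proof. by case: l => [|a [|b [|c [|d []]]]] // _; rewrite (dep_bracket _ _ _ _ Pn). Qed.

(** The sorting network only compares neighbours, so antisymmetry of the bracket in adjacent
    arguments is enough to follow the sign. *)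
Let compare_swapX i (sl : bool * seq nat) : (i < 3)%N -> size sl.2 = 4%N ->
  size (compare_swap i i.+1 sl).2 = 4%N /\
  (-1) ^+ (compare_swap i i.+1 sl).1 * X (compare_swap i i.+1 sl).2 = (-1) ^+ sl.1 * X sl.2.
Proof.
case: sl => s [|a [|b [|c [|d []]]]] //; case: i => [|[|[|]]] // _ _;
  rewrite /compare_swap; case: ifP => //= _; split=> //; rewrite signrN mulNr -mulrN;
  congr (_ * _); rewrite /X /=.
- by rewrite bracket_swap01 opprK.
- by rewrite bracket_swap12 opprK.
- by rewrite bracket_swap23 opprK.
Qed.

Let sort4X l : size l = 4%N -> X l = (-1) ^+ (sort4 l).1 * X (sort4 l).2.
Proof.
move=> l4; have step (sl : bool * seq nat) m i : (i < 3)%N ->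
    size sl.2 = 4%N /\ m = (-1) ^+ sl.1 * X sl.2 ->
    size (compare_swap i i.+1 sl).2 = 4%N /\
    m = (-1) ^+ (compare_swap i i.+1 sl).1 * X (compare_swap i i.+1 sl).2.
  by move=> i3 [sl4 ->]; have [? ->] := compare_swapX i3 sl4.
suff [] : size (sort4 l).2 = 4%N /\ X l = (-1) ^+ (sort4 l).1 * X (sort4 l).2 by [].
by do 7!(apply: (step) => //); rewrite /= mul1r.
Qed.

Let monoX s l l' : indices l -> size l = 4%N -> indices l' -> size l' = 4%N ->
  value (mono s l l') = (-1) ^+ s * (X l * X l').
Proof.
move=> il l4 il' l4'; rewrite /value /= /Y !elements_code //.
rewrite [in RHS](sort4X l4) [in RHS](sort4X l4') !signr_addb.
by ring.
Qed.

Definition in_codes (t : monomial) := (t.2.1 \in codes) && (t.2.2 \in codes).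

Lemma in_codes_mono s l l' : indices l -> size l = 4%N -> indices l' -> size l' = 4%N ->
  in_codes (mono s l l').
Proof. by move=> *; rewrite /in_codes !code_in. Qed.

Lemma pluckerP l : indices l -> all in_codes (plucker l) /\ \sum_(t <- plucker l) value t = 0.
Proof.
(* Every quadruple in a relation is given by distinct positions in l, and so inherits distinct
   entries below 8 from l. *)
move=> il; have sub s : uniq s -> all (fun i => i < size l)%N s -> indices (map (nth 0%N l) s).
  exact: indices_nth.
case: l il sub => [|a [|b [|c [|d [|e [|f [|g []]]]]]]] //= il sub; rewrite ?big_nil //.
- have i1 := sub [:: 0; 1; 2; 3]%N isT isT; have i2 := sub [:: 0; 1; 4; 5]%N isT isT.
  have i3 := sub [:: 0; 1; 2; 4]%N isT isT; have i4 := sub [:: 0; 1; 3; 5]%N isT isT.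
  have i5 := sub [:: 0; 1; 2; 5]%N isT isT; have i6 := sub [:: 0; 1; 3; 4]%N isT isT.
  split; first by rewrite !in_codes_mono.
  rewrite !big_cons big_nil !monoX // addr0.
  rewrite -[RHS](plucker3 (coords (n a)) (coords (n b)) (coords (n c)) (coords (n d))
    (coords (n e)) (coords (n f))) /X /=; ring.
- have i1 := sub [:: 0; 1; 2; 3]%N isT isT; have i2 := sub [:: 0; 4; 5; 6]%N isT isT.
  have i3 := sub [:: 0; 4; 2; 3]%N isT isT; have i4 := sub [:: 0; 1; 5; 6]%N isT isT.
  have i5 := sub [:: 0; 5; 2; 3]%N isT isT; have i6 := sub [:: 0; 4; 1; 6]%N isT isT.
  have i7 := sub [:: 0; 6; 2; 3]%N isT isT; have i8 := sub [:: 0; 4; 5; 1]%N isT isT.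
  split; first by rewrite !in_codes_mono.
  rewrite !big_cons big_nil !monoX // addr0 /= expr0 expr1 !mul1r /X /=.
  by rewrite plucker4; ring.
Qed.

Variable st : state.
Hypothesis agr : agrees st.

Lemma knownP b c : known st b c -> dep P (elements c) = b.
Proof. by rewrite /known; case E: (PositiveMap.find c st) => [b'|] // /eqP->; apply: agr. Qed.

Let knownY b c : c \in codes -> known st b c -> (Y c == 0) = b.
Proof. by move=> cc /knownP; rewrite dep_X ?size_elements. Qed.

Let vanishesP t : in_codes t -> vanishes st t -> value t = 0.
Proof.
case/andP=> c1 c2 /orP[/(knownY c1)/eqP|/(knownY c2)/eqP]; rewrite /value => ->.
  by rewrite mul0r mulr0.
by rewrite !mulr0.
Qed.

Let nonzeroY t : in_codes t -> nonzero st t -> Y t.2.1 != 0 /\ Y t.2.2 != 0.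
Proof. by case/andP=> c1 c2 /andP[/(knownY c1) -> /(knownY c2) ->]. Qed.

Let nonzeroP t : in_codes t -> nonzero st t -> value t != 0.
Proof.
move=> ct /(nonzeroY ct)[y1 y2].
by rewrite /value !mulf_neq0 // signr_eq0.
Qed.

Lemma clash_false l : clash st l = false.
Proof.
apply/negP => /andP[/pluckerP]; case: plucker => // t ts [/= /andP[ct cts]].
rewrite big_cons => sum0 /andP[/(nonzeroP ct)/eqP + zts]; apply.
rewrite -[RHS]sum0 big_seq big1 ?addr0 // => u uts.
by apply: vanishesP; [apply: (allP cts)|apply: (allP zts)].
Qed.

Lemma binomial_relationP l t u : binomial_relation st l = Some (t, u) ->
  [/\ value t = - value u, Y u.2.1 != 0 & Y u.2.2 != 0].
Proof.
rewrite /binomial_relation; case: ifP => // /andP[/pluckerP + _].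
case: plucker => [|t' [|u' [|v []]]] // [/and4P[ct cu cv _]].
rewrite !big_cons big_nil addr0 => sum0; case: ifP => // /andP[zv nu] [<- <-].
have [y1 y2] := nonzeroY cu nu; split=> //.
by move: sum0; rewrite (vanishesP cv zv) addr0 => /eqP; rewrite addr_eq0 => /eqP.
Qed.

(** Relations are multiplied one at a time. Nonvanishing of the brackets on the right is carried
    along, as it allows the product over y to be cancelled. *)
Lemma deriveP ls s x y : derive st ls = Some (s, (x, y)) ->
  \prod_(c <- x) Y c = (-1) ^+ s * \prod_(c <- y) Y c /\ all (fun c => Y c != 0) y.
Proof.
elim: ls s x y => [|l ls IH] s x y /=; first by case=> <- <- <-; rewrite !big_nil mulr1.
case E: binomial_relation => [[[s1 [a b]] [s2 [a' b']]]|] //.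
case F: derive => [[s0 [x0 y0]]|] // [<- <- <-].
have [tu na nb] := binomial_relationP E; have [IHp IHy] := IH _ _ _ F.
rewrite /= in na nb; rewrite /= na nb IHy !big_cons; split=> //.
rewrite !mulrA; have {tu} : Y a * Y b = (-1) ^+ (~~ (s1 (+) s2)) * (Y a' * Y b').
  move: tu; rewrite /value /= => /(congr1 (fun z => (-1) ^+ s1 * z)).
  by rewrite mulrA -signr_addb addbb mul1r => ->; rewrite signrN signr_addb; ring.
by move=> ->; rewrite IHp signr_addb; ring.
Qed.

Lemma bracket_ratioP ls t u s : bracket_ratio st ls t u = Some s -> value u = (-1) ^+ s * value t.
Proof.
rewrite /bracket_ratio; case E: derive => [[s0 [x y]]|] //; case: ifP => // pxy [<-].
have [pr /allP y0] := deriveP E.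
have /mulIf inj : \prod_(c <- y) Y c != 0.
  by rewrite prodf_seq_neq0; apply/allP => c /y0.
(* After the product over x is replaced by its derived value, both sides contain the product over y
   as a factor. *)
have := perm_big _ pxy : \prod_(c <- _) Y c = \prod_(c <- _) Y c.
rewrite !big_cons pr => e; have {}e : (-1) ^+ s0 * (Y u.2.1 * Y u.2.2) = Y t.2.1 * Y t.2.2.
  by apply: inj; rewrite -[RHS]mulrA -e; ring.
rewrite /value !signr_addb -e.
(* The signs of the derivation and of t occur twice and square to 1. *)
transitivity (((-1) ^+ s0 * (-1) ^+ s0) * ((-1) ^+ t.1 * (-1) ^+ t.1) *
   ((-1) ^+ u.1 * (Y u.2.1 * Y u.2.2)) : K); last by ring.
by rewrite -!signr_addb !addbb !mul1r.
Qed.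

Lemma unrealizable_false l ls ls' : unrealizable st l ls ls' = false.
Proof.
apply/negP => /and3P[/pluckerP + _].
case: plucker => [|t [|u [|v []]]] // [/and4P[ct cu cv _]].
rewrite !big_cons big_nil addr0 => sum0 /andP[/(nonzeroP ct) t0].
case E: bracket_ratio => [[]|] //; rewrite (bracket_ratioP E) in sum0.
  (* Here u = - t, so the relation leaves v = 0. *)
  move=> /(nonzeroP cv)/eqP; apply; rewrite -[RHS]sum0 expr1; ring.
rewrite expr0 mul1r in sum0; case/orP => [/(vanishesP cv) v0|/eqP/bracket_ratioP v0].
  (* Here u = t and v = 0, hence 2 t = 0. *)
  move: sum0; rewrite v0 addr0 -mulr2n => /eqP; rewrite mulrn_eq0 /=; exact/negP.
(* Here u = v = t, hence 3 t = 0. *)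
move: sum0; rewrite v0 expr0 mul1r -mulr2n -mulrS => /eqP; rewrite mulrn_eq0 /=; exact/negP.
Qed.
End Soundness.

(** * Canonical orderings *)

Lemma card_check : all (fun x => card (N.of_nat x) ==
  count (mem_code (N.of_nat x)) (iota 0 8)) (iota 0 256).
Proof. by vm_compute. Qed.

Lemma Npos_of_nat p : Pos.to_nat p < 256 -> Npos p = N.of_nat (Pos.to_nat p) /\
  Pos.to_nat p \in iota 0 256.
Proof. by rewrite positive_nat_N mem_iota. Qed.

Lemma indices_elements_pos p : indices (elements p).
Proof.
apply/andP; split; first by rewrite filter_uniq ?iota_uniq.
by apply/allP => i; rewrite mem_filter mem_iota => /andP[].
Qed.

Lemma size_elements_pos p : Pos.to_nat p < 256 -> size (elements p) = card (Npos p).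
Proof.
by move=> /Npos_of_nat[-> /(allP card_check)/eqP->]; rewrite /elements size_filter -positive_nat_N.
Qed.

Lemma commonE p c : Pos.to_nat p < 256 -> c \in codes ->
  common p c = count (mem (elements p)) (elements c).
Proof.
move=> /Npos_of_nat[pE pI] cc; have /allP/(_ c cc)/eqP := allP card_land_check _ pI.
rewrite -pE -[common p c]/(card (N.land (Npos p) (Npos c))) => ->.
rewrite /elements count_filter -size_filter -[RHS]size_filter.
congr size; apply: eq_in_filter => i i8; 
by rewrite [RHS](_ : _ = (i \in elements p) && mem_code (Npos c) i) // mem_filter i8 andbT.
Qed.

(** This contradicts [octic_basis] for the set with mask p: no quadruple that contains enough of its
    planes can still be a basis. *)
Definition crowded st (p : positive) :=
  let k := card (Npos p) in
  [&& k \in [:: 2; 4; 6], Pos.to_nat p < 256 &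
      all (fun c => (common p c < k./2.+1) || known st true c) codes].

(** Strict lexicographic comparison, with the second components on the winning side. An undecided
    bracket before the first difference makes it fail, so success holds for every completion of the
    state. *)
Fixpoint beats st (l : seq (positive * positive)) :=
  if l is (c, c') :: r then
    match PositiveMap.find c st, PositiveMap.find c' st with
    | Some x, Some y => if x == y then beats st r else y
    | _, _ => false
    end
  else false.

Definition moved (g : seq nat) := [seq code (map (nth 0 g) q) | q <- quads].

(** The first letter of a word counts negatively, hence the new first quadruple has to be a basis;
    the old one may be anything. *)
Definition outranks st (l l' : seq positive) :=
  if zip l' l is (_, c) :: r then known st false c && beats st r else false.

Definition noncanonical st g :=
  [&& indices g, size g == 8 & outranks st (moved g) codes].

(** Read as binary numbers, words of equal length are compared lexicographically, and an optimal
    ordering is the maximum of a function to [nat] on a finite group. *)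
Fixpoint binary (s : seq bool) : nat := if s is b :: r then b * 2 ^ size r + binary r else 0.

Lemma binary_lt s : binary s < 2 ^ size s.
Proof.
elim: s => //= b s IH; rewrite expnS mul2n -addnn mulnbl.
by case: b; rewrite ?ltn_add2l // (leq_trans IH) // leq_addr.
Qed.

(* The first quadruple counts negatively, so that the planes 0, 1, 2, 3 of a
   canonical ordering are in general position. *)
Definition rank_word (s : seq bool) : nat := if s is b :: r then binary (~~ b :: r) else 0.

Section Word.
Variable K : numFieldType.
Implicit Type P : 'I_8 -> subspace K.

Definition word P := [seq dep P q | q <- quads].

Definition canonical P := forall s : 'S_8, rank_word (word (P \o s)) <= rank_word (word P).

Lemma wordE P : word P = [seq dep P (elements c) | c <- codes].
Proof. by rewrite /word -elements_codes -map_comp. Qed.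

Lemma octic_comp P (s : 'S_8) : octic_arrangement P -> octic_arrangement (P \o s).
Proof.
case=> P3 Pi P6 P4; have capE (S : {set 'I_8}) :
    (\bigcap_(i in S) P (s i) = \bigcap_(i in (s @: S)%SET) P i)%VS.
  by rewrite big_imset //= => i j _ _; apply: perm_inj.
split=> [i|i j /Pi/perm_inj //|S S6|S S4]; first exact: P3.
  by rewrite capE P6 // card_imset //; apply: perm_inj.
by rewrite capE; apply: P4; rewrite card_imset //; apply: perm_inj.
Qed.

Lemma canonical_ex P : exists s : 'S_8, canonical (P \o s).
Proof.
have [s _ smax] :=
  arg_maxnP (fun s : 'S_8 => rank_word (word (P \o s))) (erefl : xpredT 1%g).
exists s => t; have := smax (t * s)%g isT; congr (rank_word (word _) <= _).
by apply/funext => i; rewrite /= permM.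
Qed.

Lemma dep_comp P (s : 'S_8) g q : all (fun i => i < 8) q ->
    (forall i, i < 8 -> s (inord i) = inord (nth 0 g i)) ->
  dep (P \o s) q = dep P (map (nth 0 g) q).
Proof.
move=> /allP q8 sg; rewrite /dep big_map; congr (_ != _); rewrite big_seq [RHS]big_seq.
by apply: eq_bigr => i /q8 i8; rewrite /= sg.
Qed.

(** Reorderings are lists of images in the certificate but permutations in the definition of minimal
    tables; this lemma and the next translate between the two. *)
Lemma perm_of_indices g : indices g -> size g = 8 ->
  exists s : 'S_8, forall i, i < 8 -> s (inord i) = inord (nth 0 g i).
Proof.
move=> /andP[ug /allP g8] sg; pose f (i : 'I_8) : 'I_8 := inord (nth 0 g i).
have gi (i : 'I_8) : nth 0 g i < 8 by apply/g8/mem_nth; rewrite sg.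
have fi : injective f.
  move=> i j /(congr1 val); rewrite /= !inordK // => /eqP.
  by rewrite nth_uniq ?sg // => /eqP/val_inj.
by exists (perm fi) => i i8; rewrite permE /f inordK.
Qed.

Lemma indices_of_perm (s : 'S_8) : exists g,
  [/\ indices g, size g = 8 & forall i, i < 8 -> s (inord i) = inord (nth 0 g i)].
Proof.
exists [seq val (s (inord i)) | i <- iota 0 8]; split.
- apply/andP; split; last by apply/allP => _ /mapP[i _ ->]; apply: ltn_ord.
  rewrite map_inj_in_uniq ?iota_uniq // => i j; rewrite !mem_iota => i8 j8.
  by move=> /val_inj/perm_inj/(congr1 val); rewrite /= !inordK.
- by rewrite size_map.
by move=> i i8; rewrite (nth_map 0) ?size_iota // nth_iota // inord_val.
Qed.

(** The word of a reordering is read off from P at the moved quadruples, so a state that describes P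
    also gives information on its reorderings. *)
Lemma wordM P (s : 'S_8) g : indices g -> size g = 8 ->
    (forall i, i < 8 -> s (inord i) = inord (nth 0 g i)) ->
  word (P \o s) = [seq dep P (elements c) | c <- moved g].
Proof.
move=> ig sg gs; rewrite /word /moved -map_comp.
apply/eq_in_map => q /(allP quads_indices)/andP[/andP[uq q8] /eqP q4] /=.
rewrite (dep_comp _ q8 gs); apply/esym/dep_perm/elements_code_perm; rewrite ?size_map //.
by apply: indices_nth => //; rewrite sg.
Qed.

Section Agrees.
Variables (P : 'I_8 -> subspace K) (st : state).
Hypotheses (oP : octic_arrangement P) (agr : agrees P st).

Lemma crowded_false p : crowded st p = false.
Proof.
apply/negP => /and3P[kp p8 /allP cr].
have [|l [il l4 ndl cl]] := octic_basis oP (indices_elements_pos p).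
  by rewrite size_elements_pos.
have cc := code_in il l4; have pl := elements_code_perm il l4.
have := cr _ cc; rewrite commonE // (seq.permP pl) ltnNge -size_elements_pos // cl /=.
by move=> /(knownP agr); rewrite (dep_perm _ pl) (negPf ndl).
Qed.

Lemma beatsP (l l' : seq positive) : size l = size l' -> beats st (zip l l') ->
  binary [seq dep P (elements c) | c <- l] < binary [seq dep P (elements c) | c <- l'].
Proof.
elim: l l' => [|c l IH] [|c' l'] //= [sl].
case E: PositiveMap.find => [x|] //; case E': PositiveMap.find => [y|] //.
rewrite (agr E) (agr E') !size_map sl; case: eqP => [-> /(IH _ sl)|].
  by rewrite ltn_add2l.
case: x y {E E'} => [] [] // _ _; rewrite !mulnbl add0n.
(* At the first difference the larger word has the digit 1, which outweighs all remaining digits of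
   the smaller one. *)
rewrite (leq_trans (binary_lt _)) // size_map sl; exact: leq_addr.
Qed.

Lemma outranksP (l l' : seq positive) : size l = size l' -> outranks st l l' ->
  rank_word [seq dep P (elements c) | c <- l'] < rank_word [seq dep P (elements c) | c <- l].
Proof.
case: l l' => [|c l] [|c' l'] //= [/esym sl] /andP[kc /(beatsP sl)].
rewrite (knownP agr kc) /= !size_map sl !mulnbl => lt.
(* If the old first quadruple is dependent, its leading digit is 0 and the new word wins at once;
   otherwise the leading digits agree and the tails decide. *)
rewrite mul1n; case: (dep P (elements c')); rewrite /= ?ltn_add2l //.
by rewrite (leq_trans lt) ?leq_addl.
Qed.

Lemma noncanonical_false g : canonical P -> noncanonical st g = false.
Proof.
move=> can; apply/negP => /and3P[ig /eqP sg /outranksP].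
have [s gs] := perm_of_indices ig sg.
have := can s; rewrite (wordM P ig sg gs) wordE leqNgt => /negP nlt /(_ _)/nlt; apply.
by rewrite /moved size_map -elements_codes size_map.
Qed.
End Agrees.
End Word.
Arguments word : simpl never.

(** * The case distinction *)

(** The most significant digit comes first, so a numeral reads as the list of indices; the fixed
    length n restores leading zeros. *)
Fixpoint digits (n : nat) (x : N) : seq nat :=
  if n is n'.+1 then rcons (digits n' (N.shiftr x 4)) (N.to_nat (N.land x 15)) else [::].

(* Digits of hexadecimal numbers are indices of planes. [B c t u]: case distinction on
   the dependence of c; [G], [E]: a violated three- or four-term Pluecker relation;
   [P]: a violated axiom of octic arrangements; [Y]: a reordering that contradicts
   canonicity; [U]: a multiplicative consequence of the Pluecker relations that is
   impossible in characteristic 0; [L]: a complete word. *)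
Inductive tree :=
| L
| B of positive & tree & tree
| G of N
| E of N
| P of positive
| Y of N
| U of N & seq N & seq N.

(** A refuted branch contributes no word, whereas a failed check invalidates the whole run. *)
Definition closed (b : bool) (acc : seq (seq bool)) := if b then Some acc else None.

Fixpoint sequence (l : seq (option bool)) :=
  if l is x :: l' then if x is Some b then omap (cons b) (sequence l') else None else Some [::].

Definition leaf_word (st : state) := sequence [seq PositiveMap.find c st | c <- codes].

Arguments leaf_word : simpl never.
Arguments clash : simpl never.
Arguments crowded : simpl never.
Arguments noncanonical : simpl never.
Arguments unrealizable : simpl never.
Arguments digits : simpl never.

(* The words at the leaves, from left to right; [None] if some branch is not closed. *)
Fixpoint run (t : tree) (st : state) (acc : seq (seq bool)) : option (seq (seq bool)) :=
  match t with
  | L => omap (cons^~ acc) (leaf_word st)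
  | B c t u => obind (run t (PositiveMap.add c true st)) (run u (PositiveMap.add c false st) acc)
  | G x => closed (clash st (digits 6 x)) acc
  | E x => closed (clash st (digits 7 x)) acc
  | P p => closed (crowded st p) acc
  | Y x => closed (noncanonical st (digits 8 x)) acc
  | U x l l' => closed (unrealizable st (digits 6 x) (map (digits 6) l) (map (digits 6) l')) acc
  end.

Definition start : state := PositiveMap.add (code [:: 0; 1; 2; 3]) false (PositiveMap.empty bool).

Lemma perm_cat_rest (T : eqType) (l r : seq T) : uniq l -> uniq r -> {subset l <= r} ->
  perm_eq (l ++ [seq i <- r | i \notin l]) r.
Proof.
move=> ul ur lr; apply: uniq_perm => // [|i].
  rewrite cat_uniq ul filter_uniq // andbT; apply/hasPn => i.
  by rewrite mem_filter => /andP[].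
by rewrite mem_cat mem_filter; case: (boolP (i \in l)) => // /lr ->.
Qed.

Section Run.
Variable K : numFieldType.
Variable Q : 'I_8 -> subspace K.
Hypotheses (oQ : octic_arrangement Q) (canQ : canonical Q).

(** Moving some basis to the front gives a word with leading digit 1. If the first quadruple of Q
    were dependent, the leading digit of Q would be 0, against maximality. This justifies the entry
    in [start]. *)
Lemma canonical_basis : dep Q [:: 0; 1; 2; 3] = false.
Proof.
(* The pair 0, 1 is an arbitrary choice: only the existence of a basis matters. *)
have [l [il l4 ndl _]] := @octic_basis _ Q [:: 0; 1] oQ isT isT.
have [ul /allP l8] := andP il; pose g := l ++ [seq i <- iota 0 8 | i \notin l].
have pg : perm_eq g (iota 0 8).
  by apply: perm_cat_rest; rewrite ?iota_uniq // => i /l8; rewrite mem_iota.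
have ig : indices g.
  by rewrite /indices (perm_uniq pg) iota_uniq (perm_all _ pg).
have sg : size g = 8 by rewrite (perm_size pg).
have [s gs] := perm_of_indices ig sg; apply/negbTE/negP => d0.
have := canQ s; have d1 : dep (Q \o s) [:: 0; 1; 2; 3] = false.
  rewrite (dep_comp _ _ gs) // -(negPf ndl) /g; congr dep.
  by case: l l4 {il ndl ul l8 g pg ig sg gs} => [|? [|? [|? [|? []]]]].
(* The leading letter decides, so the other 69 quadruples can be generalized. *)
have wcons P : word P = dep P [:: 0; 1; 2; 3] :: [seq dep P q | q <- behead quads] by [].
rewrite leqNgt => /negP; apply; rewrite !wcons d0 d1 /rank_word; move: (behead quads) => r.
rewrite /= !size_map mul1n mul0n add0n.
by apply: leq_trans (binary_lt _) _; rewrite size_map leq_addr.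
Qed.

Lemma agrees_add st c : agrees Q st -> agrees Q (PositiveMap.add c (dep Q (elements c)) st).
Proof.
move=> agr c' b; have [->|/eqP cc'] := eqVneq c c'.
  by rewrite PositiveMap.gss => -[].
by rewrite PositiveMap.gso => [/agr//|/esym].
Qed.

Lemma start_agrees : agrees Q start.
Proof.
rewrite /start -canonical_basis -[in dep _ _]/(elements (code [:: 0; 1; 2; 3])).
by apply: agrees_add => c b; rewrite PositiveMap.gempty.
Qed.

Lemma sequence_agrees st l w : agrees Q st ->
  sequence [seq PositiveMap.find c st | c <- l] = Some w -> w = [seq dep Q (elements c) | c <- l].
Proof.
move=> agr; elim: l w => [|c l IH] w /=; first by case.
case F: PositiveMap.find => [b|] //; case S: sequence => [w'|] //= [<-].
by rewrite (agr _ _ F) (IH _ S).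
Qed.

Lemma closed_sound st b acc ws : (agrees Q st -> b = false) -> closed b acc = Some ws ->
  {subset acc <= ws} /\ (agrees Q st -> word Q \in ws).
Proof. by case: b => // bF [<-]; split=> // /bF. Qed.

(** At each case distinction the true dependence of Q selects the branch in which the state still
    agrees with Q. The inclusion is part of the induction because words found in one branch have to
    survive the run of the other. *)
Lemma run_sound t st acc ws : run t st acc = Some ws ->
  {subset acc <= ws} /\ (agrees Q st -> word Q \in ws).
Proof.
have [d3 _ _ _] := oQ.
have /boolp.choice[n Qn] : forall i : nat, exists m, Q (inord i) = hyperplane m.
  by move=> i; have [m _ ->] := hyperplaneP (d3 (inord i)); exists m.
elim: t st acc ws => [|c t IHt u IHu|x|x|x|x|x l l'] st acc ws; cbn [run].
- case S: leaf_word => [w|] // [<-]; split=> [v va|agr]; first by rewrite inE va orbT.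
  by rewrite wordE -(sequence_agrees agr S) mem_head.
- case R: run => [a|] // R'; have [aw wt] := IHt _ _ _ R'; have [acca wu] := IHu _ _ _ R.
  split=> [v /acca/aw //|/(@agrees_add _ c)].
  by case: (dep Q (elements c)) => [/wt|/wu/aw].
- by apply: closed_sound => agr; apply: clash_false Qn _ agr _.
- by apply: closed_sound => agr; apply: clash_false Qn _ agr _.
- by apply: closed_sound => agr; apply: crowded_false oQ agr _.
- by apply: closed_sound => agr; apply: noncanonical_false agr _ canQ.
- by apply: closed_sound => agr; apply: unrealizable_false Qn _ agr _ _ _.
Qed.
End Run.

(** * Realizations *)

Definition subsets : seq positive := Eval vm_compute in
  [seq p <- [seq Pos.of_nat i | i <- iota 1 255] | card (Npos p) \in [:: 2; 4; 6]].

(** The conclusion of [octic_basis] as a test on complete words; [octic_of_spanning] shows that the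
    test implies the axioms. *)
Definition spanning (s : seq bool) : bool :=
  let bases := mask (map negb s) codes in
  all (fun p => let k := (card (Npos p))./2.+1 in has (fun c => k <= common p c) bases) subsets.

Lemma spanningP s p : spanning s -> p \in subsets ->
  exists2 c, c \in mask (map negb s) codes & (card (Npos p))./2 < common p c.
Proof. by rewrite /spanning; move: subsets => l /allP/(_ p) sp /sp/hasP. Qed.

(** The empty list is excluded because its default code is also the code of [[:: 0]]. *)
Lemma elements_filter (a : pred nat) (T := [seq i <- iota 0 8 | a i]) :
  T != [::] -> elements (code T) = T /\ Pos.to_nat (code T) < 256.
Proof.
rewrite {}/T /=.
by case: (a 0); case: (a 1); case: (a 2); case: (a 3); case: (a 4); case: (a 5); case: (a 6);
  case: (a 7) => //= _; split; vm_compute.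
Qed.

Lemma subsetsP p : Pos.to_nat p < 256 -> card (Npos p) \in [:: 2; 4; 6] -> p \in subsets.
Proof.
move=> p8 kp; have -> : subsets =
  [seq p <- [seq Pos.of_nat i | i <- iota 1 255] | card (Npos p) \in [:: 2; 4; 6]] by vm_compute.
rewrite mem_filter kp andTb; apply/mapP; exists (Pos.to_nat p); last by rewrite Pos2Nat.id.
by rewrite mem_iota p8 andbT; apply/ssrnat.ltP/Pos2Nat.is_pos.
Qed.

Section Realize.
Variable K : numFieldType.
Implicit Type P : 'I_8 -> subspace K.

Lemma spanning_basis P (S : {set 'I_8}) : spanning (word P) -> #|S| \in [:: 2; 4; 6] ->
  exists q, [/\ indices q, size q = 4, ~~ dep P q & (#|S|)./2 < count (fun i => inord i \in S) q].
Proof.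
move=> spw kS; pose T := [seq i <- iota 0 8 | inord i \in S].
have sT : size T = #|S|.
  rewrite cardE -(size_map val); apply/perm_size/uniq_perm.
  - by rewrite filter_uniq ?iota_uniq.
  - by rewrite map_inj_uniq ?enum_uniq //; apply: val_inj.
  move=> i; rewrite mem_filter mem_iota add0n; apply/andP/mapP => [[iS /= i8]|[j jS ->]].
    by exists (inord i); rewrite ?mem_enum // inordK.
  by rewrite /= inord_val ltn_ord; move: jS; rewrite mem_enum.
have /elements_filter[eT T8] : T != [::] by apply: contraL kS => /eqP T0; rewrite -sT T0.
have kT : card (Npos (code T)) = #|S| by rewrite -size_elements_pos // eT sT.
have [|c] := spanningP spw (subsetsP T8 _); first by rewrite kT.
rewrite wordE -map_comp -filter_mask mem_filter => /andP[ndc cc].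
rewrite kT commonE // eT => kc; exists (elements c).
split=> //; rewrite ?indices_elements ?size_elements //.
apply: leq_trans kc (eq_leq _); apply: eq_in_count => i ic.
rewrite [LHS](_ : _ = (i \in T)) // mem_filter mem_iota leq0n add0n.
by have [_ /allP/(_ _ ic) ->] := andP (indices_elements cc); rewrite !andbT.
Qed.

(** Bases with two elements in a pair give proper and distinct planes, bases inside any six planes
    exclude a common point, and bases with three elements among any four exclude a common line. *)
Lemma octic_of_spanning P (n : 'I_8 -> 'rV[K]_4) : (forall i, P i = hyperplane (n i)) ->
  spanning (word P) -> octic_arrangement P.
Proof.
move=> Pn sp; have Pn' i : P (inord i) = hyperplane (n (inord i)) by [].
(* For a pair the bound is 2, so any two planes belong to a common basis. A zero normal or a
   repeated plane would make the bracket of that basis vanish. *)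
have pair (i j : 'I_8) : i != j -> exists a b, ~~ dep P [:: val i; val j; a; b].
  move=> ij; have [|q [/andP[uq /allP q8] q4 ndq]] := spanning_basis (S := [set i; j]) sp.
    by rewrite cards2 ij.
  rewrite cards2 ij /= -size_filter; set f := filter _ q => cq.
  have fS : {subset f <= [:: val i; val j]}.
    move=> x; rewrite mem_filter !inE => /andP[xS /q8 x8].
    by rewrite -(inordK x8); case/orP: xS => /eqP->; rewrite eqxx ?orbT.
  have [_ fE] := uniq_min_size (filter_uniq _ uq) fS cq.
  have iq : val i \in q.
    have : val i \in f by rewrite fE !inE eqxx.
    by rewrite mem_filter => /andP[].
  have jq : val j \in rem (val i) q.
    rewrite mem_rem_uniq // inE /= eq_sym val_eqE ij /=.
    have : val j \in f by rewrite fE !inE eqxx orbT.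
    by rewrite mem_filter => /andP[].
  have := size_rem jq; rewrite (size_rem iq) q4.
  case E: (rem (val j) _) => [|a [|b []]] // _; exists a, b.
  suff /dep_perm <- : perm_eq q [:: val i; val j; a; b] by [].
  by rewrite (seq.permPl (perm_to_rem iq)) perm_cons -E perm_to_rem.
have two (i : 'I_8) : exists j, i != j.
  exists (if val i == 0 then inord 1 else ord0).
  by case: i => [[|i] i8]; rewrite -val_eqE /= ?inordK.
have vd (i : 'I_8) : P (inord (val i)) = P i by rewrite inord_val.
split=> [i|i j Pij|S S6|S S4].
- rewrite Pn dim_hyperplane //; apply/eqP => n0.
  have [j /pair[a [b /negP]]] := two i; apply.
  rewrite (dep_bracket _ _ _ _ Pn') inord_val n0 /coords !mxE /bracket /det4 /=.
  by apply/eqP; ring.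
- apply/eqP/negPn/negP => /pair[a [b /negP]]; apply.
  (* The repeated index is moved to the middle, where [bracket_eq] applies. *)
  rewrite (_ : dep P _ = dep P [:: a; val j; val j; b]); last first.
    rewrite -[RHS](dep_perm P (l := [:: val j; val j; a; b])).
      by rewrite /dep !big_cons !vd Pij.
    by apply/seq.permP => x /=; lia.
  by rewrite (dep_bracket _ _ _ _ Pn') bracket_eq.
- have [|q [/andP[uq q8] q4 ndq]] := spanning_basis (S := S) sp; first by rewrite S6.
  rewrite S6 /= -{1}q4 => cq; apply/eqP; rewrite -subv0.
  (* For six planes the bound is 4, so the whole basis lies in S. *)
  have /allP qS : all (fun i => inord i \in S) q by rewrite all_count eqn_leq count_size.
  rewrite /dep negbK in ndq; rewrite -(eqP ndq); apply/subvP => y.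
  rewrite -big_enum !mem_bigcap => /allP yS; apply/allP => i iq.
  by apply: yS; rewrite mem_enum qS.
- have [|q [/andP[uq /allP q8] q4 ndq]] := spanning_basis (S := S) sp; first by rewrite S4.
  rewrite S4 /= => cq [M M2 MS].
  (* At most one member of the basis lies outside S; it is taken for x. If there is none, the head
     of q serves. *)
  have [x xq xS] : exists2 x, x \in q & {in rem x q, forall i, inord i \in S}.
    have [/allP qS|/allPn[x xq xS]] := boolP (all (fun i => inord i \in S) q).
      by exists (head 0 q) => [|i /mem_rem/qS //]; case: (q) q4 => // a l _; apply: mem_head.
    exists x => // i iq; apply/negPn/negP => iS.
    have c2 : 2 <= count (predC (fun i => inord i \in S)) q.
      by rewrite (seq.permP (perm_to_rem xq)) /= xS ltnS -has_count; apply/hasP; exists i.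
    by have := leq_add cq c2; rewrite count_predC q4.
  (* The line M lies in the other three planes of the basis, hence meets the plane of x in 0 only;
     but 2 + 3 exceeds 4. *)
  have := dimv_sum_cap M (P (inord x)).
  have -> : (M :&: P (inord x) = 0)%VS.
    rewrite /dep negbK in ndq; apply/eqP; rewrite -subv0 -(eqP ndq).
    rewrite (perm_big _ (perm_to_rem xq)) /= big_cons capvC capvS //.
    apply/subvP => y /(subvP MS); rewrite -big_enum !mem_bigcap => /allP yS.
    by apply/allP => i /xS iS; apply: yS; rewrite mem_enum.
  have P3 : \dim (P (inord x)) = 3.
    rewrite Pn dim_hyperplane //; apply/eqP => n0.
    have [j /pair[a [b /negP]]] := two (inord x); apply.
    rewrite (dep_bracket _ _ _ _ Pn') inord_val n0 /coords !mxE /bracket /det4 /=.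
    by apply/eqP; ring.
  have := dimvS (subvf (M + P (inord x))%VS); rewrite M2 P3 dimv0 dimvf /dim /=; lia.
Qed.
End Realize.

(** * Exact evaluation of brackets in quadratic integers *)

Section Brackets.
Variables (T : Type) (add sub mul : T -> T -> T).

(* The nesting shares the minors of the last rows. *)
Definition brackets (v : nat -> vec T) : seq T :=
  flatten [seq flatten [seq let m := minor2 sub mul (v c) (v d) in
    flatten [seq let n := minor3 add sub mul (v b) m in
      [seq minor4 add sub mul (v a) n | a <- iota 0 b]
    | b <- iota 0 c] | c <- iota 0 d] | d <- iota 0 8].

(** [quads] has been computed from the same nesting, so both sides reduce to the same 70
    determinants. *)
Lemma bracketsE v : brackets v =
  [seq det4 add sub mul (v (nth 0 q 0)) (v (nth 0 q 1)) (v (nth 0 q 2)) (v (nth 0 q 3))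
  | q <- quads].
Proof. by []. Qed.
End Brackets.

(* [(a, b)] stands for a + b * alpha, where alpha ^ 2 = e.1 * alpha + e.2. *)
Definition zpair := (Z * Z)%type.
Definition add_pair (x y : zpair) : zpair := (Z.add x.1 y.1, Z.add x.2 y.2).
Definition sub_pair (x y : zpair) : zpair := (Z.sub x.1 y.1, Z.sub x.2 y.2).
Definition mul_pair (e x y : zpair) : zpair :=
  let c := Z.mul x.2 y.2 in
  (Z.add (Z.mul x.1 y.1) (Z.mul e.2 c),
   Z.add (Z.add (Z.mul x.1 y.2) (Z.mul x.2 y.1)) (Z.mul e.1 c)).
Definition norm_pair (e x : zpair) : Z :=
  Z.sub (Z.add (Z.mul x.1 x.1) (Z.mul e.1 (Z.mul x.1 x.2))) (Z.mul e.2 (Z.mul x.2 x.2)).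
Definition is0 (x : zpair) := Z.eqb x.1 0 && Z.eqb x.2 0.

Section Evaluation.
Variables (K : numFieldType) (e : zpair) (alpha : K).
Local Open Scope ring_scope.
Local Notation zK z := ((int_of_Z z)%:~R : K).
Hypothesis alpha2 : alpha ^+ 2 = zK e.1 * alpha + zK e.2.

Definition eval (x : zpair) : K := zK x.1 + zK x.2 * alpha.
Definition eval_vec (v : vec zpair) : vec K :=
  (eval v.1.1.1, eval v.1.1.2, eval v.1.2, eval v.2).

Lemma eval_add x y : eval (add_pair x y) = eval x + eval y.
Proof. by rewrite /eval /= (rmorphD int_of_Z) (rmorphD int_of_Z) !intrD; ring. Qed.

Lemma eval_sub x y : eval (sub_pair x y) = eval x - eval y.
Proof. by rewrite /eval /= (rmorphB int_of_Z) (rmorphB int_of_Z) !intrB; ring. Qed.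

Lemma eval_mul x y : eval (mul_pair e x y) = eval x * eval y.
Proof.
have -> : eval x * eval y = zK x.1 * zK y.1 + (zK x.1 * zK y.2 + zK x.2 * zK y.1) * alpha
  + zK x.2 * zK y.2 * alpha ^+ 2 by rewrite /eval; ring.
rewrite alpha2 /eval /= 3!(rmorphD int_of_Z) 6!(rmorphM int_of_Z) !intrD !intrM; ring.
Qed.

(** [e.1 - alpha] is the other root of the quadratic polynomial, so the second factor is the
    conjugate of the first. *)
Lemma eval_norm x : zK (norm_pair e x) = eval x * (zK x.1 + zK x.2 * (zK e.1 - alpha)).
Proof.
have -> : eval x * (zK x.1 + zK x.2 * (zK e.1 - alpha)) = zK x.1 ^+ 2 +
  zK e.1 * zK x.1 * zK x.2 + zK x.2 ^+ 2 * (zK e.1 * alpha - alpha ^+ 2) by rewrite /eval; ring.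
rewrite alpha2 /norm_pair (rmorphB int_of_Z) (rmorphD int_of_Z) 5!(rmorphM int_of_Z).
by rewrite intrB intrD !intrM; ring.
Qed.

Lemma zK_eq0 z : (zK z == 0) = Z.eqb z 0.
Proof.
rewrite intr_eq0; apply/eqP/idP => [|/Z.eqb_eq -> //].
by move=> /(congr1 Z_of_int); rewrite int_of_ZK => ->.
Qed.

(** A nonzero integral norm stays nonzero in characteristic 0 and forces its factor [eval x] to be
    nonzero, whichever root alpha is. *)
Lemma eval_eq0 x : is0 x || ~~ Z.eqb (norm_pair e x) 0 -> (eval x == 0) = is0 x.
Proof.
rewrite -zK_eq0 eval_norm mulf_eq0 negb_or; case: (boolP (is0 x)) => [|_ /andP[/negPf //]].
by case/andP=> /Z.eqb_eq x1 /Z.eqb_eq x2 _; rewrite /eval x1 x2 mul0r addr0 eqxx.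
Qed.

Lemma eval_det4 x y z w : eval (det4 add_pair sub_pair (mul_pair e) x y z w) =
  bracket (eval_vec x) (eval_vec y) (eval_vec z) (eval_vec w).
Proof.
move: x y z w => [[[? ?] ?] ?] [[[? ?] ?] ?] [[[? ?] ?] ?] [[[? ?] ?] ?].
rewrite /bracket /det4 /minor4 /minor3 /minor2 /eval_vec /fst /snd.
by rewrite !(eval_add, eval_sub, eval_mul).
Qed.
End Evaluation.

(* The vectors are the unit vectors and the four rows of [m.2]. *)
Definition configuration := (zpair * seq zpair)%type.

Definition row (m : configuration) (i : nat) : vec zpair :=
  let o := (Z0, Z0) in let l := (Zpos 1, Z0) in
  nth (o, o, o, o) ([:: (l, o, o, o); (o, l, o, o); (o, o, l, o); (o, o, o, l)] ++
    [seq (nth o m.2 (4 * k), nth o m.2 (4 * k + 1), nth o m.2 (4 * k + 2), nth o m.2 (4 * k + 3))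
    | k <- iota 0 4]) i.

Definition brackets_of (m : configuration) : seq zpair :=
  brackets add_pair sub_pair (mul_pair m.1) (row m).

Definition word_of (m : configuration) : seq bool := map is0 (brackets_of m).

Definition decided (m : configuration) : bool :=
  all (fun x => is0 x || ~~ Z.eqb (norm_pair m.1 x) 0) (brackets_of m).

Section Realization.
Variable K : numClosedFieldType.
Local Open Scope ring_scope.

Definition vector (x : vec K) : 'rV[K]_4 :=
  \row_j nth 0 [:: x.1.1.1; x.1.1.2; x.1.2; x.2] j.

Lemma vectorK x : coords (vector x) = x.
Proof. by case: x => [[[a b] c] d]; rewrite /coords !mxE. Qed.

Lemma realize m : decided m -> spanning (word_of m) ->
  exists2 P : 'I_8 -> subspace K, octic_arrangement P & word P = word_of m.
Proof.
move=> dm sm; pose zK z : K := (int_of_Z z)%:~R.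
have [alpha alpha2] : exists alpha, alpha ^+ 2 = zK m.1.1 * alpha + zK m.1.2.
  (* Algebraic closedness provides a root of the quadratic polynomial prescribed by the
     configuration. *)
  have [x xE] := @solve_monicpoly K 2 (fun i => if i == 0%N then zK m.1.2 else zK m.1.1) isT.
  by exists x; rewrite xE !big_ord_recl big_ord0 /= expr0 expr1 mulr1 addr0 addrC.
pose n (i : nat) := vector (eval_vec alpha (row m i)).
pose P (i : 'I_8) := hyperplane (n i).
have wP : word P = word_of m.
  rewrite /word /word_of /brackets_of bracketsE -map_comp; apply/eq_in_map => q qq.
  have /andP[/andP[_ /allP q8] /eqP q4] := allP quads_indices q qq.
  have -> : dep P q = (bracket (coords (n (nth 0 q 0)%N)) (coords (n (nth 0 q 1)%N))
     (coords (n (nth 0 q 2)%N)) (coords (n (nth 0 q 3)%N)) == 0).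
    have -> : dep P q = dep P [:: nth 0 q 0; nth 0 q 1; nth 0 q 2; nth 0 q 3]%N.
      by case: q q4 {qq q8} => [|a [|b [|c [|d []]]]].
    (* [dep_bracket] asks for a normal of [P (inord i)] for every natural number i, also beyond
       7. *)
    rewrite (dep_bracket (n := fun i => n (inord i : 'I_8))) //.
    by rewrite !inordK // q8 // mem_nth ?q4.
  rewrite /n !vectorK -(eval_det4 alpha2) (eval_eq0 alpha2) //.
  by apply: (allP dm); rewrite /brackets_of bracketsE; apply/mapP; exists q.
exists P => //; apply: (@octic_of_spanning _ _ (fun i => n i)) => //.
by rewrite wP.
Qed.
End Realization.

(** * An invariant of words *)

Definition sumN T (f : T -> N) (l : seq T) : N := foldr (fun x => N.add (f x)) N0 l.
Definition squareN (n : N) : N := N.mul n n.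

Definition card2 (a b : positive) : N := N.of_nat (card (N.land (Npos a) (Npos b))).
Definition card3 (a b c : positive) : N :=
  N.of_nat (card (N.land (N.land (Npos a) (Npos b)) (Npos c))).

(* The exponents are chosen so that the invariant separates the 455 words. *)
Definition weight a b c : N :=
  let x := card3 a b c in let y := card2 b c in let z := card2 a c in
  N.mul (N.mul (N.succ (squareN x)) (N.succ (squareN y))) (N.succ (N.mul z (squareN z))).

(** Only sizes of intersections of dependent quadruples enter, which gives invariance. The squares
    between the nested sums retain how incidences are distributed, which a plain sum would average
    out. *)
Definition triple_sum (l : seq positive) : N :=
  sumN (fun a => squareN (sumN (fun b =>
    N.mul (squareN (sumN (weight a b) l)) (N.succ (card2 a b))) l)) l.

Definition degree (l : seq positive) (i : nat) : N :=
  sumN (fun c => if mem_code (Npos c) i then 1%num else 0%num) l.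

(** The second summand records in how many dependent quadruples each plane occurs, up to the order
    of the planes. *)
Definition invariant_codes (l : seq positive) : N :=
  N.add (triple_sum l) (sumN (fun i => squareN (squareN (degree l i))) (iota 0 8)).

Definition invariant (s : seq bool) : N := invariant_codes (mask s codes).

Lemma sumN_nat T (f : T -> N) l : N.to_nat (sumN f l) = \sum_(x <- l) N.to_nat (f x).
Proof. by elim: l => [|x l IH]; rewrite ?big_nil //= big_cons N2Nat.inj_add IH. Qed.

Lemma perm_sumN (T : eqType) (f : T -> N) l l' : perm_eq l l' -> sumN f l = sumN f l'.
Proof. by move=> ll'; apply: N2Nat.inj; rewrite !sumN_nat (perm_big _ ll'). Qed.

Lemma eq_in_sumN (T : eqType) (f h : T -> N) l : {in l, f =1 h} -> sumN f l = sumN h l.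
Proof.
elim: l => //= x l IH fh; rewrite fh ?mem_head // IH // => y yl.
by apply: fh; rewrite inE yl orbT.
Qed.

Lemma sumN_map T T' (h : T' -> T) (f : T -> N) l : sumN f (map h l) = sumN (f \o h) l.
Proof. by elim: l => //= x l ->. Qed.

Lemma perm_invariant_codes l l' : perm_eq l l' -> invariant_codes l = invariant_codes l'.
Proof.
move=> ll'; rewrite /invariant_codes /triple_sum; congr N.add.
  rewrite (perm_sumN _ ll'); apply: eq_in_sumN => a _; congr squareN.
  rewrite (perm_sumN _ ll'); apply: eq_in_sumN => b _; congr (N.mul (squareN _) _).
  exact: perm_sumN.
by apply: eq_in_sumN => i _; rewrite /degree (perm_sumN _ ll').
Qed.

Lemma code_elements_check : map (code \o elements) codes = codes.
Proof. by vm_compute. Qed.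

Lemma codes_uniq : uniq codes.
Proof. by vm_compute. Qed.

Lemma codes_lt : all (fun c => Pos.to_nat c < 256) codes.
Proof. by vm_compute. Qed.

Lemma code_elements c : c \in codes -> code (elements c) = c.
Proof.
move=> cc.
suff /eq_in_map/(_ c cc) : map (code \o elements) codes = map id codes by [].
by rewrite code_elements_check map_id.
Qed.

Lemma mem_elements p i : i < 8 -> (i \in elements p) = mem_code (Npos p) i.
Proof. by move=> i8; rewrite mem_filter mem_iota leq0n i8 !andbT. Qed.

Lemma card_land n c : N.to_nat n < 256 -> c \in codes ->
  card (N.land n (Npos c)) = count (fun i => mem_code n i && mem_code (Npos c) i) (iota 0 8).
Proof.
move=> n8 cc; have n8' : N.to_nat n \in iota 0 256 by rewrite mem_iota n8.
by have := allP (allP card_land_check _ n8') c cc; rewrite N2Nat.id => /eqP.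
Qed.

Lemma card2E a b : a \in codes -> b \in codes ->
  card2 a b = N.of_nat (count (fun i => mem_code (Npos a) i && mem_code (Npos b) i) (iota 0 8)).
Proof. by move=> ac bc; rewrite /card2 card_land // positive_N_nat; apply: (allP codes_lt). Qed.

Lemma card3E a b c : a \in codes -> b \in codes -> c \in codes ->
  card3 a b c = N.of_nat (count (fun i => [&& mem_code (Npos a) i, mem_code (Npos b) i
    & mem_code (Npos c) i]) (iota 0 8)).
Proof.
move=> ac bc cc; rewrite /card3 card_land //.
  by congr N.of_nat; apply: eq_count => i; rewrite {1}/mem_code N.land_spec andbA.
have := allP codes_lt b bc; have := N.land_le_r (Npos a) (Npos b); lia.
Qed.

Lemma perm_map_self (T : eqType) (f : T -> T) l : uniq l -> {in l &, injective f} ->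
  {subset map f l <= l} -> perm_eq (map f l) l.
Proof.
move=> ul fi sub; have u : uniq (map f l) by rewrite map_inj_in_uniq.
have [|_ E] := uniq_min_size u sub; first by rewrite size_map.
exact: uniq_perm.
Qed.

(** * Invariance under relabelling of the planes *)

Section Relabel.
Variable g : seq nat.
Hypotheses (ig : indices g) (sg : size g = 8).

Definition relabel (c : positive) : positive := code (map (nth 0 g) (elements c)).

Let ug : uniq g. Proof. by case/andP: ig. Qed.

Let g8 i : i < 8 -> nth 0 g i < 8.
Proof. by case/andP: ig => _ /allP g8 i8; apply/g8/mem_nth; rewrite sg. Qed.

Let permg : perm_eq g (iota 0 8).
Proof.
have sub : {subset g <= iota 0 8}.
  by case/andP: ig => _ /allP g8' i /g8'; rewrite mem_iota.
have [|_ gE] := uniq_min_size ug sub; first by rewrite sg.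
by apply: uniq_perm; rewrite ?iota_uniq //; apply: gE.
Qed.

Let ilabel c : c \in codes -> indices (map (nth 0 g) (elements c)) /\
  size (map (nth 0 g) (elements c)) = 4.
Proof.
move=> cc; rewrite size_map size_elements //; split=> //.
have [uc c8] := andP (indices_elements cc); apply: indices_nth => //.
by rewrite sg.
Qed.

Lemma relabel_in c : c \in codes -> relabel c \in codes.
Proof. by case/ilabel => *; apply: code_in. Qed.

Lemma relabel_perm c : c \in codes -> perm_eq (elements (relabel c)) (map (nth 0 g) (elements c)).
Proof. by case/ilabel => *; apply: elements_code_perm. Qed.

Lemma mem_relabel c i : c \in codes -> i < 8 ->
  mem_code (Npos (relabel c)) (nth 0 g i) = mem_code (Npos c) i.
Proof.
move=> cc i8; rewrite -!mem_elements ?g8 // (perm_mem (relabel_perm cc)).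
apply/mapP/idP => [[j jc /eqP]|ic]; last by exists i.
have [_ /allP/(_ _ jc) j8] := andP (indices_elements cc).
by rewrite nth_uniq ?sg // => /eqP ->.
Qed.

Lemma relabel_inj : {in codes &, injective relabel}.
Proof.
move=> c c' cc cc' e; rewrite -(code_elements cc) -(code_elements cc'); congr code.
apply: eq_in_filter => i; rewrite mem_iota => i8.
by rewrite -(mem_relabel cc i8) -(mem_relabel cc' i8) e.
Qed.

Lemma perm_relabel : perm_eq (map relabel codes) codes.
Proof.
apply: perm_map_self codes_uniq relabel_inj _.
by move=> _ /mapP[c cc ->]; apply: relabel_in.
Qed.

Let count_relabel (a b : pred nat) : (forall i, i < 8 -> a (nth 0 g i) = b i) ->
  count a (iota 0 8) = count b (iota 0 8).
Proof.
move=> ab; rewrite -(seq.permP permg) -{1}(mkseq_nth 0 g) sg count_map.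
by apply: eq_in_count => i; rewrite mem_iota => /ab.
Qed.

(** Relabelling preserves the sizes of double and triple intersections and permutes the degrees of
    the planes. *)
Lemma invariant_codes_relabel l : {subset l <= codes} ->
  invariant_codes (map relabel l) = invariant_codes l.
Proof.
move=> lc; rewrite /invariant_codes; congr N.add.
  rewrite /triple_sum sumN_map; apply: eq_in_sumN => a /lc ac /=; congr squareN.
  rewrite sumN_map; apply: eq_in_sumN => b /lc bc /=.
  have c2 x y : x \in codes -> y \in codes -> card2 (relabel x) (relabel y) = card2 x y.
    move=> xc yc; rewrite !card2E ?relabel_in //; congr N.of_nat.
    by apply: count_relabel => i i8; rewrite !mem_relabel.
  rewrite c2 // sumN_map; congr (N.mul (squareN _) _).
  apply: eq_in_sumN => c /lc cc /=; rewrite /weight !c2 //.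
  suff -> : card3 (relabel a) (relabel b) (relabel c) = card3 a b c by [].
  rewrite !card3E ?relabel_in //; congr N.of_nat.
  by apply: count_relabel => i i8; rewrite !mem_relabel.
(* As g lists all eight indices, the sum over the planes may be taken in the order of g, where the
   degree at [nth 0 g i] becomes the old degree at i. *)
rewrite (perm_sumN _ (l' := g)); last by rewrite perm_sym.
rewrite -{1}(mkseq_nth 0 g) sg sumN_map; apply: eq_in_sumN => i; rewrite mem_iota => i8 /=.
congr (squareN (squareN _)); rewrite /degree sumN_map; apply: eq_in_sumN => c /lc cc.
by rewrite /comp mem_relabel.
Qed.
End Relabel.

Section Invariance.
Variable K : numFieldType.

Lemma mask_word (P : 'I_8 -> subspace K) :
  mask (word P) codes = [seq c <- codes | dep P (elements c)].
Proof. by rewrite wordE filter_mask. Qed.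

(** The list g of images of s maps the dependent quadruples of the reordered family bijectively onto
    those of P. *)
Lemma invariantP (P : 'I_8 -> subspace K) (s : 'S_8) :
  invariant (word (P \o s)) = invariant (word P).
Proof.
have [g [ig sg gs]] := indices_of_perm s.
rewrite /invariant !mask_word.
have pf := perm_filter (fun c => dep P (elements c)) (perm_relabel ig sg).
apply: etrans (perm_invariant_codes pf); rewrite filter_map.
have sub a : {subset [seq c <- codes | a c] <= codes} by move=> c; rewrite mem_filter => /andP[].
apply/esym/(etrans (invariant_codes_relabel ig sg (sub _))).
apply: (f_equal invariant_codes); apply: eq_in_filter => c cc.
have [/andP[_ c8] c4] := (indices_elements cc, size_elements cc).
by rewrite [RHS](dep_comp _ c8 gs) /preim /= -(dep_perm _ (relabel_perm ig sg cc)).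
Qed.
End Invariance.

(** * Incidence tables *)

Lemma quads_sorted : all (sorted ltn) quads.
Proof. by vm_compute. Qed.

Section Tables.
Variable K : numFieldType.
Implicit Types P Q R : 'I_8 -> subspace K.

Lemma eq_word P Q : word P = word Q <-> {in quads, dep P =1 dep Q}.
Proof. by split=> [|e]; [move=> e; apply/eq_in_map|apply/eq_in_map]. Qed.

Lemma incidentE P (q : quadruple) :
  incident P q = sorted <%O (q : seq 'I_8) && dep P (map val (q : seq 'I_8)).
Proof.
rewrite /incident /dep big_map; congr (_ && (_ != _)).
by apply: eq_bigr => i _; rewrite inord_val.
Qed.

Lemma quadruple_quads (q : quadruple) : sorted <%O (q : seq 'I_8) ->
  map val (q : seq 'I_8) \in quads.
Proof.
move=> sq; have sq' : sorted ltn (map val (q : seq 'I_8)) by rewrite sorted_map.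
apply: sorted_quads => //; last by rewrite size_map size_tuple.
apply/andP; split; first by apply: sorted_uniq sq'; [apply: ltn_trans|apply: ltnn].
by apply/allP => _ /mapP[i _ ->]; apply: ltn_ord.
Qed.

Lemma quads_quadruple l : l \in quads ->
  exists2 q : quadruple, sorted <%O (q : seq 'I_8) & map val (q : seq 'I_8) = l.
Proof.
move=> lq; have /andP[/andP[_ /allP l8] /eqP l4] := allP quads_indices l lq.
have sl := allP quads_sorted l lq.
have s4 : size (map inord l : seq 'I_8) == 4 by rewrite size_map l4.
have vl : map val (map inord l : seq 'I_8) = l.
  by rewrite -map_comp map_id_in // => i /l8 i8; rewrite /= inordK.
exists (Tuple s4) => //=.
suff : sorted ltn (map val (map inord l : seq 'I_8)) by rewrite sorted_map.
by rewrite vl.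
Qed.

(** A table lists the sorted quadruples at which the word is true, so the two encodings determine
    each other and the classification may be carried out on words. *)
Lemma incidence_table_word P Q : incidence_table P = incidence_table Q <-> word P = word Q.
Proof.
rewrite eq_word; split=> [PQ l lq|PQ].
  have [q sq <-] := quads_quadruple lq.
  have mem R : (q \in incidence_table R) = dep R (map val (q : seq 'I_8)).
    by rewrite mem_sort mem_filter mem_enum inE andbT incidentE sq.
  by rewrite -!mem PQ.
rewrite /incidence_table; congr sort; apply: eq_filter => q; rewrite !incidentE.
by case: (boolP (sorted _ _)) => // /quadruple_quads/PQ.
Qed.

(** Each letter of the reordered word is a letter of the original word at a moved quadruple. *)
Lemma word_comp P Q (s : 'S_8) : word P = word Q -> word (P \o s) = word (Q \o s).
Proof.
have [g [ig sg gs]] := indices_of_perm s.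
move=> /eq_word PQ; rewrite !(wordM _ ig sg gs); apply/eq_in_map => _ /mapP[q qq ->].
apply/PQ/elements_in; have /andP[/andP[uq q8] /eqP q4] := allP quads_indices q qq.
by apply: code_in; rewrite ?size_map //; apply: indices_nth; rewrite ?sg.
Qed.

Lemma minimal_le P (s : 'S_8) : (minimal_incidence_table P <= incidence_table (P \o s))%O.
Proof. exact: bigmin_le. Qed.

Lemma minimal_attained P :
  exists s : 'S_8, minimal_incidence_table P = incidence_table (P \o s).
Proof.
rewrite /minimal_incidence_table; elim/big_ind: _ => [|x y [s ->] [t ->]|s _].
(* The default value of the minimum is itself attained, at the identity. *)
- by exists 1%g; congr incidence_table; apply/funext => i; rewrite /= perm1.
- by case: (leP (incidence_table (P \o s)) (incidence_table (P \o t))); [exists s|exists t].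
- by exists s.
Qed.

Lemma minimal_comp P (s : 'S_8) :
  minimal_incidence_table (P \o s) = minimal_incidence_table P.
Proof.
have comp2 (t u : 'S_8) : ((P \o t) \o u) = P \o (u * t)%g by apply/funext => i; rewrite /= permM.
apply/le_anti/andP; split.
  have [t ->] := minimal_attained P.
  (* Reordering by s and then by [t * s^-1] amounts to reordering by t, so the minimum for P is
     among the tables of the reordered family. *)
  by have := minimal_le (P \o s) (t * s^-1)%g; rewrite comp2 mulgKV.
by have [t ->] := minimal_attained (P \o s); rewrite comp2 minimal_le.
Qed.

End Tables.

(** * The classification *)

Definition entry (x : N) : seq Z := [seq Z.sub (Z.of_nat d) 8 | d <- digits 16 x].

(* Hexadecimal digits encode the entries, shifted by 8, of the last four vectors:
   [q x] over the rational numbers, [w x y] over Z[alpha] with alpha^2 + alpha + 1 = 0 and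
   [g x y] with alpha^2 = alpha + 1, where [y] gives the coefficients of alpha. *)
Definition w (x y : N) : configuration := ((Zneg 1, Zneg 1), zip (entry x) (entry y)).
Definition g (x y : N) : configuration := ((Zpos 1, Zpos 1), zip (entry x) (entry y)).
Definition q (x : N) : configuration := ((Zneg 1, Zneg 1), [seq (a, Z0) | a <- entry x]).

(** Decimal numbers are masks, of quadruples at [B] and of sets of 2, 4 or 6 planes at [P]. The
    order in which brackets are decided varies between branches; [run] is sound for every order. *)
Definition certificate : tree := (
B 23 (B 27 (B 51 (B 83 (B 147 (B 29 (B 53 (B 85 (B 149 (B 57 (B 89 (B 153 (B 30 (B 54 (B 86 (B 150
(B 58 (B 90 (B 154 (B 60 (B 92 (B 156 (B 39 (B 43 (B 99 (B 163 (B 45 (B 101 (B 46 (B 102 (B 71 (B 77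
(B 113 (B 114 (B 116 (P 119) (B 177 (B 209 (P 17) (G 0x460725)) (G 0x450726))) (B 177 (B 209 (P 17)
(G 0x460715)) (G 0x450716))) (E 0x0123456)) (B 113 (B 116 (B 212 (B 114 (P 119) (B 180 (P 20) (G
0x451627))) (G 0x260347)) (G 0x260345)) (G 0x062345))) (B 113 (B 209 (B 177 (P 17) (B 141 (E
0x0123457) (G 0x072345))) (G 0x061247)) (G 0x061245))) (G 0x120356)) (B 114 (B 178 (B 116 (B 180 (B
210 (P 18) (B 177 (B 113 (P 51) (B 212 (P 20) (G 0x460527))) (G 0x470516))) (G 0x251347)) (G
0x251346)) (G 0x152347)) (G 0x152346))) (G 0x021356)) (B 113 (B 177 (B 116 (B 180 (B 209 (P 17) (B
178 (B 114 (P 51) (B 212 (P 20) (G 0x461527))) (G 0x470615))) (G 0x250347)) (G 0x250346)) (G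
0x052347)) (G 0x052346))) (G 0x012357)) (G 0x012356)) (B 113 (B 177 (B 114 (B 178 (B 209 (P 17) (B
163 (B 165 (B 180 (B 210 (P 18) (B 166 (B 135 (P 183) (G 0x071246)) (G 0x172546))) (G 0x470625)) (G
0x072546)) (G 0x071546))) (G 0x150347)) (G 0x150346)) (G 0x051347)) (G 0x051346))) (B 113 (B 177 (B
209 (P 17) (B 77 (B 141 (E 0x0123467) (G 0x072346)) (G 0x062347))) (G 0x051247)) (G 0x051246))) (G
0x230147)) (G 0x230146)) (G 0x230145)) (G 0x130247)) (G 0x130246)) (G 0x130245)) (G 0x120347)) (G
0x120346)) (G 0x120345)) (B 39 (B 54 (B 43 (B 99 (B 163 (B 58 (B 114 (B 178 (B 45 (B 101 (B 60 (B
116 (B 71 (B 86 (B 102 (B 113 (P 119) (B 77 (E 0x0123456) (G 0x062345))) (G 0x120356)) (G 0x120346))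
(B 113 (B 209 (B 177 (P 17) (B 141 (E 0x0123457) (G 0x072345))) (G 0x061247)) (G 0x061245))) (G
0x241356)) (G 0x230145)) (G 0x021356)) (B 113 (B 177 (P 51) (G 0x052347)) (G 0x052346))) (G
0x142357)) (G 0x142356)) (G 0x130245)) (G 0x012357)) (G 0x012356)) (B 113 (B 177 (B 58 (G 0x130524)
(B 209 (P 17) (B 163 (B 165 (B 178 (B 180 (B 150 (B 166 (B 135 (P 183) (G 0x071246)) (G 0x152734))
(G 0x142735)) (G 0x470625)) (G 0x470615)) (G 0x072546)) (G 0x071546)))) (G 0x051347)) (G 0x051346)))
(G 0x120345)) (B 113 (B 177 (B 209 (P 17) (B 77 (B 141 (E 0x0123467) (G 0x072346)) (G 0x062347))) (G
0x051247)) (G 0x051246)))) (G 0x031247)) (G 0x031246)) (G 0x031245)) (G 0x021347)) (G 0x021346)) (G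
0x021345)) (B 30 (Y 0x10234567) (B 39 (B 53 (B 54 (B 43 (B 99 (B 163 (B 57 (B 58 (B 113 (B 177 (B
114 (B 178 (P 51) (G 0x142357)) (G 0x142356)) (G 0x042357)) (G 0x042356)) (G 0x130245)) (G
0x031245)) (G 0x012357)) (G 0x012356)) (B 57 (G 0x031524) (B 58 (G 0x130524) (B 45 (B 101 (B 165 (B
46 (B 102 (B 166 (B 60 (B 108 (B 172 (B 116 (B 180 (B 228 (P 36) (B 85 (B 86 (B 113 (B 114 (B 71 (B
99 (P 119) (G 0x560127)) (G 0x260157)) (G 0x561427)) (G 0x560427)) (G 0x261457)) (G 0x260457))) (G
0x240357)) (G 0x240356)) (G 0x230157)) (G 0x230156)) (G 0x230145)) (G 0x120357)) (G 0x120356)) (B 60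
(G 0x230415) (B 71 (B 99 (B 85 (B 86 (B 102 (B 113 (B 114 (B 116 (P 119) (G 0x240356)) (G 0x150346))
(G 0x051346)) (G 0x120356)) (G 0x120346)) (G 0x021346)) (G 0x012356)) (B 99 (G 0x012635) (B 85 (G
0x021634) (B 113 (G 0x061524) (B 86 (G 0x120634) (B 102 (G 0x120635) (B 114 (G 0x160524) (B 116 (G
0x260415) (B 75 (B 89 (B 90 (B 77 (B 105 (B 201 (B 108 (B 78 (B 106 (B 202 (B 92 (B 204 (B 120 (B
232 (B 216 (P 72) (G 0x340267)) (G 0x350167)) (G 0x350146)) (G 0x230167)) (G 0x230146)) (G
0x130267)) (G 0x130256)) (B 106 (G 0x130526) (B 92 (G 0x230416) (B 120 (G 0x361524) (B 135 (B 163 (B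
149 (B 150 (B 166 (B 177 (B 178 (B 180 (P 183) (G 0x240357)) (G 0x150347)) (G 0x051347)) (G
0x120357)) (G 0x120347)) (G 0x021347)) (G 0x012357)) (B 163 (G 0x012735) (B 149 (G 0x021734) (B 177
(G 0x071524) (B 150 (G 0x120734) (B 166 (G 0x120735) (B 178 (G 0x170524) (B 180 (G 0x270415) (B 139
(B 195 (B 153 (B 154 (B 202 (B 209 (B 210 (B 216 (P 219) (G 0x340267)) (G 0x160247)) (G 0x061247))
(G 0x130267)) (G 0x130247)) (G 0x031247)) (G 0x012367)) (B 195 (G 0x012637) (B 153 (G 0x031724) (B
209 (G 0x071634) (B 154 (G 0x130724) (B 202 (G 0x130726) (B 210 (G 0x170634) (B 216 (G 0x370416) (B
141 (B 197 (B 169 (B 172 (B 204 (B 225 (B 228 (B 232 (P 237) (G 0x350167)) (G 0x260157)) (G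
0x061257)) (G 0x230167)) (G 0x230157)) (G 0x031257)) (G 0x021367)) (B 197 (G 0x021637) (B 169 (G
0x031527) (B 225 (G 0x072635) (B 172 (G 0x230715) (B 204 (G 0x230716) (B 228 (G 0x270635) (B 232 (G
0x370526) (B 142 (B 198 (G 0x120736) (B 170 (G 0x130725) (B 156 (G 0x230714) (B 184 (B 240 (G
0x450736) (B 212 (B 226 (U 0x670453 [:: 0x072645; 0x172564; 0x270461; 0x271453; 0x372456; 0x470651]
[::]) L) (B 226 (Y 0x02135467) L))) (B 212 (Y 0x01324657) (B 226 (Y 0x02135467) (B 240 L L))))))) (B
156 (Y 0x02345617) (B 170 (Y 0x01354627) (B 184 (Y 0x01354627) (B 198 (Y 0x01264537) (B 212 (Y
0x01264537) (B 226 (Y 0x01264537) (B 240 (Y 0x01264537) L)))))))))))))))))))))))))))))))))))) (G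
0x230156)) (G 0x031267)) (G 0x031256)) (B 105 (G 0x031526) (B 108 (G 0x230615) (B 78 (B 106 (B 202
(B 92 (G 0x230614) (B 120 (G 0x350614) (B 135 (B 163 (B 149 (B 150 (B 166 (B 177 (B 178 (B 180 (P
183) (G 0x240357)) (G 0x150347)) (G 0x051347)) (G 0x120357)) (G 0x120347)) (G 0x021347)) (G
0x012357)) (B 163 (G 0x012735) (B 149 (G 0x021734) (B 177 (G 0x071524) (B 150 (G 0x120734) (B 166 (G
0x120735) (B 178 (G 0x170524) (B 180 (G 0x270415) (B 139 (B 195 (B 153 (B 201 (B 154 (B 209 (B 210
(B 216 (P 219) (G 0x340267)) (G 0x160247)) (G 0x061247)) (G 0x130247)) (G 0x031267)) (G 0x031247))
(G 0x012367)) (B 195 (G 0x012637) (B 153 (G 0x031724) (B 201 (G 0x031726) (B 209 (G 0x071634) (B 154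
(G 0x130724) (B 210 (G 0x170634) (B 216 (G 0x370614) (B 141 (B 197 (G 0x021736) (B 169 (B 172 (B 225
(G 0x061527) (B 228 (G 0x260715) (B 142 (B 198 (B 170 (G 0x130725) (B 156 (B 204 (B 226 (G 0x160725)
(B 212 (G 0x260714) (B 184 (G 0x350417) (B 232 (G 0x350617) (B 240 L L))))) (G 0x230167)) (G
0x230147))) (G 0x120367)) (B 198 (G 0x120637) (B 156 (G 0x230417) (B 204 (G 0x230617) (B 170 (Y
0x01534267) (B 226 (G 0x150637) (B 184 (G 0x350417) (B 232 (G 0x350617) (B 212 (B 240 (G 0x460725)
L) (B 240 (Y 0x01534267) L)))))))))))) (G 0x230157)) (G 0x031257))) (B 169 (G 0x031527) (B 172 (G
0x230715) (B 142 (Y 0x10324657) (B 198 (G 0x120637) (B 204 (G 0x230617) (B 156 (B 212 (G 0x240736)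
(B 184 (G 0x340725) (B 170 (Y 0x01534267) (B 226 (G 0x150637) (B 232 (G 0x350617) (B 197 (Y
0x01264537) (B 225 (G 0x061527) (B 228 (G 0x260715) (B 240 L L))))))))) (B 170 (Y 0x01534267) (B 226
(G 0x150637) (B 232 (G 0x350617) (B 184 (Y 0x01534267) (B 197 (Y 0x01264537) (B 225 (G 0x061527) (B
228 (G 0x260715) (B 212 (Y 0x01264537) (B 240 (Y 0x01264537) L)))))))))))))))))))))))))))))))))) (G
0x130267)) (G 0x130256)) (B 106 (G 0x130526) (B 92 (Y 0x04231567) (B 120 (G 0x340526) (B 135 (B 163
(B 149 (B 150 (B 166 (B 177 (B 178 (B 180 (P 183) (G 0x240357)) (G 0x150347)) (G 0x051347)) (G
0x120357)) (G 0x120347)) (G 0x021347)) (G 0x012357)) (B 163 (G 0x012735) (B 149 (G 0x021734) (B 177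
(G 0x071524) (B 150 (G 0x120734) (B 166 (G 0x120735) (B 178 (G 0x170524) (B 180 (G 0x270415) (B 139
(B 195 (B 153 (B 201 (B 154 (B 202 (B 209 (B 210 (B 216 (P 219) (G 0x340267)) (G 0x160247)) (G
0x061247)) (G 0x130267)) (G 0x130247)) (G 0x031267)) (G 0x031247)) (G 0x012367)) (B 195 (G 0x012637)
(B 153 (G 0x031724) (B 201 (G 0x031726) (B 209 (G 0x071634) (B 154 (G 0x130724) (B 202 (G 0x130726)
(B 210 (G 0x170634) (B 216 (G 0x340726) (B 141 (B 197 (G 0x021736) (B 169 (B 172 (B 225 (G 0x061527)
(B 228 (G 0x260715) (B 142 (Y 0x02135476) (B 156 (G 0x230417) (B 204 (G 0x230617) (B 170 (Y
0x01534267) (B 184 (G 0x350417) (B 232 (G 0x350617) (B 198 (B 226 (G 0x160725) (B 212 (G 0x260714)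
(B 240 L L))) (B 212 (Y 0x02435176) (B 226 (Y 0x01534267) (B 240 (Y 0x01534267) L)))))))))))) (G
0x230157)) (G 0x031257))) (B 169 (G 0x031527) (B 172 (G 0x230715) (B 142 (B 198 (G 0x120736) (B 170
(G 0x130725) (B 156 (G 0x230714) (B 204 (G 0x230716) (B 184 (B 232 (G 0x350746) (B 240 (G 0x450736)
(B 197 (Y 0x01264537) (B 225 (G 0x061527) (B 228 (G 0x260715) (B 212 (B 226 L L) (B 226 (Y
0x04531267) L))))))) (B 197 (Y 0x01264537) (B 225 (G 0x061527) (B 228 (G 0x260715) (B 212 (B 240 (G
0x460725) (B 226 (Y 0x01564237) (B 232 L L))) (B 226 (B 232 (G 0x560713) (B 240 (G 0x560714) L)) (B
232 (B 240 (G 0x560734) L) (B 240 L L)))))))))))) (B 156 (Y 0x04231567) (B 170 (Y 0x01534267) (B 184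
(Y 0x01534267) (B 197 (Y 0x01264537) (B 225 (G 0x061527) (B 228 (G 0x260715) (B 198 (Y 0x01264537)
(B 204 (B 212 (G 0x260734) (B 232 (G 0x360725) (B 226 (Y 0x01264537) (B 240 (Y 0x01264537) L)))) (B
212 (Y 0x01264537) (B 226 (Y 0x01264537) (B 232 (Y 0x01534267) (B 240 (Y 0x01264537)
L)))))))))))))))))))))))))))))))))))))))) (G 0x130246)) (G 0x031246)) (B 89 (G 0x031624) (B 90 (G
0x130624) (B 77 (Y 0x02135467) (B 105 (G 0x031526) (B 108 (G 0x230615) (B 78 (B 106 (G 0x130625) (B
92 (G 0x230614) (B 120 (B 135 (B 163 (B 149 (B 150 (B 166 (B 177 (B 178 (B 180 (P 183) (G 0x240357))
(G 0x150347)) (G 0x051347)) (G 0x120357)) (G 0x120347)) (G 0x021347)) (G 0x012357)) (B 163 (G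
0x012735) (B 149 (G 0x021734) (B 177 (G 0x071524) (B 150 (G 0x120734) (B 166 (G 0x120735) (B 178 (G
0x170524) (B 180 (G 0x270415) (B 139 (Y 0x01234576) (B 153 (G 0x031724) (B 154 (G 0x130724) (B 141
(Y 0x01234576) (B 169 (G 0x031527) (B 172 (G 0x230715) (B 142 (B 198 (B 170 (G 0x130725) (B 202 (B
156 (G 0x230714) (B 204 (B 184 (B 216 (B 232 (B 240 (B 201 (B 195 (B 197 (B 209 (B 225 (B 210 (B 226
(B 212 (B 228 (P 192) (G 0x260157)) (G 0x260147)) (G 0x160257)) (G 0x160247)) (G 0x061257)) (G
0x061247)) (G 0x061327)) (B 197 (G 0x061723) (B 209 (G 0x061724) (B 225 (G 0x061527) (B 210 (G
0x160724) (B 226 (G 0x160725) (B 212 (G 0x670214) (B 228 (G 0x670215) L)))))))) (G 0x360714)) (G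
0x450367)) (G 0x350467)) (G 0x340567)) (B 216 (G 0x340657) (B 232 (G 0x350647) (B 240 (G 0x450637)
(B 201 (G 0x360147) (B 195 (Y 0x01264537) (B 209 (G 0x061724) (B 210 (G 0x160724) (B 226 (G
0x160725) (B 197 (Y 0x01264537) (B 225 (G 0x061527) (B 212 (G 0x260714) (B 228 (G 0x260715)
L))))))))))))) (G 0x230167))) (G 0x130267))) (G 0x120367)) (B 198 (G 0x120637) (B 202 (G 0x130627)
(B 204 (G 0x230617) (B 156 (B 212 (G 0x240736) (B 184 (G 0x340725) (B 216 (G 0x340726) (B 240 (G
0x462537) (B 232 (G 0x350647) (B 170 (B 226 (G 0x150736) (B 195 (Y 0x01264537) (B 209 (G 0x061724)
(B 210 (G 0x160724) (B 197 (Y 0x01264537) (B 225 (G 0x061527) (B 228 (G 0x260715) (B 201 (U 0x350176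
[:: 0x031765; 0x130674; 0x132546; 0x341275; 0x350142; 0x350467] [::]) L)))))))) (B 195 (Y
0x01264537) (B 209 (G 0x061724) (B 210 (G 0x160724) (B 197 (Y 0x01264537) (B 225 (G 0x061527) (B 228
(G 0x260715) (B 201 (B 226 L L) (B 226 L L)))))))))))))) (B 170 (Y 0x02135467) (B 184 (Y 0x04531267)
(B 216 (G 0x340657) (B 232 (G 0x350647) (B 240 (G 0x450637) (B 195 (Y 0x01264537) (B 209 (G
0x061724) (B 210 (G 0x160724) (B 197 (Y 0x01264537) (B 225 (G 0x061527) (B 228 (G 0x260715) (B 201
(B 212 (Y 0x01264537) (B 226 (Y 0x01264537) L)) (B 212 (Y 0x01264537) (B 226 (Y 0x01264537)
L))))))))))))))))))))))))))))))))) (B 135 (B 163 (B 149 (B 150 (B 166 (B 177 (B 178 (B 180 (P 183)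
(G 0x240357)) (G 0x150347)) (G 0x051347)) (G 0x120357)) (G 0x120347)) (G 0x021347)) (G 0x012357)) (B
163 (G 0x012735) (B 149 (G 0x021734) (B 177 (G 0x071524) (B 150 (G 0x120734) (B 166 (G 0x120735) (B
178 (G 0x170524) (B 180 (G 0x270415) (B 139 (Y 0x01234576) (B 153 (G 0x031724) (B 154 (G 0x130724)
(B 141 (Y 0x01234576) (B 169 (G 0x031527) (B 172 (G 0x230715) (B 142 (B 198 (B 170 (G 0x130725) (B
202 (B 156 (G 0x230714) (B 204 (B 184 (Y 0x01234576) (B 195 (Y 0x01264537) (B 209 (G 0x061724) (B
210 (G 0x160724) (B 226 (G 0x160725) (B 197 (Y 0x01264537) (B 225 (G 0x061527) (B 212 (G 0x260714)
(B 228 (G 0x260715) (B 201 (B 216 (B 232 (B 240 (G 0x460735) L) (G 0x360157)) (G 0x360147)) (B 216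
(G 0x360714) (B 232 (G 0x360715) (B 240 (Y 0x01264537) L))))))))))))) (G 0x230167))) (G 0x130267)))
(G 0x120367)) (B 198 (G 0x120637) (B 202 (G 0x130627) (B 204 (G 0x230617) (B 156 (B 212 (G 0x240736)
(B 184 (G 0x340725) (B 216 (G 0x340726) (B 170 (Y 0x01534276) (B 195 (Y 0x01264537) (B 209 (G
0x061724) (B 210 (G 0x160724) (B 197 (Y 0x01264537) (B 225 (G 0x061527) (B 228 (G 0x260715) (B 201
(B 232 (G 0x360517) (B 226 (B 240 (G 0x560714) L) (B 240 (Y 0x02475136) L))) (B 226 (B 232 (G
0x560713) (B 240 (G 0x560714) L)) (B 232 (B 240 (G 0x560734) L) (B 240 (Y 0x02475136)
L)))))))))))))) (B 170 (Y 0x02135467) (B 184 (B 216 (G 0x340756) (B 232 (G 0x350746) (B 240 (G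
0x450736) (B 195 (Y 0x01264537) (B 209 (G 0x061724) (B 210 (G 0x160724) (B 197 (Y 0x01264537) (B 225
(G 0x061527) (B 228 (G 0x260715) (B 201 (B 212 (Y 0x01264537) (B 226 (Y 0x01264537) L)) (B 212 (Y
0x01264537) (B 226 (Y 0x01264537) L)))))))))))) (B 195 (Y 0x01264537) (B 209 (G 0x061724) (B 210 (G
0x160724) (B 197 (Y 0x01264537) (B 225 (G 0x061527) (B 228 (G 0x260715) (B 201 (B 216 (G 0x360417)
(B 232 (G 0x360517) (B 212 (Y 0x01264537) (B 226 (Y 0x01264537) (B 240 (Y 0x01264537) L))))) (B 212
(Y 0x01264537) (B 216 (B 232 (G 0x360745) (B 240 (G 0x460735) (B 226 (Y 0x01264537) L))) (B 226 (Y
0x01264537) (B 232 (Y 0x02135467) (B 240 (Y 0x01264537) L)))))))))))))))))))))))))))))))))))) (B 92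
(Y 0x02435167) (B 106 (Y 0x01534267) (B 120 (Y 0x01534267) (B 135 (B 163 (B 149 (B 150 (B 166 (B 177
(B 178 (B 180 (P 183) (G 0x240357)) (G 0x150347)) (G 0x051347)) (G 0x120357)) (G 0x120347)) (G
0x021347)) (G 0x012357)) (B 163 (G 0x012735) (B 149 (G 0x021734) (B 177 (G 0x071524) (B 150 (G
0x120734) (B 166 (G 0x120735) (B 178 (G 0x170524) (B 180 (G 0x270415) (B 139 (Y 0x01234576) (B 153
(G 0x031724) (B 154 (G 0x130724) (B 141 (Y 0x01234576) (B 169 (G 0x031527) (B 172 (G 0x230715) (B
142 (Y 0x01234576) (B 156 (Y 0x01234576) (B 170 (Y 0x01234576) (B 184 (Y 0x01234576) (B 195 (Y
0x01264537) (B 209 (G 0x061724) (B 210 (G 0x160724) (B 197 (Y 0x01264537) (B 225 (G 0x061527) (B 228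
(G 0x260715) (B 198 (Y 0x01264537) (B 201 (B 202 (B 226 (G 0x160735) (B 204 (B 216 (B 232 (B 240 (G
0x561734) (B 212 (G 0x260734) L)) (G 0x360157)) (G 0x360147)) (G 0x360127))) (B 204 (G 0x360217) (B
216 (G 0x360417) (B 232 (G 0x360517) (B 212 (Y 0x01264537) (B 226 (Y 0x01264537) (B 240 (Y
0x01264537) L))))))) (B 202 (B 226 (G 0x160735) (B 204 (G 0x360712) (B 216 (G 0x360714) (B 232 (G
0x360715) (B 212 (Y 0x01264537) (B 240 (Y 0x01264537) L)))))) (B 204 (Y 0x02135467) (B 212 (Y
0x01264537) (B 216 (Y 0x02435167) (B 226 (Y 0x01264537) (B 232 (Y 0x01534267) (B 240 (Y 0x01264537)
L))))))))))))))))))))))))))))))))))))))))))))))))))))) (G 0x021357)) (G 0x021356)) (B 46 (Y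
0x10234567) (B 60 (Y 0x04231567) (B 71 (B 99 (B 85 (B 101 (B 86 (B 102 (B 113 (B 114 (B 116 (P 119)
(G 0x240356)) (G 0x150346)) (G 0x051346)) (G 0x120356)) (G 0x120346)) (G 0x021356)) (G 0x021346)) (G
0x012356)) (B 99 (G 0x012635) (B 85 (G 0x021634) (B 101 (G 0x021635) (B 113 (G 0x061524) (B 86 (G
0x120634) (B 102 (G 0x120635) (B 114 (G 0x160524) (B 116 (G 0x240635) (B 75 (B 89 (B 90 (B 77 (Y
0x01324657) (B 105 (G 0x031526) (B 78 (Y 0x01324657) (B 106 (G 0x130526) (B 92 (Y 0x01324657) (B 120
(G 0x340526) (B 108 (B 135 (B 163 (B 149 (B 165 (B 150 (B 166 (B 177 (B 178 (B 180 (P 183) (G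
0x240357)) (G 0x150347)) (G 0x051347)) (G 0x120357)) (G 0x120347)) (G 0x021357)) (G 0x021347)) (G
0x012357)) (B 163 (G 0x012735) (B 149 (G 0x021734) (B 165 (G 0x021735) (B 177 (G 0x071524) (B 150 (G
0x120734) (B 166 (G 0x120735) (B 178 (G 0x170524) (B 180 (G 0x240735) (B 139 (B 195 (B 153 (B 201 (B
154 (B 202 (B 209 (B 210 (B 216 (P 219) (G 0x340267)) (G 0x160247)) (G 0x061247)) (G 0x130267)) (G
0x130247)) (G 0x031267)) (G 0x031247)) (G 0x012367)) (B 195 (G 0x012637) (B 153 (G 0x031724) (B 201
(G 0x031726) (B 209 (G 0x071634) (B 154 (G 0x130724) (B 202 (G 0x130726) (B 210 (G 0x170634) (B 216
(G 0x340726) (B 141 (B 197 (G 0x021736) (B 169 (G 0x031725) (B 142 (B 198 (G 0x120736) (B 170 (G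
0x130725) (B 156 (B 172 (B 204 (B 212 (G 0x261734) (B 228 (B 232 (B 184 (G 0x351724) (B 225 (Y
0x23507614) (B 226 (G 0x560712) (B 240 (G 0x560724) L)))) (G 0x671235)) (G 0x261357))) (G 0x230167))
(G 0x230157)) (G 0x230147)))) (B 156 (G 0x230417) (B 172 (G 0x230517) (B 204 (G 0x230617) (B 228 (G
0x250637) (B 232 (G 0x350627) (B 170 (B 226 (G 0x150736) (B 184 (G 0x350714) (B 198 (B 212 (G
0x260714) (B 225 (B 240 (G 0x560417) (U 0x130276 [:: 0x120365; 0x132576; 0x260173; 0x370612;
0x561327; 0x670235] [::])) (B 240 L L))) (B 212 (B 240 (G 0x460725) (B 225 (Y 0x10354627) L)) (B 225
(B 240 (G 0x560417) (Y 0x10354627)) (B 240 (Y 0x10534267) L)))))) (B 184 (Y 0x04231567) (B 198 (Y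
0x01324657) (B 212 (Y 0x01324657) (B 225 (B 226 (G 0x560127) (B 240 (G 0x560417) L)) (B 226 (B 240
(G 0x560714) L) (B 240 (Y 0x04231567) L))))))))))))))) (B 142 (Y 0x10234567) (B 156 (Y 0x04231567)
(B 169 (Y 0x01354627) (B 170 (Y 0x01354627) (B 172 (B 204 (B 228 (B 184 (G 0x350724) (B 232 (B 197
(Y 0x01264537) (B 198 (G 0x260713) (B 212 (G 0x260734) (B 225 (Y 0x01264537) (B 226 (G 0x560712) (B
240 (G 0x560724) L)))))) (G 0x350267))) (G 0x250367)) (G 0x230567)) (B 204 (G 0x230657) (B 228 (G
0x250637) (B 232 (G 0x350627) (B 184 (Y 0x01354627) (B 197 (Y 0x01264537) (B 198 (Y 0x01264537) (B
212 (Y 0x01264537) (B 225 (Y 0x01264537) (B 226 (Y 0x01264537) (B 240 (Y 0x01264537)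
L)))))))))))))))))))))))))))))))))) (B 135 (B 163 (B 149 (B 165 (B 150 (B 166 (B 177 (B 178 (B 180
(P 183) (G 0x240357)) (G 0x150347)) (G 0x051347)) (G 0x120357)) (G 0x120347)) (G 0x021357)) (G
0x021347)) (G 0x012357)) (B 163 (G 0x012735) (B 149 (G 0x021734) (B 165 (G 0x021735) (B 177 (G
0x071524) (B 150 (G 0x120734) (B 166 (G 0x120735) (B 178 (G 0x170524) (B 180 (G 0x240735) (B 139 (B
195 (B 153 (B 201 (B 154 (B 202 (B 209 (B 210 (B 216 (P 219) (G 0x340267)) (G 0x160247)) (G
0x061247)) (G 0x130267)) (G 0x130247)) (G 0x031267)) (G 0x031247)) (G 0x012367)) (B 195 (G 0x012637)
(B 153 (G 0x031724) (B 201 (G 0x031726) (B 209 (G 0x071634) (B 154 (G 0x130724) (B 202 (G 0x130726)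
(B 210 (G 0x170634) (B 216 (G 0x340726) (B 141 (B 197 (G 0x021736) (B 169 (G 0x031725) (B 142 (B 198
(G 0x120736) (B 170 (G 0x130725) (B 156 (B 172 (B 204 (B 212 (G 0x261734) (B 228 (G 0x261735) (B 232
(G 0x671325) (B 184 (G 0x351724) (B 225 (B 226 (G 0x560127) (B 240 (G 0x560417) L)) (B 226 (Y
0x10234567) (B 240 (Y 0x04231567) L))))))) (G 0x230167)) (G 0x230157)) (G 0x230147)))) (B 156 (G
0x230417) (B 172 (G 0x230517) (B 204 (G 0x230617) (B 170 (B 226 (G 0x150736) (B 184 (G 0x350714) (B
232 (G 0x350716) (B 198 (B 212 (G 0x260714) (B 228 (G 0x260715) (B 225 (B 240 (G 0x560417) L) (B 240
L L)))) (B 212 (B 228 (G 0x260745) (B 240 (G 0x460725) (B 225 (Y 0x10354627) L))) (B 225 (B 240 (G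
0x560417) (Y 0x10354627)) (B 228 (B 240 (G 0x560724) L) (B 240 (Y 0x10534267) L)))))))) (B 184 (Y
0x04231567) (B 198 (Y 0x01324657) (B 212 (Y 0x01324657) (B 225 (B 226 (Y 0x01564237) (B 228 (G
0x560217) (B 232 (G 0x560317) (B 240 (G 0x560417) L)))) (B 226 (B 228 (G 0x560712) (B 232 (G
0x560713) (B 240 (G 0x560714) L))) (B 228 (B 232 (G 0x560723) (B 240 (G 0x560724) L)) (B 232 (Y
0x01324657) (B 240 (Y 0x04231567) L))))))))))))))) (B 142 (Y 0x10234567) (B 156 (Y 0x04231567) (B
169 (Y 0x01354627) (B 170 (Y 0x01354627) (B 172 (B 204 (G 0x230756) (B 228 (G 0x250736) (B 184 (G
0x350724) (B 232 (G 0x350726) (B 197 (Y 0x01264537) (B 198 (Y 0x01264537) (B 212 (Y 0x01264537) (B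
225 (Y 0x01264537) (B 226 (Y 0x01264537) (B 240 (Y 0x01534267) L)))))))))) (B 184 (Y 0x01354627) (B
197 (Y 0x01264537) (B 198 (Y 0x01264537) (B 204 (Y 0x01324657) (B 212 (Y 0x01264537) (B 225 (Y
0x01264537) (B 226 (Y 0x01264537) (B 228 (Y 0x01264537) (B 232 (Y 0x01324657) (B 240 (Y 0x01264537)
L))))))))))))))))))))))))))))))))))))))))) (G 0x130246)) (G 0x031246)) (B 89 (G 0x031624) (B 90 (G
0x130624) (B 77 (B 105 (G 0x031625) (B 78 (B 106 (G 0x130625) (B 92 (B 108 (B 204 (B 120 (G
0x351624) (B 135 (B 163 (B 149 (B 165 (B 150 (B 166 (B 177 (B 178 (B 180 (P 183) (G 0x240357)) (G
0x150347)) (G 0x051347)) (G 0x120357)) (G 0x120347)) (G 0x021357)) (G 0x021347)) (G 0x012357)) (B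
163 (G 0x012735) (B 149 (G 0x021734) (B 165 (G 0x021735) (B 177 (G 0x071524) (B 150 (G 0x120734) (B
166 (G 0x120735) (B 178 (G 0x170524) (B 180 (G 0x240735) (B 139 (Y 0x01234576) (B 153 (G 0x031724)
(B 154 (G 0x130724) (B 141 (B 197 (B 169 (G 0x031725) (B 201 (B 142 (B 198 (B 170 (G 0x130725) (B
202 (B 156 (B 172 (B 212 (B 228 (B 232 (B 216 (P 204) (G 0x371546)) (G 0x351267)) (G 0x260157)) (G
0x260147)) (G 0x230157)) (G 0x230147)) (G 0x130267))) (G 0x120367)) (B 198 (G 0x120637) (B 202 (G
0x130627) (B 156 (G 0x230417) (B 172 (G 0x230517) (B 212 (G 0x271634) (B 228 (G 0x271635) (B 216 (G
0x371624) (B 232 (G 0x371625) (B 170 (B 226 (G 0x150736) (B 184 (G 0x350714) (B 195 (Y 0x01264537)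
(B 209 (G 0x061724) (B 225 (G 0x061725) (B 210 (G 0x160724) (B 240 L L))))))) (B 184 (Y 0x04231567)
(B 195 (Y 0x01264537) (B 209 (G 0x061724) (B 225 (G 0x061725) (B 210 (G 0x160724) (B 226 (Y
0x01264537) (B 240 (Y 0x01264537) L))))))))))))))))) (G 0x031267))) (G 0x021367)) (B 197 (G
0x021637) (B 201 (G 0x031627) (B 142 (Y 0x10234567) (B 198 (G 0x120637) (B 202 (G 0x130627) (B 156
(Y 0x04231567) (B 212 (G 0x240637) (B 216 (G 0x340627) (B 169 (B 225 (G 0x051736) (B 170 (B 172 (Y
0x23506714) (G 0x350127)) (B 172 (G 0x350217) (B 184 (G 0x350417) (B 232 (G 0x350617) (B 228 (G
0x250637) (B 195 (Y 0x01264537) (B 209 (G 0x061724) (B 210 (G 0x160724) (B 226 (B 240 (G 0x560714)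
L) (B 240 (Y 0x04231567) L))))))))))) (B 170 (Y 0x10234567) (B 172 (B 228 (B 184 (G 0x350724) (B 232
(B 195 (Y 0x01264537) (B 209 (G 0x061724) (B 210 (G 0x160724) (B 225 (Y 0x01264537) (B 226 (G
0x560712) (B 240 (G 0x560724) L)))))) (G 0x350267))) (G 0x250367)) (B 228 (G 0x250637) (B 232 (G
0x350627) (B 184 (Y 0x04231567) (B 195 (Y 0x01264537) (B 209 (G 0x061724) (B 210 (G 0x160724) (B 225
(Y 0x01264537) (B 226 (Y 0x01264537) (B 240 (Y 0x01264537) L)))))))))))))))))))))))))))))))))) (G
0x230167)) (G 0x230156)) (G 0x230146))) (B 92 (G 0x230416) (B 108 (G 0x230516) (B 106 (B 120 (G
0x350614) (B 135 (B 163 (B 149 (B 165 (B 150 (B 166 (B 177 (B 178 (B 180 (P 183) (G 0x240357)) (G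
0x150347)) (G 0x051347)) (G 0x120357)) (G 0x120347)) (G 0x021357)) (G 0x021347)) (G 0x012357)) (B
163 (G 0x012735) (B 149 (G 0x021734) (B 165 (G 0x021735) (B 177 (G 0x071524) (B 150 (G 0x120734) (B
166 (G 0x120735) (B 178 (G 0x170524) (B 180 (G 0x240735) (B 139 (Y 0x01234576) (B 153 (G 0x031724)
(B 154 (G 0x130724) (B 141 (B 197 (B 169 (G 0x031725) (B 201 (B 204 (B 142 (Y 0x01234576) (B 156 (G
0x230417) (B 172 (G 0x230517) (B 170 (B 202 (B 226 (B 232 (B 216 (B 195 (B 209 (B 225 (B 198 (B 210
(B 212 (B 240 (B 228 (P 192) (G 0x560127)) (G 0x460257)) (G 0x460327)) (G 0x160247)) (G 0x160327))
(G 0x061257)) (G 0x061247)) (B 198 (G 0x160723) (Y 0x36017245))) (G 0x360147)) (G 0x350167)) (G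
0x150367)) (G 0x130567)) (B 202 (G 0x130657) (B 226 (G 0x150637) (B 232 (G 0x350617) (B 216 (G
0x360417) (B 184 (B 240 (G 0x450736) (B 195 (Y 0x01264537) (B 209 (G 0x061724) (B 225 (G 0x061725)
(B 210 (G 0x160724) (B 198 (Y 0x01264537) (B 212 (G 0x260417) (B 228 (G 0x260517) L)))))))) (B 195
(Y 0x01264537) (B 209 (G 0x061724) (B 225 (G 0x061725) (B 210 (G 0x160724) (B 198 (Y 0x01264537) (B
212 (G 0x260417) (B 228 (G 0x260517) (B 240 (Y 0x01264537) L))))))))))))))))) (G 0x230167)) (G
0x031267))) (G 0x021367)) (B 197 (G 0x021637) (B 201 (G 0x031627) (B 204 (G 0x230716) (B 142 (B 198
(G 0x120736) (B 170 (G 0x130725) (B 202 (G 0x130726) (B 156 (G 0x230714) (B 172 (G 0x230715) (B 226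
(G 0x162537) (B 232 (G 0x350617) (B 169 (B 225 (G 0x051736) (B 184 (G 0x350417) (B 195 (Y
0x01264537) (B 209 (G 0x061724) (B 210 (G 0x160724) (B 212 (B 228 (G 0x260745) (B 216 (G 0x460723)
(B 240 (G 0x460725) L))) (B 216 (B 240 (G 0x460735) (B 228 L L)) (B 228 (B 240 (G 0x560724) L) (B
240 (Y 0x01534276) L))))))))) (B 184 (B 216 (G 0x340756) (B 240 (G 0x450736) (B 195 (Y 0x01264537)
(B 209 (G 0x061724) (B 210 (G 0x160724) (B 212 (B 228 (G 0x260745) (B 225 L L)) (B 225 (Y
0x41530276) (B 228 L L)))))))) (B 195 (Y 0x01264537) (B 209 (G 0x061724) (B 210 (G 0x160724) (B 212
(B 228 (G 0x260745) (B 216 (G 0x460723) (B 240 (G 0x460725) (B 225 (Y 0x10564237) L)))) (B 216 (B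
240 (G 0x460735) (B 225 (B 228 (G 0x560217) L) (B 228 L L))) (B 225 (B 228 (G 0x560217) (B 240 (G
0x560417) L)) (B 228 (B 240 (G 0x560724) L) (B 240 L L))))))))))))))))) (B 156 (B 172 (G 0x230745)
(B 212 (G 0x240736) (B 184 (G 0x340725) (B 216 (G 0x340726) (B 169 (B 170 (G 0x350127) (Y
0x10534267)) (B 170 (Y 0x10534267) (B 202 (G 0x130657) (B 226 (G 0x150637) (B 232 (G 0x350617) (B
195 (Y 0x01264537) (B 209 (G 0x061724) (B 210 (G 0x160724) (B 198 (Y 0x01264537) (B 225 (Y
0x10564237) (B 228 (B 240 (G 0x560724) L) (B 240 L L)))))))))))))))) (B 169 (B 170 (Y 0x01534276) (Y
0x10534267)) (B 170 (Y 0x10534267) (B 202 (G 0x130657) (B 226 (G 0x150637) (B 232 (G 0x350617) (B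
172 (B 228 (G 0x250736) (B 184 (G 0x350724) (B 195 (Y 0x01264537) (B 209 (G 0x061724) (B 210 (G
0x160724) (B 198 (Y 0x01264537) (B 212 (Y 0x01264537) (B 216 (B 240 (G 0x460735) (B 225 (Y
0x01264537) L)) (B 225 (Y 0x01264537) (B 240 (Y 0x10534267) L)))))))))) (B 184 (Y 0x10534267) (B 195
(Y 0x01264537) (B 209 (G 0x061724) (B 210 (G 0x160724) (B 198 (Y 0x01264537) (B 212 (Y 0x01264537)
(B 216 (B 240 (G 0x460735) (B 225 (Y 0x01264537) (B 228 (Y 0x01264537) L))) (B 225 (Y 0x01264537) (B
228 (Y 0x01264537) (B 240 (Y 0x01264537) L))))))))))))))))))))))))))))))))))) (B 120 (Y 0x04231567)
(B 135 (B 163 (B 149 (B 165 (B 150 (B 166 (B 177 (B 178 (B 180 (P 183) (G 0x240357)) (G 0x150347))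
(G 0x051347)) (G 0x120357)) (G 0x120347)) (G 0x021357)) (G 0x021347)) (G 0x012357)) (B 163 (G
0x012735) (B 149 (G 0x021734) (B 165 (G 0x021735) (B 177 (G 0x071524) (B 150 (G 0x120734) (B 166 (G
0x120735) (B 178 (G 0x170524) (B 180 (G 0x240735) (B 139 (Y 0x01234576) (B 153 (G 0x031724) (B 154
(G 0x130724) (B 141 (B 197 (B 169 (G 0x031725) (B 201 (B 204 (B 142 (Y 0x01234576) (B 156 (G
0x230417) (B 172 (G 0x230517) (B 170 (Y 0x01234576) (B 184 (Y 0x01234576) (B 195 (Y 0x01264537) (B
209 (G 0x061724) (B 225 (G 0x061725) (B 210 (G 0x160724) (B 198 (Y 0x01264537) (B 212 (G 0x260417)
(B 228 (G 0x260517) (B 202 (Y 0x36017245) (B 216 (G 0x360417) (B 232 (G 0x360517) (B 226 (Y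
0x01264537) (B 240 (Y 0x01264537) L))))))))))))))))) (G 0x230167)) (G 0x031267))) (G 0x021367)) (B
197 (G 0x021637) (B 201 (G 0x031627) (B 204 (G 0x230716) (B 142 (B 198 (G 0x120736) (B 170 (G
0x130725) (B 202 (G 0x130726) (B 156 (G 0x230714) (B 172 (G 0x230715) (B 169 (B 184 (G 0x350417) (Y
0x01534276)) (B 184 (Y 0x10234576) (B 195 (Y 0x01264537) (B 209 (G 0x061724) (B 210 (G 0x160724) (B
212 (B 228 (G 0x260745) (B 216 (G 0x460723) (B 240 (G 0x460725) (B 225 (B 226 (G 0x560127) (Y
0x01564273)) (B 226 (Y 0x04261537) (B 232 L L)))))) (B 216 (B 232 (G 0x360745) (B 240 (G 0x460735)
(B 225 (B 226 (G 0x560137) (B 228 (G 0x560237) L)) (B 226 (Y 0x10234576) (B 228 L L))))) (B 225 (B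
226 (Y 0x01564273) (B 228 (G 0x560217) (B 232 (G 0x560317) (B 240 (G 0x560417) L)))) (B 226 (Y
0x10234576) (B 228 (B 232 (G 0x560723) (B 240 (G 0x560724) L)) (B 232 (B 240 (G 0x560734) L) (B 240
L L))))))))))))))))) (B 156 (Y 0x04231567) (B 169 (B 225 (G 0x051736) (B 170 (Y 0x01534276) (B 172
(G 0x350217) (B 184 (G 0x350417) (B 232 (G 0x350617) (B 195 (Y 0x01264537) (B 209 (G 0x061724) (B
210 (G 0x160724) (B 198 (Y 0x01264537) (B 202 (B 226 (G 0x160735) (B 216 (G 0x360714) (B 212 (Y
0x01264537) (B 228 (B 240 (G 0x560724) L) (B 240 (Y 0x01534276) L))))) (B 212 (Y 0x01264537) (B 216
(Y 0x04231567) (B 226 (Y 0x01534276) (B 228 (B 240 (G 0x560724) L) (B 240 (Y 0x01534276)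
L))))))))))))))) (B 170 (B 202 (G 0x130756) (B 226 (G 0x150736) (B 172 (G 0x350712) (B 184 (G
0x350714) (B 232 (G 0x350716) (B 195 (Y 0x01264537) (B 209 (G 0x061724) (B 210 (G 0x160724) (B 198
(Y 0x01264537) (B 212 (Y 0x01264537) (B 216 (B 240 (G 0x460735) (B 225 (Y 0x01264537) (B 228 L L)))
(B 225 (Y 0x01264537) (B 228 (B 240 (G 0x560724) L) (B 240 (Y 0x10534276) L)))))))))))))) (B 172 (B
228 (G 0x250736) (B 184 (G 0x350724) (B 232 (G 0x350726) (B 195 (Y 0x01264537) (B 209 (G 0x061724)
(B 210 (G 0x160724) (B 198 (Y 0x01264537) (B 202 (B 226 (G 0x160735) (B 216 (G 0x360714) (B 212 (Y
0x01264537) (B 225 (Y 0x01264537) (B 240 (Y 0x04261537) L))))) (B 212 (Y 0x01264537) (B 216 (Y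
0x04231567) (B 225 (Y 0x01264537) (B 226 (Y 0x01264537) (B 240 (Y 0x04231567) L))))))))))))) (B 184
(Y 0x04231567) (B 195 (Y 0x01264537) (B 209 (G 0x061724) (B 210 (G 0x160724) (B 198 (Y 0x01264537)
(B 202 (B 226 (G 0x160735) (B 216 (G 0x360714) (B 232 (G 0x360715) (B 212 (Y 0x01264537) (B 225 (Y
0x01264537) (B 228 (Y 0x01264537) (B 240 (Y 0x01264537) L))))))) (B 212 (Y 0x01264537) (B 216 (Y
0x04231567) (B 225 (Y 0x01264537) (B 226 (Y 0x01264537) (B 228 (Y 0x01264537) (B 232 (B 240 (G
0x560734) L) (B 240 (Y 0x01264537) L)))))))))))))))))))))))))))))))))))))))) (B 78 (Y 0x10234567) (B
92 (Y 0x04231567) (B 105 (Y 0x01534267) (B 106 (Y 0x01534267) (B 108 (B 120 (G 0x350624) (B 135 (B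
163 (B 149 (B 165 (B 150 (B 166 (B 177 (B 178 (B 180 (P 183) (G 0x240357)) (G 0x150347)) (G
0x051347)) (G 0x120357)) (G 0x120347)) (G 0x021357)) (G 0x021347)) (G 0x012357)) (B 163 (G 0x012735)
(B 149 (G 0x021734) (B 165 (G 0x021735) (B 177 (G 0x071524) (B 150 (G 0x120734) (B 166 (G 0x120735)
(B 178 (G 0x170524) (B 180 (G 0x240735) (B 139 (Y 0x01234576) (B 153 (G 0x031724) (B 154 (G
0x130724) (B 141 (Y 0x01234576) (B 142 (Y 0x01234576) (B 156 (Y 0x01234576) (B 169 (Y 0x01234576) (B
170 (Y 0x01234576) (B 172 (B 204 (B 228 (B 184 (G 0x350724) (B 232 (B 195 (Y 0x01264537) (B 209 (G
0x061724) (B 210 (G 0x160724) (B 197 (Y 0x01264537) (B 198 (G 0x260713) (B 212 (G 0x260734) (B 201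
(B 225 (G 0x061735) (B 202 (B 216 (B 226 (G 0x560712) (B 240 (G 0x560724) L)) (G 0x360147)) (G
0x360217))) (B 202 (G 0x360712) (B 216 (G 0x360724) (B 225 (Y 0x01264537) (B 226 (G 0x560712) (B 240
(G 0x560724) L)))))))))))) (G 0x350267))) (G 0x250367)) (G 0x230567)) (B 204 (G 0x230657) (B 228 (G
0x250637) (B 232 (G 0x350627) (B 184 (Y 0x01534267) (B 195 (Y 0x01264537) (B 209 (G 0x061724) (B 210
(G 0x160724) (B 197 (Y 0x01264537) (B 198 (Y 0x01264537) (B 201 (B 225 (G 0x061735) (B 202 (G
0x360127) (B 216 (G 0x360417) (B 212 (Y 0x01264537) (B 226 (Y 0x01264537) (B 240 (Y 0x01264537)
L)))))) (B 202 (Y 0x10234567) (B 212 (Y 0x01264537) (B 216 (Y 0x04231567) (B 225 (Y 0x01264537) (B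
226 (Y 0x01264537) (B 240 (Y 0x01264537) L))))))))))))))))))))))))))))))))))) (B 120 (Y 0x01534267)
(B 135 (B 163 (B 149 (B 165 (B 150 (B 166 (B 177 (B 178 (B 180 (P 183) (G 0x240357)) (G 0x150347))
(G 0x051347)) (G 0x120357)) (G 0x120347)) (G 0x021357)) (G 0x021347)) (G 0x012357)) (B 163 (G
0x012735) (B 149 (G 0x021734) (B 165 (G 0x021735) (B 177 (G 0x071524) (B 150 (G 0x120734) (B 166 (G
0x120735) (B 178 (G 0x170524) (B 180 (G 0x240735) (B 139 (Y 0x01234576) (B 153 (G 0x031724) (B 154
(G 0x130724) (B 141 (Y 0x01234576) (B 142 (Y 0x01234576) (B 156 (Y 0x01234576) (B 169 (Y 0x01234576)
(B 170 (Y 0x01234576) (B 172 (Y 0x01234576) (B 184 (Y 0x01234576) (B 195 (Y 0x01264537) (B 209 (G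
0x061724) (B 210 (G 0x160724) (B 197 (Y 0x01264537) (B 198 (Y 0x01264537) (B 201 (B 225 (G 0x061735)
(B 202 (B 226 (G 0x160735) (B 204 (B 216 (B 232 (B 228 (G 0x561723) (B 240 (G 0x561734) (B 212 (G
0x260734) L))) (G 0x360157)) (G 0x360147)) (G 0x360127))) (B 204 (G 0x360217) (B 216 (G 0x360417) (B
232 (G 0x360517) (B 212 (Y 0x01264537) (B 226 (Y 0x01264537) (B 228 (Y 0x01264537) (B 240 (Y
0x01264537) L))))))))) (B 202 (Y 0x10234567) (B 204 (B 212 (G 0x260734) (B 228 (G 0x260735) (B 216
(G 0x360724) (B 232 (G 0x360725) (B 225 (Y 0x01264537) (B 226 (Y 0x01264537) (B 240 (Y 0x01264537)
L))))))) (B 212 (Y 0x01264537) (B 216 (Y 0x04231567) (B 225 (Y 0x01264537) (B 226 (Y 0x01264537) (B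
228 (Y 0x01264537) (B 232 (Y 0x01534267) (B 240 (Y 0x01264537)
L))))))))))))))))))))))))))))))))))))))))))))))))))))))))))) (G 0x120345)) (G 0x021345)) (B 53 (G
0x021534) (B 54 (G 0x120534) (B 43 (Y 0x01324567) (B 57 (G 0x031524) (B 58 (G 0x130524) (B 45 (B 46
(B 60 (B 108 (B 172 (B 71 (Y 0x01234657) (B 85 (G 0x021634) (B 86 (G 0x120634) (B 75 (Y 0x01234657)
(B 89 (G 0x031624) (B 90 (G 0x130624) (B 77 (Y 0x23015467) (B 101 (G 0x021536) (B 105 (G 0x031526)
(B 78 (Y 0x10234567) (B 102 (G 0x120536) (B 106 (G 0x130526) (B 92 (Y 0x04231567) (B 116 (G
0x240536) (B 120 (G 0x340526) (B 99 (Y 0x01254367) (B 113 (G 0x051624) (B 114 (G 0x150624) (B 135 (Y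
0x01234576) (B 149 (G 0x021734) (B 150 (G 0x120734) (B 139 (Y 0x01234576) (B 153 (G 0x031724) (B 154
(G 0x130724) (B 141 (Y 0x01234576) (B 165 (G 0x021537) (B 169 (G 0x031527) (B 142 (Y 0x01234576) (B
166 (G 0x120537) (B 170 (G 0x130527) (B 156 (Y 0x01234576) (B 180 (G 0x240537) (B 184 (G 0x340527)
(B 163 (Y 0x01234576) (B 177 (G 0x051724) (B 178 (G 0x150724) (B 195 (Y 0x01264735) (B 209 (G
0x061724) (B 210 (G 0x160724) (B 197 (B 201 (G 0x061723) (B 225 (G 0x061725) (B 198 (B 204 (Y
0x23015467) (G 0x260137)) (B 204 (G 0x260317) (B 212 (G 0x260417) (B 228 (G 0x260517) (B 232 (G
0x360527) (B 202 (B 226 (G 0x160735) (B 216 (G 0x360714) (B 240 L L))) (B 216 (Y 0x04231567) (B 226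
(Y 0x01254367) (B 240 (Y 0x01254367) L))))))))))) (B 198 (Y 0x10234567) (B 201 (Y 0x01324567) (B 202
(Y 0x01324567) (B 204 (Y 0x23015467) (B 228 (G 0x260537) (B 232 (G 0x360527) (B 212 (Y 0x04231567)
(B 216 (Y 0x01324567) (B 225 (Y 0x01254367) (B 226 (Y 0x01254367) (B 240 (Y 0x01254367)
L))))))))))))))))))))))))))))))))))))))))))))))))))) (G 0x230157)) (G 0x230156)) (G 0x230145)) (B 60
(G 0x230415) (B 71 (Y 0x01234657) (B 85 (G 0x021634) (B 86 (G 0x120634) (B 75 (Y 0x01234657) (B 89
(G 0x031624) (B 90 (G 0x130624) (B 77 (B 101 (B 105 (B 108 (B 78 (Y 0x01234657) (B 92 (G 0x230416)
(B 99 (Y 0x01254367) (B 113 (G 0x051624) (B 114 (G 0x150624) (B 102 (Y 0x01254367) (B 116 (G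
0x250416) (B 106 (Y 0x01324567) (B 120 (G 0x350416) (B 135 (Y 0x01234576) (B 149 (G 0x021734) (B 150
(G 0x120734) (B 139 (Y 0x01234576) (B 153 (G 0x031724) (B 154 (G 0x130724) (B 141 (B 165 (B 197 (B
169 (B 201 (B 172 (B 204 (B 225 (B 228 (B 232 (P 237) (G 0x350167)) (G 0x250167)) (G 0x051267)) (G
0x230167)) (G 0x230157)) (G 0x031267)) (G 0x031257)) (G 0x021367)) (G 0x021357)) (B 165 (G 0x021537)
(B 197 (G 0x021637) (B 169 (G 0x031527) (B 201 (G 0x031627) (B 172 (G 0x230715) (B 204 (G 0x230716)
(B 225 (G 0x051627) (B 228 (G 0x250716) (B 232 (G 0x350716) (B 142 (B 166 (G 0x120735) (B 198 (G
0x120736) (B 170 (G 0x130725) (B 202 (G 0x130726) (B 156 (G 0x230714) (B 163 (Y 0x01254367) (B 177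
(G 0x051724) (B 178 (G 0x150724) (B 180 (B 212 (G 0x240756) (B 184 (G 0x450723) (B 240 (G 0x450726)
(B 195 (Y 0x01234657) (B 209 (G 0x061724) (B 210 (G 0x160724) (B 216 (B 226 L L) (B 226 (Y
0x04251367) L)))))))) (B 184 (Y 0x01324567) (B 195 (Y 0x01234657) (B 209 (G 0x061724) (B 210 (G
0x160724) (B 212 (Y 0x01234657) (B 216 (Y 0x01234657) (B 226 (B 240 (G 0x560714) L) (B 240 L
L))))))))))))))))) (B 156 (Y 0x04231567) (B 163 (Y 0x01254367) (B 177 (G 0x051724) (B 178 (G
0x150724) (B 166 (Y 0x01254367) (B 170 (Y 0x01324567) (B 180 (Y 0x01254367) (B 184 (Y 0x01324567) (B
195 (Y 0x01234657) (B 209 (G 0x061724) (B 210 (G 0x160724) (B 198 (Y 0x01234657) (B 202 (Y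
0x01234657) (B 212 (Y 0x01234657) (B 216 (Y 0x01234657) (B 226 (Y 0x01254367) (B 240 (Y 0x01254367)
L))))))))))))))))))))))))))))))))))))))))))) (G 0x230156)) (G 0x031256)) (G 0x021356)) (B 101 (G
0x021536) (B 105 (G 0x031526) (B 108 (G 0x230615) (B 78 (B 102 (G 0x120635) (B 106 (G 0x130625) (B
92 (G 0x230614) (B 99 (Y 0x01254367) (B 113 (G 0x051624) (B 114 (G 0x150624) (B 116 (B 120 (G
0x450623) (B 135 (Y 0x01234576) (B 149 (G 0x021734) (B 150 (G 0x120734) (B 139 (Y 0x01234576) (B 153
(G 0x031724) (B 154 (G 0x130724) (B 141 (Y 0x01234576) (B 165 (G 0x021537) (B 169 (G 0x031527) (B
172 (G 0x230715) (B 142 (Y 0x10234657) (B 198 (G 0x120637) (B 202 (G 0x130627) (B 204 (G 0x230617)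
(B 156 (B 180 (G 0x240735) (B 212 (G 0x240736) (B 184 (G 0x340725) (B 216 (G 0x340726) (B 228 (G
0x250647) (B 240 (G 0x450627) (B 163 (Y 0x01254376) (B 177 (G 0x051724) (B 178 (G 0x150724) (B 166
(B 170 (G 0x150723) (B 226 (G 0x150726) (B 195 (Y 0x01264735) (B 209 (G 0x061724) (B 210 (G
0x160724) (B 197 (B 201 (G 0x061723) (B 225 (G 0x061725) (B 232 (U 0x240567 [:: 0x021654; 0x120576;
0x230765; 0x260315; 0x270136; 0x273564] [::]) (U 0x124576 [:: 0x240751; 0x250673; 0x250467;
0x261753; 0x270546; 0x273654] [::])))) (B 201 (B 225 (G 0x061735) (B 232 (G 0x360517) L)) (B 225 (Y
0x01254376) (B 232 L L))))))))) (B 170 (B 226 (G 0x150736) (B 232 (G 0x350716) (B 195 (Y 0x01264735)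
(B 209 (G 0x061724) (B 210 (G 0x160724) (B 197 (Y 0x10234657) (B 201 (Y 0x04321576) (B 225 L
L)))))))) (B 195 (Y 0x01264735) (B 209 (G 0x061724) (B 210 (G 0x160724) (B 197 (Y 0x10234657) (B 201
(Y 0x10234657) (B 225 (B 226 (G 0x560127) (B 232 (G 0x560317) L)) (B 226 (Y 0x10234657) (B 232 L
L))))))))))))))))))) (B 163 (Y 0x01254376) (B 177 (G 0x051724) (B 178 (G 0x150724) (B 166 (B 180 (G
0x250714) (Y 0x04251367)) (B 170 (B 226 (G 0x150736) (B 184 (G 0x350714) (B 232 (G 0x350716) (B 180
(Y 0x04251367) (B 212 (G 0x240657) (B 228 (G 0x250647) (B 240 (G 0x450627) (B 195 (Y 0x01264735) (B
209 (G 0x061724) (B 210 (G 0x160724) (B 197 (Y 0x10234657) (B 201 (B 225 (G 0x061735) (B 216 (G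
0x360417) L)) (B 216 (B 225 L L) (B 225 (Y 0x40251637) L)))))))))))))) (B 180 (Y 0x04251367) (B 212
(G 0x240657) (B 228 (G 0x250647) (B 240 (G 0x450627) (B 184 (Y 0x04251367) (B 195 (Y 0x01264735) (B
209 (G 0x061724) (B 210 (G 0x160724) (B 197 (Y 0x10234657) (B 201 (Y 0x10234657) (B 216 (Y
0x10234657) (B 225 (Y 0x04251367) (B 226 (Y 0x04251367) (B 232 L
L))))))))))))))))))))))))))))))))))) (B 120 (Y 0x01324567) (B 135 (Y 0x01234576) (B 149 (G 0x021734)
(B 150 (G 0x120734) (B 139 (Y 0x01234576) (B 153 (G 0x031724) (B 154 (G 0x130724) (B 141 (Y
0x01234576) (B 165 (G 0x021537) (B 169 (G 0x031527) (B 172 (G 0x230715) (B 142 (Y 0x10234657) (B 198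
(G 0x120637) (B 202 (G 0x130627) (B 204 (G 0x230617) (B 156 (B 180 (G 0x240735) (B 212 (G 0x240736)
(B 184 (G 0x340725) (B 216 (G 0x340726) (B 163 (Y 0x01254376) (B 177 (G 0x051724) (B 178 (G
0x150724) (B 166 (B 170 (G 0x150723) (Y 0x01254376)) (B 170 (Y 0x01324567) (B 195 (Y 0x01264735) (B
209 (G 0x061724) (B 210 (G 0x160724) (B 197 (B 201 (G 0x061723) (Y 0x01264735)) (B 201 (Y
0x01324567) (B 225 (B 226 (Y 0x01564723) (B 228 (G 0x560217) (B 232 (G 0x560317) (B 240 (G 0x560417)
L)))) (B 226 (Y 0x10234657) (B 228 (B 232 (G 0x560723) (B 240 (G 0x560724) L)) (B 232 (Y 0x01324567)
(B 240 (Y 0x04231576) L))))))))))))))))))) (B 163 (Y 0x01254376) (B 177 (G 0x051724) (B 178 (G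
0x150724) (B 166 (B 170 (G 0x150723) (B 226 (G 0x150726) (B 180 (G 0x250714) (B 228 (G 0x250716) (B
184 (Y 0x01254376) (B 195 (Y 0x01264735) (B 209 (G 0x061724) (B 210 (G 0x160724) (B 197 (B 201 (G
0x061723) (B 225 (G 0x061725) (B 212 (G 0x260417) (B 216 (Y 0x01264735) (B 232 (B 240 (G 0x560734)
L) (B 240 (Y 0x01254376) L)))))) (B 201 (B 225 (G 0x061735) (B 216 (G 0x360417) (B 232 (G 0x360517)
(B 212 (Y 0x01364725) (B 240 L L))))) (B 212 (B 216 (G 0x460723) (B 240 (G 0x460725) (B 225 (Y
0x01254376) (B 232 L L)))) (B 216 (B 232 (G 0x360745) (B 240 (G 0x460735) (B 225 (Y 0x01254376) L)))
(B 225 (Y 0x01254376) (B 232 (B 240 (G 0x560734) L) (B 240 (Y 0x01254376) L))))))))))))))) (B 170 (Y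
0x01324567) (B 180 (B 212 (G 0x240756) (B 228 (G 0x250746) (B 184 (G 0x450723) (B 240 (G 0x450726)
(B 195 (Y 0x01264735) (B 209 (G 0x061724) (B 210 (G 0x160724) (B 197 (Y 0x10234657) (B 201 (Y
0x10234657) (B 216 (B 232 (G 0x360745) (B 225 (Y 0x04251376) (B 226 (Y 0x10324657) L))) (B 225 (Y
0x04251376) (B 226 (Y 0x04251376) (B 232 L L))))))))))))) (B 184 (Y 0x01324567) (B 195 (Y
0x01264735) (B 209 (G 0x061724) (B 210 (G 0x160724) (B 197 (Y 0x10234657) (B 201 (Y 0x01324567) (B
212 (Y 0x10234657) (B 216 (Y 0x01324567) (B 225 (B 226 (Y 0x01564723) (B 228 (G 0x560217) (B 232 (G
0x560317) (B 240 (G 0x560417) L)))) (B 226 (Y 0x10234657) (B 228 (B 232 (G 0x560723) (B 240 (G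
0x560724) L)) (B 232 (Y 0x01324567) (B 240 L L)))))))))))))))))))))))))))))))))))))))))) (B 92 (Y
0x04231567) (B 99 (Y 0x01254367) (B 113 (G 0x051624) (B 114 (G 0x150624) (B 102 (Y 0x01254367) (B
106 (Y 0x01324567) (B 116 (Y 0x01254367) (B 120 (Y 0x01324567) (B 135 (Y 0x01234576) (B 149 (G
0x021734) (B 150 (G 0x120734) (B 139 (Y 0x01234576) (B 153 (G 0x031724) (B 154 (G 0x130724) (B 141
(Y 0x01234576) (B 165 (G 0x021537) (B 169 (G 0x031527) (B 172 (G 0x230715) (B 142 (Y 0x01234576) (B
156 (Y 0x01234576) (B 163 (Y 0x01234576) (B 177 (G 0x051724) (B 178 (G 0x150724) (B 166 (Y
0x01234576) (B 170 (Y 0x01234576) (B 180 (Y 0x01234576) (B 184 (Y 0x01234576) (B 195 (Y 0x01264735)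
(B 209 (G 0x061724) (B 210 (G 0x160724) (B 197 (B 201 (G 0x061723) (B 225 (G 0x061725) (B 198 (Y
0x01264735) (B 204 (G 0x260317) (B 212 (G 0x260417) (B 228 (G 0x260517) (B 202 (Y 0x01264735) (B 216
(Y 0x01264735) (B 226 (Y 0x01254367) (B 232 (B 240 (G 0x560734) L) (B 240 (Y 0x01254367)
L))))))))))) (B 198 (B 202 (G 0x160723) (B 226 (G 0x160725) (B 204 (G 0x260713) (B 212 (G 0x260714)
(B 228 (G 0x260715) (B 201 (Y 0x01324567) (B 216 (Y 0x10264735) (B 225 (Y 0x01254367) (B 232 (B 240
(G 0x560734) L) (B 240 (Y 0x01254367) L)))))))))) (B 201 (Y 0x01324567) (B 202 (Y 0x01324567) (B 204
(B 212 (G 0x260734) (B 228 (G 0x260735) (B 216 (G 0x360724) (B 232 (G 0x360725) (B 225 (Y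
0x01254367) (B 226 (Y 0x01254367) (B 240 (Y 0x04231567) L))))))) (B 212 (Y 0x04231567) (B 216 (Y
0x01324567) (B 225 (Y 0x01254367) (B 226 (Y 0x01254367) (B 228 (Y 0x01254367) (B 232 (Y 0x01324567)
(B 240 (Y 0x01254367) L))))))))))))))))))))))))))))))))))))))))))))))))))))))) (B 46 (Y 0x10234567)
(B 60 (Y 0x04231567) (B 71 (Y 0x01234657) (B 85 (G 0x021634) (B 86 (G 0x120634) (B 75 (Y 0x01234657)
(B 89 (G 0x031624) (B 90 (G 0x130624) (B 77 (Y 0x01234657) (B 78 (Y 0x01234657) (B 92 (Y 0x01234657)
(B 99 (Y 0x01254367) (B 113 (G 0x051624) (B 114 (G 0x150624) (B 101 (Y 0x01254367) (B 102 (Y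
0x01254367) (B 105 (Y 0x01324567) (B 106 (Y 0x01324567) (B 108 (B 116 (G 0x250634) (B 120 (G
0x350624) (B 135 (Y 0x01234576) (B 149 (G 0x021734) (B 150 (G 0x120734) (B 139 (Y 0x01234576) (B 153
(G 0x031724) (B 154 (G 0x130724) (B 141 (Y 0x01234576) (B 142 (Y 0x01234576) (B 156 (Y 0x01234576)
(B 163 (Y 0x01234576) (B 177 (G 0x051724) (B 178 (G 0x150724) (B 165 (Y 0x01234576) (B 166 (Y
0x01234576) (B 169 (Y 0x01234576) (B 170 (Y 0x01234576) (B 172 (B 204 (B 180 (G 0x250734) (B 228 (B
184 (G 0x350724) (B 232 (B 195 (Y 0x01234657) (B 209 (G 0x061724) (B 210 (G 0x160724) (B 197 (Y
0x01234657) (B 198 (G 0x260713) (B 212 (G 0x260734) (B 201 (Y 0x01234657) (B 202 (G 0x360712) (B 216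
(G 0x360724) (B 225 (Y 0x01254367) (B 226 (G 0x560712) (B 240 (G 0x560724) L)))))))))))) (G
0x350267))) (G 0x250367))) (G 0x230567)) (B 204 (G 0x230657) (B 228 (G 0x250637) (B 232 (G 0x350627)
(B 180 (Y 0x01254367) (B 184 (Y 0x01324567) (B 195 (Y 0x01234657) (B 209 (G 0x061724) (B 210 (G
0x160724) (B 197 (Y 0x01234657) (B 198 (Y 0x01234657) (B 201 (Y 0x01234657) (B 202 (Y 0x01234657) (B
212 (Y 0x01234657) (B 216 (Y 0x01234657) (B 225 (Y 0x01254367) (B 226 (Y 0x01254367) (B 240 (Y
0x01254367) L)))))))))))))))))))))))))))))))))))) (B 116 (Y 0x01254367) (B 120 (Y 0x01324567) (B 135
(Y 0x01234576) (B 149 (G 0x021734) (B 150 (G 0x120734) (B 139 (Y 0x01234576) (B 153 (G 0x031724) (B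
154 (G 0x130724) (B 141 (Y 0x01234576) (B 142 (Y 0x01234576) (B 156 (Y 0x01234576) (B 163 (Y
0x01234576) (B 177 (G 0x051724) (B 178 (G 0x150724) (B 165 (Y 0x01234576) (B 166 (Y 0x01234576) (B
169 (Y 0x01234576) (B 170 (Y 0x01234576) (B 172 (Y 0x01234576) (B 180 (Y 0x01234576) (B 184 (Y
0x01234576) (B 195 (Y 0x01234657) (B 209 (G 0x061724) (B 210 (G 0x160724) (B 197 (Y 0x01234657) (B
198 (Y 0x01234657) (B 201 (Y 0x01234657) (B 202 (Y 0x01234657) (B 204 (Y 0x01234657) (B 212 (Y
0x01234657) (B 216 (Y 0x01234657) (B 225 (Y 0x01254367) (B 226 (Y 0x01254367) (B 228 (Y 0x01254367)
(B 232 (Y 0x01324567) (B 240 (Y 0x01254367)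
L)))))))))))))))))))))))))))))))))))))))))))))))))))))))))))))))) (G 0x012347)) (G 0x012346)) (G
0x012345)) (B 29 (Y 0x02134567) (B 30 (Y 0x10234567) (B 39 (B 51 (B 53 (B 54 (B 43 (Y 0x01235467) (B
45 (Y 0x01235467) (B 46 (Y 0x01235467) (B 57 (Y 0x01432567) (B 58 (Y 0x01432567) (B 60 (Y
0x02134567) (B 71 (B 83 (B 99 (B 85 (B 101 (B 86 (B 102 (B 113 (B 114 (B 116 (P 119) (G 0x240356))
(G 0x140356)) (G 0x041356)) (G 0x120356)) (G 0x120346)) (G 0x021356)) (G 0x021346)) (G 0x012356)) (G
0x012346)) (B 83 (G 0x012634) (B 99 (G 0x012635) (B 85 (G 0x021634) (B 101 (G 0x021635) (B 86 (G
0x120634) (B 102 (G 0x120635) (B 113 (G 0x041635) (B 114 (G 0x140635) (B 116 (G 0x240635) (B 75 (B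
77 (Y 0x01326457) (B 89 (G 0x031426) (B 105 (G 0x031526) (B 78 (Y 0x01326457) (B 90 (G 0x130426) (B
106 (G 0x130526) (B 92 (B 108 (G 0x230645) (B 120 (G 0x340625) (B 135 (B 147 (B 163 (B 149 (B 165 (B
150 (B 166 (B 177 (B 178 (B 180 (P 183) (G 0x240357)) (G 0x140357)) (G 0x041357)) (G 0x120357)) (G
0x120347)) (G 0x021357)) (G 0x021347)) (G 0x012357)) (G 0x012347)) (B 147 (G 0x012734) (B 163 (G
0x012735) (B 149 (G 0x021734) (B 165 (G 0x021735) (B 150 (G 0x120734) (B 166 (G 0x120735) (B 177 (G
0x041735) (B 178 (G 0x140735) (B 180 (G 0x240735) (B 139 (B 195 (B 201 (B 202 (B 141 (Y 0x01234576)
(B 153 (G 0x031427) (B 169 (G 0x031527) (B 142 (Y 0x01234576) (B 154 (G 0x130427) (B 170 (G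
0x130527) (B 156 (B 204 (Y 0x30126745) (G 0x230467)) (B 204 (G 0x230647) (B 212 (G 0x240637) (B 216
(G 0x340627) (B 232 (G 0x360527) (B 172 (B 228 (G 0x250736) (B 184 (G 0x350724) (B 197 (Y
0x01264537) (B 209 (G 0x061427) (B 225 (G 0x061527) (B 198 (Y 0x01264537) (B 210 (G 0x160427) (B 226
(G 0x160527) (B 240 L L))))))))) (B 184 (Y 0x01432567) (B 197 (Y 0x01264537) (B 209 (G 0x061427) (B
225 (G 0x061527) (B 198 (Y 0x01264537) (B 210 (G 0x160427) (B 226 (G 0x160527) (B 228 (Y 0x01264537)
(B 240 (Y 0x01264537) L))))))))))))))))))))) (G 0x130267)) (G 0x031267)) (G 0x012367)) (B 195 (G
0x012637) (B 201 (G 0x031726) (B 202 (G 0x130726) (B 141 (B 197 (G 0x021736) (B 153 (G 0x031724) (B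
169 (G 0x031725) (B 142 (Y 0x02134576) (B 156 (G 0x230417) (B 172 (G 0x230517) (B 204 (G 0x230617)
(B 212 (G 0x240637) (B 216 (G 0x340627) (B 154 (B 170 (G 0x130745) (B 210 (G 0x140736) (B 184 (G
0x340715) (B 198 (B 226 (G 0x160725) (B 228 (G 0x260715) (B 209 (B 225 (G 0x061745) (B 240 (G
0x460517) (B 232 (U 0x260347 [:: 0x120364; 0x132476; 0x160243; 0x162347; 0x230617; 0x460127] [::])
(U 0x071234 [:: 0x031476; 0x240671; 0x270164; 0x340716; 0x460321; 0x670234] [::])))) (B 225 (B 232
(G 0x560317) (B 240 (G 0x560417) L)) (B 232 (B 240 (G 0x560734) L) (B 240 (Y 0x41230576) L)))))) (B
209 (Y 0x10432567) (B 225 (B 226 (Y 0x05162473) (B 228 (G 0x560217) (B 232 (G 0x560317) (B 240 (G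
0x560417) L)))) (B 226 (Y 0x10432567) (B 228 (Y 0x02134576) (B 232 (B 240 (G 0x560734) L) (B 240 (Y
0x10432567) L)))))))))) (B 170 (B 226 (G 0x150736) (B 184 (G 0x350714) (B 232 (G 0x350716) (B 198 (B
210 (G 0x160724) (B 228 (G 0x260715) (B 209 (Y 0x01462537) (B 225 (Y 0x02135476) (B 240 L L))))) (B
209 (B 225 (G 0x061745) (B 210 (G 0x460127) (B 240 (G 0x460517) (B 228 (Y 0x40265173) L)))) (B 210
(B 240 (G 0x460715) (B 225 (Y 0x02135476) (B 228 L L))) (B 225 (Y 0x02135476) (B 228 (Y 0x02135476)
(B 240 L L))))))))) (B 184 (Y 0x20435176) (B 198 (B 210 (G 0x160724) (B 226 (G 0x160725) (B 228 (G
0x260715) (B 209 (Y 0x01462537) (B 225 (B 240 (G 0x560417) (Y 0x05162473)) (B 232 (B 240 (G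
0x560734) L) (B 240 (Y 0x10264537) L))))))) (B 209 (Y 0x24031567) (B 210 (B 226 (G 0x160745) (B 240
(G 0x460715) (B 225 (B 228 (G 0x560217) (Y 0x05164273)) (B 228 (Y 0x10462537) (B 232 L L))))) (B 225
(B 226 (Y 0x05162473) (B 228 (G 0x560217) (B 232 (G 0x560317) (B 240 (G 0x560417) L)))) (B 226 (B
228 (G 0x560712) (B 232 (G 0x560713) (B 240 (G 0x560714) L))) (B 228 (Y 0x24031567) (B 232 (B 240 (G
0x560734) L) (B 240 (Y 0x24031567) L)))))))))))))))))))) (B 142 (Y 0x10234567) (B 153 (Y 0x01432567)
(B 154 (Y 0x01432567) (B 156 (Y 0x24031567) (B 204 (G 0x230647) (B 212 (G 0x240637) (B 216 (G
0x340627) (B 169 (B 225 (G 0x051736) (B 170 (Y 0x03517246) (B 172 (G 0x350217) (B 184 (G 0x350417)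
(B 232 (G 0x350617) (B 197 (Y 0x01264537) (B 198 (Y 0x01264537) (B 209 (Y 0x01264537) (B 210 (Y
0x01264537) (B 226 (B 228 (G 0x560712) (B 240 (G 0x560714) L)) (B 228 (B 240 (G 0x560724) L) (B 240
(Y 0x01432567) L)))))))))))) (B 170 (Y 0x10234567) (B 172 (Y 0x24031567) (B 184 (Y 0x01432567) (B
197 (Y 0x01264537) (B 198 (Y 0x01264537) (B 209 (Y 0x01264537) (B 210 (Y 0x01264537) (B 225 (Y
0x01264537) (B 226 (Y 0x01264537) (B 228 (Y 0x01264537) (B 232 (B 240 (G 0x560734) L) (B 240 (Y
0x01264537) L))))))))))))))))))))))))))))))))))))) (B 108 (Y 0x01235467) (B 120 (Y 0x01432567) (B
135 (B 147 (B 163 (B 149 (B 165 (B 150 (B 166 (B 177 (B 178 (B 180 (P 183) (G 0x240357)) (G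
0x140357)) (G 0x041357)) (G 0x120357)) (G 0x120347)) (G 0x021357)) (G 0x021347)) (G 0x012357)) (G
0x012347)) (B 147 (G 0x012734) (B 163 (G 0x012735) (B 149 (G 0x021734) (B 165 (G 0x021735) (B 150 (G
0x120734) (B 166 (G 0x120735) (B 177 (G 0x041735) (B 178 (G 0x140735) (B 180 (G 0x240735) (B 139 (B
195 (B 201 (B 202 (B 141 (Y 0x01234576) (B 153 (G 0x031427) (B 169 (G 0x031527) (B 142 (Y
0x01234576) (B 154 (G 0x130427) (B 170 (G 0x130527) (B 156 (Y 0x01234576) (B 172 (Y 0x01234576) (B
184 (Y 0x01234576) (B 197 (Y 0x01264537) (B 209 (G 0x061427) (B 225 (G 0x061527) (B 198 (Y
0x01264537) (B 210 (G 0x160427) (B 226 (G 0x160527) (B 204 (Y 0x01326745) (B 216 (G 0x360427) (B 232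
(G 0x360527) (B 212 (Y 0x01264537) (B 228 (Y 0x01235467) (B 240 (Y 0x01264537)
L))))))))))))))))))))) (G 0x130267)) (G 0x031267)) (G 0x012367)) (B 195 (G 0x012637) (B 201 (G
0x031726) (B 202 (G 0x130726) (B 141 (B 197 (G 0x021736) (B 153 (G 0x031724) (B 169 (G 0x031725) (B
142 (Y 0x02134576) (B 156 (G 0x230417) (B 172 (G 0x230517) (B 204 (G 0x230617) (B 154 (Y 0x02134576)
(B 170 (Y 0x01235467) (B 184 (Y 0x02134576) (B 198 (B 210 (G 0x160724) (B 226 (G 0x160725) (B 212 (G
0x260714) (B 228 (G 0x260715) (B 209 (Y 0x01462537) (B 216 (B 232 (G 0x360745) (B 240 (G 0x460735)
(B 225 (Y 0x01235467) L))) (B 225 (Y 0x01235467) (B 232 (Y 0x01235467) (B 240 (Y 0x10264537)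
L))))))))) (B 209 (B 225 (G 0x061745) (B 210 (Y 0x01462537) (B 212 (G 0x460217) (B 216 (G 0x460317)
(B 240 (G 0x460517) (B 226 (Y 0x01462537) (B 228 (Y 0x01462537) (B 232 L L)))))))) (B 210 (B 226 (G
0x160745) (B 212 (G 0x460712) (B 216 (G 0x460713) (B 240 (G 0x460715) (B 225 (Y 0x01235467) (B 228
(Y 0x10462537) (B 232 L L))))))) (B 212 (Y 0x02134576) (B 216 (B 232 (G 0x360745) (B 240 (G
0x460735) (B 225 (Y 0x01235467) (B 226 (Y 0x01235467) (B 228 (Y 0x01235467) L))))) (B 225 (Y
0x01235467) (B 226 (Y 0x01235467) (B 228 (Y 0x01235467) (B 232 (Y 0x01235467) (B 240 L
L)))))))))))))))))))) (B 142 (Y 0x10234567) (B 153 (Y 0x01432567) (B 154 (Y 0x01432567) (B 156 (B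
172 (G 0x230745) (B 204 (G 0x230746) (B 212 (G 0x240736) (B 184 (G 0x340725) (B 216 (G 0x340726) (B
169 (Y 0x01235467) (B 170 (Y 0x01235467) (B 197 (Y 0x01264537) (B 198 (Y 0x01264537) (B 209 (Y
0x01264537) (B 210 (Y 0x01264537) (B 225 (Y 0x01265437) (B 226 (Y 0x01265437) (B 228 (Y 0x24031576)
(B 232 (B 240 (G 0x560734) L) (B 240 (Y 0x01432567) L)))))))))))))))) (B 169 (Y 0x01235467) (B 170
(Y 0x01235467) (B 172 (Y 0x01235467) (B 184 (Y 0x01432567) (B 197 (Y 0x01264537) (B 198 (Y
0x01264537) (B 204 (B 212 (G 0x260734) (B 228 (G 0x260735) (B 216 (G 0x360724) (B 232 (G 0x360725)
(B 209 (Y 0x01264537) (B 210 (Y 0x01264537) (B 225 (Y 0x01235467) (B 226 (Y 0x01235467) (B 240 (Y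
0x01264537) L))))))))) (B 209 (Y 0x01264537) (B 210 (Y 0x01264537) (B 212 (Y 0x01264537) (B 216 (Y
0x01432567) (B 225 (Y 0x01235467) (B 226 (Y 0x01235467) (B 228 (Y 0x01235467) (B 232 (Y 0x01235467)
(B 240 (Y 0x01264537) L)))))))))))))))))))))))))))))))))))))))))))) (B 77 (Y 0x02134567) (B 78 (Y
0x10234567) (B 89 (Y 0x01432567) (B 90 (Y 0x01432567) (B 92 (Y 0x02134567) (B 105 (Y 0x01235467) (B
106 (Y 0x01235467) (B 108 (Y 0x01235467) (B 120 (Y 0x01432567) (B 135 (B 147 (B 163 (B 149 (B 165 (B
150 (B 166 (B 177 (B 178 (B 180 (P 183) (G 0x240357)) (G 0x140357)) (G 0x041357)) (G 0x120357)) (G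
0x120347)) (G 0x021357)) (G 0x021347)) (G 0x012357)) (G 0x012347)) (B 147 (G 0x012734) (B 163 (G
0x012735) (B 149 (G 0x021734) (B 165 (G 0x021735) (B 150 (G 0x120734) (B 166 (G 0x120735) (B 177 (G
0x041735) (B 178 (G 0x140735) (B 180 (G 0x240735) (B 139 (Y 0x01234576) (B 141 (Y 0x01234576) (B 142
(Y 0x01234576) (B 153 (Y 0x01234576) (B 154 (Y 0x01234576) (B 156 (Y 0x01234576) (B 169 (Y
0x01234576) (B 170 (Y 0x01234576) (B 172 (Y 0x01234576) (B 184 (Y 0x01234576) (B 195 (Y 0x01264537)
(B 197 (Y 0x01264537) (B 198 (Y 0x01264537) (B 201 (B 209 (G 0x061734) (B 225 (G 0x061735) (B 202 (Y
0x03617245) (B 204 (G 0x360217) (B 216 (G 0x360417) (B 232 (G 0x360517) (B 210 (Y 0x01264537) (B 212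
(Y 0x01264537) (B 226 (Y 0x01235467) (B 228 (Y 0x01235467) (B 240 (Y 0x01264537) L))))))))))) (B 202
(Y 0x10234567) (B 204 (Y 0x02134567) (B 209 (Y 0x01264537) (B 210 (Y 0x01264537) (B 212 (Y
0x01264537) (B 216 (Y 0x01432567) (B 225 (Y 0x01235467) (B 226 (Y 0x01235467) (B 228 (Y 0x01235467)
(B 232 (Y 0x01235467) (B 240 (Y 0x01264537)
L))))))))))))))))))))))))))))))))))))))))))))))))))))))))))))) (G 0x120345)) (G 0x021345)) (G
0x012345)) (B 51 (G 0x012534) (B 53 (G 0x021534) (B 54 (G 0x120534) (B 43 (B 45 (Y 0x01325467) (B 57
(G 0x031425) (B 46 (Y 0x01325467) (B 58 (G 0x130425) (B 60 (B 71 (Y 0x01234657) (B 83 (G 0x012634)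
(B 85 (G 0x021634) (B 86 (G 0x120634) (B 75 (Y 0x01325467) (B 99 (G 0x012536) (B 105 (G 0x031625) (B
106 (G 0x130625) (B 77 (B 101 (G 0x021635) (B 89 (G 0x031624) (B 78 (Y 0x02134657) (B 92 (G
0x230416) (B 108 (G 0x230516) (B 116 (G 0x240536) (B 120 (G 0x340526) (B 90 (B 114 (G 0x140635) (B
102 (B 113 (B 135 (Y 0x01234576) (B 147 (G 0x012734) (B 149 (G 0x021734) (B 150 (G 0x120734) (B 139
(Y 0x01234576) (B 163 (G 0x012537) (B 169 (G 0x031725) (B 170 (G 0x130725) (B 141 (Y 0x02134657) (B
197 (G 0x021637) (B 201 (G 0x031627) (B 204 (G 0x230716) (B 142 (B 166 (G 0x120735) (B 198 (G
0x120736) (B 154 (G 0x130724) (B 202 (G 0x130726) (B 156 (G 0x230714) (B 172 (G 0x230715) (B 226 (G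
0x150627) (B 228 (G 0x250617) (B 180 (G 0x251437) (B 210 (G 0x162437) (B 216 (G 0x340617) (B 184 (G
0x341527) (B 153 (B 177 (G 0x041735) (B 209 (G 0x041736) (B 225 (G 0x051647) (B 240 (G 0x450716) (B
165 (B 178 (B 195 (B 212 (B 232 (U 0x671352 [:: 0x061357; 0x062573; 0x063547; 0x360417; 0x560127;
0x670243] [::]) (U 0x370562 [:: 0x130462; 0x140532; 0x360172; 0x450712; 0x570342] [::])) (B 232 (Y
0x01325467) (U 0x371564 [:: 0x051463; 0x061543; 0x123564; 0x132657; 0x140652; 0x340567] [::]))) (B
212 (Y 0x24031567) (B 232 (Y 0x01325467) (U 0x361572 [:: 0x021573; 0x120754; 0x142756; 0x163574;
0x230576] [::])))) (B 195 (B 212 (Y 0x02134657) (B 232 (Y 0x01325467) (U 0x671243 [:: 0x041563;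
0x051743; 0x271653; 0x460137; 0x570312] [::]))) (B 212 (Y 0x20346157) (B 232 (Y 0x01325467) (U
0x460271 [:: 0x042657; 0x051726; 0x052467; 0x132547; 0x142367; 0x150273] [::]))))) (B 178 (Y
0x10345267) (B 195 (Y 0x02134657) (B 212 (Y 0x02134657) (B 232 (U 0x370154 [:: 0x031627; 0x130745;
0x130467; 0x230175; 0x351247; 0x370651] [::]) (U 0x670352 [:: 0x062547; 0x072436; 0x120764;
0x240671; 0x260157; 0x270316] [::])))))))))) (B 165 (Y 0x01325467) (B 177 (Y 0x01452367) (B 209 (G
0x041657) (B 225 (G 0x051647) (B 240 (G 0x450716) (B 178 (Y 0x24150367) (B 195 (Y 0x02134657) (B 212
(Y 0x02134657) (B 232 (Y 0x01325467) (U 0x350246 [:: 0x031465; 0x120354; 0x130642; 0x150264;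
0x230516; 0x560134] [::]))))))))))))))))))))))) (B 153 (B 154 (Y 0x01345276) (Y 0x10345267)) (B 154
(Y 0x10345267) (B 202 (G 0x130647) (B 210 (G 0x140637) (B 216 (G 0x340617) (B 156 (Y 0x02134657) (B
172 (G 0x230547) (B 180 (G 0x240537) (B 184 (G 0x340527) (B 165 (Y 0x01325467) (B 166 (Y 0x01325467)
(B 198 (G 0x120657) (B 226 (G 0x150627) (B 228 (G 0x250617) (B 177 (Y 0x01452367) (B 209 (G
0x041657) (B 225 (G 0x051647) (B 240 (G 0x450716) (B 178 (Y 0x01452367) (B 195 (Y 0x02134657) (B 212
(Y 0x02134657) (B 232 (Y 0x01325467) (U 0x061234 [:: 0x031465; 0x041632; 0x061543; 0x160254;
0x340526; 0x461253] [::])))))))))))))))))))))))))))))))))))) (B 135 (Y 0x01234576) (B 147 (G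
0x012734) (B 149 (G 0x021734) (B 150 (G 0x120734) (B 139 (Y 0x01234576) (B 163 (G 0x012537) (B 169
(G 0x031725) (B 170 (G 0x130725) (B 141 (Y 0x02134657) (B 197 (G 0x021637) (B 201 (G 0x031627) (B
204 (G 0x230716) (B 142 (B 166 (G 0x120735) (B 198 (G 0x120736) (B 154 (G 0x130724) (B 202 (G
0x130726) (B 156 (G 0x230714) (B 172 (G 0x230715) (B 226 (G 0x150627) (B 228 (G 0x250617) (B 180 (G
0x251437) (B 210 (G 0x162437) (B 216 (G 0x340617) (B 184 (G 0x341527) (B 153 (B 177 (G 0x041735) (B
209 (G 0x041736) (B 165 (B 225 (G 0x051726) (B 178 (Y 0x01254376) (B 195 (B 212 (Y 0x01264735) (B
232 (Y 0x01325467) (B 240 (U 0x450127 [:: 0x012654; 0x013764; 0x023574; 0x051263; 0x071432;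
0x260513; 0x360152; 0x451672; 0x560127; 0x561742] [:: 0x012654; 0x013764; 0x032475; 0x042735;
0x071432; 0x160327; 0x172563; 0x250431; 0x250147; 0x350271]) L))) (B 212 (B 240 (G 0x460725) (B 232
(U 0x140573 [:: 0x061234; 0x150463; 0x160523; 0x360142; 0x460273; 0x470613] [::]) (U 0x560134 [::
0x021573; 0x051623; 0x270134; 0x461753; 0x471263] [::]))) (B 232 (Y 0x01325467) (B 240 (U 0x071356
[:: 0x031746; 0x241356; 0x251476; 0x340162; 0x570612] [::]) (U 0x071456 [:: 0x041736; 0x251376;
0x340165; 0x351426; 0x570612] [::]))))))) (B 178 (Y 0x24130576) (B 195 (Y 0x02134657) (B 212 (Y
0x02134657) (B 225 (B 232 (G 0x560317) (B 240 (G 0x560417) L)) (B 232 (B 240 (G 0x560734) (U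
0x063457 [:: 0x021734; 0x042736; 0x120375; 0x251376; 0x360752; 0x670532] [::])) (B 240 (Y
0x41230657) L))))))))) (B 165 (Y 0x01325467) (B 177 (B 209 (G 0x041756) (B 225 (G 0x051746) (B 178
(G 0x450127) (B 240 (G 0x450617) (B 195 (Y 0x02134657) (B 212 (Y 0x41230657) (B 232 (Y 0x01325467)
L))))))) (B 178 (Y 0x42130567) (B 195 (Y 0x02134657) (B 209 (Y 0x02134657) (B 212 (Y 0x02134657) (B
225 (Y 0x01325467) (B 232 (Y 0x01325467) (B 240 (Y 0x41230657) L)))))))))))))))))))))) (B 153 (B 177
(G 0x041735) (B 209 (G 0x041736) (B 154 (Y 0x01345276) (B 202 (G 0x130647) (B 210 (G 0x140637) (B
156 (G 0x340217) (B 184 (G 0x340517) (B 216 (G 0x340617) (B 172 (G 0x230547) (B 180 (G 0x240537) (B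
165 (B 225 (G 0x051726) (B 166 (G 0x250137) (B 228 (G 0x250617) (B 226 (G 0x560127) (B 198 (G
0x120657) (B 178 (B 240 (G 0x450716) (B 195 (B 212 (B 232 L (U 0x370561 [:: 0x230541; 0x240371;
0x350721; 0x470261; 0x670431] [::])) (B 232 (Y 0x01325467) (U 0x460273 [:: 0x150643; 0x260453;
0x450173; 0x470563; 0x560213] [::]))) (B 212 (Y 0x24051376) (B 232 (Y 0x01325467) (U 0x472356 [::
0x032756; 0x051623; 0x150264; 0x370624; 0x451267] [::]))))) (B 195 (B 212 (Y 0x02134657) (B 232 (Y
0x01325467) (B 240 L L))) (B 212 (B 240 (G 0x460725) (B 232 (U 0x071236 [:: 0x021756; 0x031476;
0x250163; 0x340615; 0x351246] [::]) (U 0x160357 [:: 0x150267; 0x250317; 0x340657; 0x350427;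
0x360147] [::]))) (B 232 (Y 0x01325467) (B 240 (U 0x071236 [:: 0x021756; 0x031475; 0x034567;
0x241536; 0x250164; 0x340612] [::]) (U 0x071246 [:: 0x251736; 0x270165; 0x341576; 0x351246;
0x470613] [::]))))))))))) (B 166 (Y 0x12506734) (B 198 (G 0x120657) (B 226 (G 0x150627) (B 228 (G
0x250617) (B 178 (Y 0x42130567) (B 195 (Y 0x02134657) (B 212 (Y 0x02134657) (B 225 (B 232 (G
0x560317) (B 240 (G 0x560417) L)) (B 232 (B 240 (G 0x560734) L) (B 240 (Y 0x41230657)
L))))))))))))))))))))) (B 154 (Y 0x13406725) (B 202 (G 0x130647) (B 210 (G 0x140637) (B 216 (G
0x340617) (B 156 (Y 0x02134657) (B 172 (G 0x230547) (B 180 (G 0x240537) (B 184 (G 0x340527) (B 165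
(Y 0x01325467) (B 166 (Y 0x01325467) (B 198 (G 0x120657) (B 226 (G 0x150627) (B 228 (G 0x250617) (B
177 (B 209 (G 0x041756) (B 225 (G 0x051746) (B 178 (G 0x450127) (B 240 (G 0x450617) (B 195 (Y
0x02134657) (B 212 (Y 0x41230657) (B 232 (Y 0x01325467) L))))))) (B 178 (Y 0x42130567) (B 195 (Y
0x02134657) (B 209 (Y 0x02134657) (B 212 (Y 0x02134657) (B 225 (Y 0x01325467) (B 232 (Y 0x01325467)
(B 240 (Y 0x41230657) L)))))))))))))))))))))))))))))))))))) (B 113 (Y 0x10345267) (B 135 (Y
0x01234576) (B 147 (G 0x012734) (B 149 (G 0x021734) (B 150 (G 0x120734) (B 139 (Y 0x01234576) (B 163
(G 0x012537) (B 169 (G 0x031725) (B 170 (G 0x130725) (B 141 (Y 0x02134657) (B 197 (G 0x021637) (B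
201 (G 0x031627) (B 204 (G 0x230716) (B 142 (B 166 (G 0x120735) (B 198 (G 0x120736) (B 154 (G
0x130724) (B 202 (G 0x130726) (B 156 (G 0x230714) (B 172 (G 0x230715) (B 180 (G 0x251437) (B 210 (G
0x162437) (B 216 (G 0x340617) (B 184 (G 0x341527) (B 153 (B 177 (G 0x041735) (B 209 (G 0x041736) (B
165 (Y 0x10234576) (B 178 (Y 0x01345276) (B 195 (Y 0x02134657) (B 212 (Y 0x02134657) (B 225 (B 226
(Y 0x05163724) (B 228 (G 0x560217) (B 232 (G 0x560317) (B 240 (G 0x560417) L)))) (B 226 (Y
0x10234576) (B 228 (Y 0x02134657) (B 232 (B 240 (G 0x560734) (U 0x372564 [:: 0x130475; 0x230746;
0x340251; 0x340517; 0x341276; 0x370125] [::])) (B 240 (Y 0x01432576) L))))))))))) (B 165 (B 177 (G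
0x051724) (B 225 (G 0x051726) (B 228 (G 0x250617) (B 178 (Y 0x01254376) (B 195 (B 209 (G 0x061427)
(B 226 (G 0x160527) (B 212 (Y 0x01264735) (B 232 (Y 0x01573624) (B 240 L L))))) (B 209 (B 212 (G
0x460217) (B 240 (G 0x460517) (B 226 (B 232 (G 0x560713) L) (B 232 (U 0x470152 [:: 0x130462;
0x140732; 0x350672; 0x360152; 0x570342] [::]) L)))) (B 212 (B 240 (G 0x460725) (B 226 (Y 0x10325476)
(B 232 (U 0x160357 [:: 0x012536; 0x021354; 0x240357; 0x273465; 0x671532] [::]) (U 0x053467 [::
0x031645; 0x130467; 0x172643; 0x271465; 0x570642] [::])))) (B 226 (Y 0x10325476) (B 232 (Y
0x10325476) (B 240 L L)))))))))) (B 177 (B 209 (G 0x041756) (B 225 (G 0x051746) (B 178 (G 0x450127)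
(B 240 (G 0x450617) (B 195 (Y 0x02134657) (B 212 (Y 0x14326075) (B 226 (B 228 (G 0x560712) (B 232 (G
0x560713) L)) (B 228 (Y 0x42130567) (B 232 L L))))))))) (B 178 (Y 0x24315076) (B 195 (Y 0x02134657)
(B 209 (Y 0x02134657) (B 212 (Y 0x02134657) (B 225 (B 226 (Y 0x05163724) (B 228 (G 0x560217) (B 232
(G 0x560317) (B 240 (G 0x560417) L)))) (B 226 (B 228 (G 0x560712) (B 232 (G 0x560713) (B 240 (G
0x560714) L))) (B 228 (Y 0x02134657) (B 232 (B 240 (G 0x560734) L) (B 240 (Y 0x41230657)
L)))))))))))))))))))))) (B 153 (B 154 (Y 0x01345276) (Y 0x10432567)) (B 154 (Y 0x10432567) (B 202 (G
0x130647) (B 210 (G 0x140637) (B 216 (G 0x340617) (B 156 (Y 0x02134657) (B 172 (G 0x230547) (B 180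
(G 0x240537) (B 184 (G 0x340527) (B 165 (B 177 (G 0x051724) (B 225 (G 0x051726) (B 166 (G 0x250137)
(B 228 (G 0x250617) (B 178 (B 226 (G 0x150746) (B 240 (G 0x450716) (B 195 (B 209 (G 0x061427) (B 198
(G 0x160237) (B 212 (B 232 L (U 0x360574 [:: 0x012574; 0x021756; 0x062453; 0x062743; 0x140576;
0x461573] [::])) (B 232 (U 0x670245 [:: 0x012754; 0x071426; 0x150243; 0x251346; 0x451236; 0x562374]
[::]) (U 0x570361 [:: 0x023546; 0x041632; 0x052637; 0x140367; 0x173456] [::]))))) (B 198 (B 212 (G
0x260714) (B 209 (B 232 (U 0x132465 [:: 0x041732; 0x071642; 0x130425; 0x230541; 0x230156; 0x560731;
0x560372; 0x670215] [::]) (U 0x671354 [:: 0x012674; 0x041672; 0x071254; 0x260413; 0x361724;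
0x570146] [::])) (B 232 L (U 0x561374 [:: 0x021654; 0x051274; 0x260413; 0x361524; 0x570146] [::]))))
(B 209 (Y 0x10432567) (B 212 (Y 0x24031567) (B 232 L (U 0x570364 [:: 0x012364; 0x021637; 0x072635;
0x140365; 0x451367] [::])))))))) (B 195 (B 209 (G 0x061427) (B 198 (G 0x160237) (B 226 (G 0x160527)
(B 212 (Y 0x02134657) (B 232 (B 240 (G 0x560734) (U 0x260471 [:: 0x240651; 0x250431; 0x350271;
0x570361; 0x670521] [::])) (B 240 L L)))))) (B 198 (B 226 (G 0x160725) (B 212 (G 0x260714) (B 209 (B
240 (G 0x460517) (B 232 (U 0x170452 [:: 0x130462; 0x140732; 0x360172; 0x370652; 0x570312] [::]) L))
(B 232 (B 240 (G 0x560734) (U 0x142573 [:: 0x021573; 0x120754; 0x134756; 0x230576; 0x361752] [::]))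
(B 240 L L))))) (B 209 (B 212 (G 0x460217) (Y 0x24031567)) (B 212 (Y 0x20431657) (B 226 (B 232 (G
0x560713) (B 240 (G 0x560714) L)) (B 232 (B 240 (G 0x560734) (U 0x142573 [:: 0x021576; 0x120754;
0x260573; 0x341756; 0x362574] [::])) (B 240 (Y 0x24031567) L)))))))))))) (B 166 (B 198 (G 0x120756)
(B 178 (G 0x150724) (B 226 (G 0x150726) (B 228 (G 0x250716) (B 177 (B 209 (G 0x041756) (B 225 (G
0x051746) (B 240 (G 0x450617) (B 195 (Y 0x02134657) (B 212 (Y 0x20431657) (B 232 (U 0x021354 [::
0x052473; 0x230156; 0x250713; 0x340526; 0x350271; 0x351672; 0x361254] [::]) L)))))) (B 195 (Y
0x02134657) (B 209 (B 225 (G 0x061745) (B 212 (G 0x460217) (B 240 (G 0x460517) (B 232 L L)))) (B 212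
(Y 0x20431657) (B 225 (B 232 (G 0x560317) (B 240 (G 0x560417) L)) (B 232 (B 240 (G 0x560734) L) (B
240 (Y 0x42130567) L))))))))))) (B 177 (B 178 (G 0x450127) (Y 0x10432567)) (B 178 (Y 0x10432567) (B
195 (Y 0x02134657) (B 198 (Y 0x02134657) (B 209 (Y 0x02134657) (B 212 (Y 0x02134657) (B 225 (B 226
(Y 0x05163724) (B 228 (G 0x560217) (B 232 (G 0x560317) (B 240 (G 0x560417) L)))) (B 226 (Y
0x10432567) (B 228 (Y 0x02134657) (B 232 (B 240 (G 0x560734) L) (B 240 (Y 0x10432567)
L)))))))))))))))))))))))))))))))))))))) (B 102 (Y 0x01325467) (B 113 (Y 0x23046517) (B 114 (B 135 (Y
0x01234576) (B 147 (G 0x012734) (B 149 (G 0x021734) (B 150 (G 0x120734) (B 139 (Y 0x01234576) (B 163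
(G 0x012537) (B 169 (G 0x031725) (B 170 (G 0x130725) (B 141 (Y 0x02316745) (B 197 (G 0x021637) (B
201 (G 0x031627) (B 204 (G 0x230716) (B 142 (B 166 (G 0x120735) (B 198 (G 0x120736) (B 154 (G
0x130724) (B 202 (G 0x130726) (B 156 (G 0x230714) (B 172 (G 0x230715) (B 180 (G 0x251437) (B 184 (G
0x341527) (B 153 (Y 0x01432576) (B 165 (Y 0x01325467) (B 177 (B 209 (G 0x041756) (B 225 (G 0x051746)
(B 178 (G 0x450127) (B 240 (G 0x450617) (B 210 (G 0x460157) (B 226 (G 0x560147) (B 195 (B 212 (Y
0x01264735) (B 216 (B 232 (G 0x360745) (B 228 L (U 0x670253 [:: 0x021534; 0x021654; 0x031745;
0x041362; 0x053746; 0x130276; 0x160453; 0x260713; 0x361475; 0x560143] [::]))) (B 228 (B 232 (G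
0x560723) (Y 0x01325467)) (B 232 (Y 0x01325467) L)))) (B 212 (B 228 (G 0x260745) (B 216 (G 0x460723)
(B 232 (U 0x170246 [:: 0x012754; 0x051243; 0x350247; 0x372564; 0x671423] [::]) L))) (B 216 (B 232 (G
0x360745) (B 228 L (U 0x570261 [:: 0x021674; 0x061324; 0x072546; 0x120735; 0x130265; 0x163457;
0x460371] [::]))) (B 228 (B 232 (G 0x560723) (Y 0x01325467)) (B 232 (Y 0x01325467) L))))))))))) (B
178 (Y 0x10234576) (B 210 (G 0x140657) (B 226 (G 0x150647) (B 240 (G 0x450617) (B 195 (B 209 (G
0x061427) (B 225 (G 0x061527) (B 212 (Y 0x01264735) (B 216 (B 232 (G 0x360745) (B 228 (Y 0x23016745)
L)) (B 228 (B 232 (G 0x560723) (Y 0x01325467)) (B 232 (Y 0x01325467) L)))))) (B 209 (B 225 (G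
0x061745) (B 212 (G 0x460217) (B 216 (G 0x460317) (B 228 (B 232 (G 0x560723) L) (B 232 L L))))) (B
212 (B 228 (G 0x260745) (B 216 (G 0x460723) (B 225 (Y 0x01325467) (B 232 (U 0x160257 [:: 0x120754;
0x120674; 0x150263; 0x251346; 0x261475; 0x561732] [::]) L)))) (B 216 (B 232 (G 0x360745) (B 225 (Y
0x01325467) (B 228 (U 0x450137 [:: 0x031627; 0x031465; 0x140532; 0x152467; 0x230174; 0x360752;
0x372645; 0x561273] [::]) L))) (B 225 (Y 0x01325467) (B 228 (B 232 (G 0x560723) (Y 0x01325467)) (B
232 (Y 0x01325467) L)))))))))))))))))))))) (B 153 (B 154 (Y 0x01345276) (B 156 (G 0x340217) (Y
0x24031567))) (B 154 (B 178 (G 0x140735) (B 184 (G 0x340715) (Y 0x53140267))) (B 156 (Y 0x23405716)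
(B 172 (G 0x230547) (B 180 (G 0x240537) (B 184 (G 0x340527) (B 165 (Y 0x01325467) (B 166 (Y
0x01325467) (B 177 (B 178 (G 0x450127) (Y 0x10452367)) (B 178 (Y 0x10452367) (B 210 (G 0x140657) (B
226 (G 0x150647) (B 240 (G 0x450617) (B 195 (B 209 (G 0x061427) (B 225 (G 0x061527) (B 198 (G
0x160247) (B 202 (G 0x160347) (B 212 (B 228 (G 0x260745) (B 216 (G 0x460723) (B 232 L (U 0x671354
[:: 0x012537; 0x021354; 0x170536; 0x240357; 0x472356] [::])))) (B 216 (B 232 (G 0x360745) (B 228 L
L)) (B 228 (B 232 (G 0x560723) (Y 0x01325467)) (B 232 (Y 0x01325467) L)))))))) (B 198 (B 202 (G
0x160723) (B 212 (G 0x260714) (B 228 (G 0x260715) (B 209 (B 225 (G 0x061745) (B 216 (G 0x460317) (B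
232 (Y 0x35021467) L))) (B 216 (B 232 (G 0x360745) (B 225 L L)) (B 225 (B 232 (G 0x560317) (Y
0x35021467)) (B 232 (Y 0x35021467) L))))))) (B 202 (Y 0x01325467) (B 209 (Y 0x10452367) (B 212 (Y
0x24031567) (B 216 (Y 0x24031567) (B 225 (Y 0x01325467) (B 228 (B 232 (G 0x560723) (Y 0x01325467))
(B 232 (Y 0x01325467) L))))))))))))))))))))))))))))))))))) (B 135 (Y 0x01234576) (B 147 (G 0x012734)
(B 149 (G 0x021734) (B 150 (G 0x120734) (B 139 (Y 0x01234576) (B 163 (G 0x012537) (B 169 (G
0x031725) (B 170 (G 0x130725) (B 141 (Y 0x02316745) (B 197 (G 0x021637) (B 201 (G 0x031627) (B 204
(G 0x230716) (B 142 (B 166 (G 0x120735) (B 198 (G 0x120736) (B 154 (G 0x130724) (B 202 (G 0x130726)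
(B 156 (G 0x230714) (B 172 (G 0x230715) (B 180 (G 0x251437) (B 184 (G 0x341527) (B 153 (Y
0x01432576) (B 165 (Y 0x01325467) (B 177 (B 178 (G 0x450127) (Y 0x01452376)) (B 178 (Y 0x10234576)
(B 195 (B 209 (G 0x061427) (B 225 (G 0x061527) (B 210 (G 0x160427) (B 226 (G 0x160527) (B 212 (Y
0x01264735) (B 216 (Y 0x06127345) (B 228 (B 232 (G 0x560723) (Y 0x01325467)) (B 232 (Y 0x01325467)
(B 240 L L))))))))) (B 209 (B 225 (G 0x061745) (B 210 (Y 0x04162735) (B 212 (G 0x460217) (B 216 (G
0x460317) (B 240 (G 0x460517) (B 226 (B 228 (G 0x560712) (B 232 (G 0x560713) L)) (B 228 (B 232 (G
0x560723) L) (B 232 L L)))))))) (B 210 (Y 0x10234576) (B 212 (B 228 (G 0x260745) (B 216 (G 0x460723)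
(B 240 (G 0x460725) (B 225 (Y 0x01325467) (B 226 (Y 0x01325467) (B 232 (U 0x670231 [:: 0x240531;
0x240651; 0x260741; 0x340251; 0x350461; 0x360571] [::]) L)))))) (B 216 (B 232 (G 0x360745) (B 240 (G
0x460735) (B 225 (Y 0x01325467) (B 226 (Y 0x01325467) (B 228 L L))))) (B 225 (Y 0x01325467) (B 226
(Y 0x01325467) (B 228 (B 232 (G 0x560723) (Y 0x01325467)) (B 232 (Y 0x01325467) (B 240 L
L)))))))))))))))))))))) (B 153 (B 154 (Y 0x01345276) (B 156 (G 0x340217) (Y 0x24031567))) (B 154 (B
202 (G 0x130746) (B 178 (G 0x140735) (B 210 (G 0x140736) (B 156 (G 0x340712) (B 184 (G 0x340715) (B
216 (G 0x340716) (B 180 (G 0x451237) (B 172 (G 0x230547) (B 165 (B 177 (G 0x051724) (B 166 (G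
0x250137) (Y 0x01254376))) (B 166 (Y 0x24513076) (B 177 (Y 0x01452376) (B 195 (B 209 (G 0x061427) (B
225 (G 0x061527) (B 198 (G 0x160237) (B 226 (G 0x160527) (B 212 (Y 0x01264735) (B 228 (B 232 (G
0x560723) (B 240 (G 0x560724) L)) (B 232 (B 240 (G 0x560734) (U 0x670243 [:: 0x012754; 0x071426;
0x150243; 0x351246; 0x362574] [::])) (B 240 (Y 0x10432576) L)))))))) (B 198 (B 226 (G 0x160725) (B
212 (G 0x260714) (B 228 (G 0x260715) (B 209 (Y 0x04261735) (B 225 (B 232 (G 0x560317) (B 240 (G
0x560417) L)) (B 232 (B 240 (G 0x560734) L) (B 240 (Y 0x42130576) L))))))) (B 209 (Y 0x10432576) (B
212 (Y 0x24031567) (B 225 (B 226 (Y 0x05163724) (B 228 (G 0x560217) (B 232 (G 0x560317) (B 240 (G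
0x560417) L)))) (B 226 (Y 0x10432576) (B 228 (Y 0x24031567) (B 232 (B 240 (G 0x560734) L) (B 240 (Y
0x10432576) L)))))))))))))))))))) (B 156 (Y 0x23405716) (B 172 (G 0x230547) (B 180 (G 0x240537) (B
184 (G 0x340527) (B 165 (Y 0x01325467) (B 166 (Y 0x01325467) (B 177 (Y 0x24031567) (B 178 (B 210 (G
0x140756) (B 226 (G 0x150746) (B 240 (G 0x450716) (B 195 (B 209 (G 0x061427) (B 225 (G 0x061527) (B
198 (G 0x160247) (B 202 (G 0x160347) (B 212 (B 228 (G 0x260745) (B 216 (G 0x460723) (B 232 L (U
0x351674 [:: 0x014765; 0x041672; 0x150763; 0x240673; 0x342675] [::])))) (B 216 (B 232 (G 0x360745)
(B 228 L L)) (B 228 (B 232 (G 0x560723) (Y 0x01325467)) (B 232 (Y 0x01325467) L)))))))) (B 198 (B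
202 (G 0x160723) (B 212 (G 0x260714) (B 228 (G 0x260715) (B 209 (B 225 (G 0x061745) (B 216 (G
0x460317) (B 232 (Y 0x35021467) L))) (B 216 (B 232 (G 0x360745) (B 225 L L)) (B 225 (B 232 (G
0x560317) (Y 0x35021467)) (B 232 (Y 0x35021467) L))))))) (B 202 (Y 0x01325467) (B 209 (Y 0x10452376)
(B 212 (Y 0x24031567) (B 216 (Y 0x24031567) (B 225 (Y 0x01325467) (B 228 (B 232 (G 0x560723) (Y
0x01325467)) (B 232 (Y 0x01325467) L)))))))))))) (B 195 (B 209 (G 0x061427) (B 225 (G 0x061527) (B
198 (Y 0x01264735) (B 202 (G 0x160327) (B 210 (G 0x160427) (B 226 (G 0x160527) (B 212 (B 228 (G
0x260745) (B 216 (G 0x460723) (B 240 (G 0x460725) (B 232 L (U 0x670354 [:: 0x021354; 0x031725;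
0x051273; 0x071536; 0x240357; 0x472356] [::]))))) (B 216 (B 232 (G 0x360745) (B 240 (G 0x460735) (B
228 L L))) (B 228 (B 232 (G 0x560723) (Y 0x01325467)) (B 232 (Y 0x01325467) (B 240 L L))))))))))) (B
198 (B 202 (G 0x160723) (B 210 (G 0x160724) (B 226 (G 0x160725) (B 212 (G 0x260714) (B 228 (G
0x260715) (B 209 (B 225 (G 0x061745) (B 216 (G 0x460317) (B 240 (G 0x460517) (B 232 (Y 0x35021467)
L)))) (B 216 (B 232 (G 0x360745) (B 240 (G 0x460735) (B 225 L L))) (B 225 (B 232 (G 0x560317) (Y
0x35021467)) (B 232 (Y 0x35021467) (B 240 L L)))))))))) (B 202 (Y 0x01325467) (B 209 (B 210 (Y
0x04162735) (B 212 (G 0x460217) (Y 0x24031567))) (B 210 (B 226 (G 0x160745) (B 212 (G 0x460712) (B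
216 (G 0x460713) (B 240 (G 0x460715) (B 225 (Y 0x01325467) (B 228 (Y 0x24031567) (B 232 (Y
0x35021467) L))))))) (B 212 (Y 0x24031567) (B 216 (Y 0x24031567) (B 225 (Y 0x01325467) (B 226 (Y
0x01325467) (B 228 (B 232 (G 0x560723) (Y 0x01325467)) (B 232 (Y 0x01325467) (B 240 (Y 0x24031567)
L)))))))))))))))))))))))))))))))))))))))))))))) (B 78 (Y 0x10234567) (B 89 (Y 0x01345267) (B 90 (Y
0x01345267) (B 92 (Y 0x23405617) (B 108 (G 0x230546) (B 116 (G 0x240536) (B 120 (G 0x340526) (B 101
(Y 0x01254367) (B 102 (Y 0x01254367) (B 113 (Y 0x01254367) (B 114 (Y 0x01254367) (B 135 (Y
0x01234576) (B 147 (G 0x012734) (B 149 (G 0x021734) (B 150 (G 0x120734) (B 139 (Y 0x01234576) (B 163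
(G 0x012537) (B 169 (G 0x031725) (B 170 (G 0x130725) (B 141 (Y 0x01234576) (B 142 (Y 0x01234576) (B
153 (Y 0x01234576) (B 154 (Y 0x01234576) (B 156 (Y 0x01234576) (B 172 (G 0x230547) (B 180 (G
0x240537) (B 184 (G 0x340527) (B 165 (Y 0x01234576) (B 166 (Y 0x01234576) (B 177 (Y 0x01234576) (B
178 (Y 0x01234576) (B 195 (B 197 (Y 0x01264735) (B 201 (G 0x061327) (B 209 (G 0x061427) (B 225 (G
0x061527) (B 198 (Y 0x01264735) (B 202 (G 0x160327) (B 210 (G 0x160427) (B 226 (G 0x160527) (B 204
(B 212 (G 0x260734) (B 228 (G 0x260735) (B 216 (G 0x360724) (B 232 (G 0x360725) (B 240 L L))))) (B
212 (B 228 (G 0x260745) (B 216 (G 0x460723) (B 240 (G 0x460725) (B 232 L (U 0x670352 [:: 0x013645;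
0x041352; 0x061537; 0x240356; 0x263475] [::]))))) (B 216 (Y 0x01345267) (B 228 (Y 0x01254367) (B 232
(Y 0x01325467) (B 240 (Y 0x01254367) L)))))))))))))) (B 197 (B 201 (G 0x061723) (B 209 (G 0x061724)
(B 225 (G 0x061725) (B 198 (Y 0x02164735) (B 204 (G 0x260317) (B 212 (G 0x260417) (B 228 (G
0x260517) (B 202 (B 210 (G 0x160734) (B 226 (G 0x160735) (B 216 (G 0x360714) (B 232 (G 0x360715) (B
240 L L))))) (B 210 (B 226 (G 0x160745) (B 216 (G 0x460713) (B 240 (G 0x460715) (B 232 (Y
0x35021467) L)))) (B 216 (Y 0x24031567) (B 226 (Y 0x01254367) (B 232 (Y 0x35021467) (B 240 (Y
0x01254367) L))))))))))))) (B 198 (Y 0x10234567) (B 201 (Y 0x01325467) (B 202 (Y 0x01325467) (B 204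
(B 212 (G 0x260734) (Y 0x24305167)) (B 209 (Y 0x01345267) (B 210 (Y 0x01345267) (B 212 (Y
0x24031567) (B 216 (Y 0x01345267) (B 225 (Y 0x01254367) (B 226 (Y 0x01254367) (B 228 (Y 0x01254367)
(B 232 (Y 0x01325467) (B 240 (Y 0x01254367) L)))))))))))))))))))))))))))))))))))))))))))))))))))))))
(B 71 (Y 0x01234657) (B 83 (G 0x012634) (B 85 (G 0x021634) (B 86 (G 0x120634) (B 75 (Y 0x01325467)
(B 99 (G 0x012536) (B 105 (G 0x031625) (B 106 (G 0x130625) (B 77 (B 101 (G 0x021635) (B 89 (G
0x031624) (B 78 (Y 0x02134657) (B 92 (G 0x230416) (B 108 (G 0x230516) (B 90 (Y 0x02134657) (B 102 (Y
0x01325467) (B 113 (B 114 (Y 0x01452367) (B 116 (G 0x450216) (B 120 (G 0x450316) (B 135 (Y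
0x01234576) (B 147 (G 0x012734) (B 149 (G 0x021734) (B 150 (G 0x120734) (B 139 (Y 0x01234576) (B 163
(G 0x012537) (B 169 (G 0x031725) (B 170 (G 0x130725) (B 141 (Y 0x02134657) (B 197 (G 0x021637) (B
201 (G 0x031627) (B 204 (G 0x230716) (B 142 (B 166 (G 0x120735) (B 198 (G 0x120736) (B 154 (G
0x130724) (B 202 (G 0x130726) (B 156 (G 0x230714) (B 172 (G 0x230715) (B 153 (Y 0x01432576) (B 165
(Y 0x01325467) (B 177 (Y 0x01452367) (B 209 (G 0x041657) (B 225 (G 0x051647) (B 240 (G 0x450716) (B
178 (B 210 (G 0x140756) (B 226 (G 0x150746) (B 180 (G 0x450712) (B 184 (G 0x450713) (B 195 (Y
0x02134657) (B 212 (B 228 (G 0x260745) (B 216 (G 0x460723) (B 232 L (U 0x571362 [:: 0x012354;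
0x012537; 0x023476; 0x041352; 0x150746; 0x260475; 0x370215; 0x450126] [::])))) (B 216 (B 232 (G
0x360745) (B 228 L L)) (B 228 (B 232 (G 0x560723) (Y 0x01325467)) (B 232 (Y 0x01325467) L)))))))))
(B 180 (B 212 (G 0x240756) (B 228 (G 0x250746) (B 184 (G 0x450723) (B 195 (B 210 (G 0x160427) (Y
0x01264735)) (B 210 (B 226 (G 0x160745) (B 216 (G 0x460713) (B 232 (Y 0x03125647) L))) (B 216 (B 232
(G 0x360745) (B 226 L L)) (B 226 (B 232 (G 0x560713) (Y 0x03125647)) (B 232 (Y 0x03125647) L))))))))
(B 184 (Y 0x01325467) (B 195 (Y 0x02134657) (B 210 (B 212 (G 0x460712) (Y 0x02134657)) (B 212 (Y
0x02134657) (B 216 (Y 0x02134657) (B 226 (Y 0x01325467) (B 228 (B 232 (G 0x560723) (Y 0x01325467))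
(B 232 (Y 0x01325467) L)))))))))))))))))))))) (B 153 (B 177 (G 0x041735) (B 209 (G 0x041736) (B 225
(G 0x051647) (B 240 (G 0x450716) (B 154 (Y 0x01345276) (B 156 (G 0x340217) (B 184 (G 0x340517) (B
216 (G 0x340617) (B 165 (B 166 (Y 0x01254376) (B 172 (G 0x250317) (B 180 (G 0x250417) (B 228 (G
0x250617) (B 178 (Y 0x01254376) (B 195 (B 198 (Y 0x01264735) (B 202 (G 0x160327) (B 210 (G 0x160427)
(B 226 (G 0x160527) (B 212 (Y 0x01264735) (B 232 (Y 0x01325467) (U 0x061257 [:: 0x012374; 0x013475;
0x021637; 0x051467; 0x071342; 0x071254] [::]))))))) (B 198 (B 202 (G 0x160723) (B 210 (G 0x160724)
(B 226 (G 0x160725) (B 212 (G 0x260714) (B 232 (Y 0x02356714) L))))) (B 202 (Y 0x01325467) (B 210 (Y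
0x01345276) (B 212 (Y 0x02346175) (B 226 (Y 0x01254376) (B 232 (Y 0x01325467) L)))))))))))) (B 166
(B 198 (G 0x120756) (B 178 (G 0x150724) (B 226 (G 0x150726) (B 172 (G 0x250713) (B 180 (G 0x250714)
(B 228 (G 0x250716) (B 195 (Y 0x02134657) (B 202 (B 210 (G 0x160734) (B 232 (G 0x360715) (B 212 (Y
0x02346175) L))) (B 210 (Y 0x01543267) (B 212 (Y 0x02346175) (B 232 (Y 0x01543267) L))))))))))) (B
172 (B 180 (G 0x250734) (B 228 (G 0x250736) (B 232 (G 0x350726) (B 178 (Y 0x01345276) (B 195 (Y
0x02134657) (B 198 (Y 0x02134657) (B 202 (B 210 (G 0x160734) (B 226 (G 0x160735) (B 212 (Y
0x02134657) L))) (B 210 (B 226 (G 0x160745) (B 212 (G 0x460712) L)) (B 212 (Y 0x02346175) (B 226 (Y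
0x05143627) L)))))))))) (B 178 (Y 0x01345276) (B 180 (Y 0x01543267) (B 195 (Y 0x02134657) (B 198 (Y
0x02134657) (B 202 (Y 0x02134657) (B 210 (B 226 (G 0x160745) (Y 0x01543267)) (B 212 (Y 0x02134657)
(B 226 (Y 0x01543267) (B 228 (Y 0x02134657) (B 232 (Y 0x01543267) L))))))))))))))))))))) (B 154 (B
202 (G 0x130746) (B 178 (G 0x140735) (B 210 (G 0x140736) (B 156 (G 0x340712) (B 184 (G 0x340715) (B
216 (G 0x340716) (B 165 (Y 0x01325467) (B 166 (B 198 (G 0x120756) (B 226 (G 0x150726) (B 172 (G
0x250713) (B 180 (G 0x250714) (B 228 (G 0x250716) (B 177 (Y 0x01452367) (B 209 (G 0x041657) (B 225
(G 0x051647) (B 240 (G 0x450716) (B 195 (Y 0x02316457) (B 212 (Y 0x02461357) (B 232 (Y 0x01325467)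
L)))))))))))) (B 172 (B 180 (G 0x250734) (B 228 (G 0x250736) (B 232 (G 0x350726) (B 177 (Y
0x01452367) (B 209 (G 0x041657) (B 225 (G 0x051647) (B 240 (G 0x450716) (B 195 (Y 0x02316457) (B 198
(B 226 (G 0x160725) (B 212 (G 0x260714) L)) (B 212 (Y 0x02461357) (B 226 L L))))))))))) (B 177 (Y
0x01452367) (B 209 (G 0x041657) (B 225 (G 0x051647) (B 240 (G 0x450716) (B 180 (Y 0x01543267) (B 195
(Y 0x02316457) (B 198 (Y 0x02316457) (B 212 (Y 0x02461357) (B 226 (Y 0x01543267) (B 228 (B 232 (G
0x560723) L) (B 232 (Y 0x01543267) L)))))))))))))))))))) (B 156 (Y 0x02134657) (B 165 (Y 0x01325467)
(B 166 (Y 0x01325467) (B 172 (Y 0x01325467) (B 177 (Y 0x01452367) (B 209 (G 0x041657) (B 225 (G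
0x051647) (B 240 (G 0x450716) (B 178 (Y 0x01452367) (B 180 (Y 0x01452367) (B 184 (Y 0x01325467) (B
195 (Y 0x02134657) (B 198 (Y 0x02134657) (B 202 (Y 0x01325467) (B 210 (Y 0x01452367) (B 212 (Y
0x02134657) (B 216 (Y 0x02134657) (B 226 (Y 0x01325467) (B 228 (B 232 (G 0x560723) (Y 0x01325467))
(B 232 (Y 0x01325467) L)))))))))))))))))))))))))))))))))))))) (B 114 (B 116 (G 0x450612) (B 120 (G
0x450613) (B 135 (Y 0x01234576) (B 147 (G 0x012734) (B 149 (G 0x021734) (B 150 (G 0x120734) (B 139
(Y 0x01234576) (B 163 (G 0x012537) (B 169 (G 0x031725) (B 170 (G 0x130725) (B 141 (Y 0x02134675) (B
197 (G 0x021637) (B 201 (G 0x031627) (B 204 (G 0x230716) (B 142 (B 166 (G 0x120735) (B 198 (G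
0x120736) (B 154 (G 0x130724) (B 202 (G 0x130726) (B 156 (G 0x230714) (B 172 (G 0x230715) (B 153 (Y
0x01432576) (B 165 (Y 0x01325467) (B 177 (B 209 (G 0x041756) (B 225 (G 0x051746) (B 178 (Y
0x01452376) (B 210 (G 0x140657) (B 226 (G 0x150647) (B 180 (G 0x450217) (B 184 (G 0x450317) (B 240
(G 0x450617) (B 195 (Y 0x02613475) (B 212 (Y 0x20134675) (B 216 (B 232 (G 0x360745) (B 228 L (U
0x571264 [:: 0x021734; 0x031264; 0x130675; 0x170326; 0x172563; 0x340765; 0x470235; 0x561374] [::])))
(B 228 (B 232 (G 0x560723) (Y 0x01325467)) (B 232 (Y 0x01325467) L))))))))))))) (B 178 (Y
0x10234576) (B 210 (G 0x140657) (B 226 (G 0x150647) (B 240 (G 0x450617) (B 180 (B 212 (G 0x240756)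
(B 228 (G 0x250746) (B 184 (G 0x450723) (B 195 (B 209 (G 0x061427) (Y 0x01264735)) (B 209 (B 225 (G
0x061745) (Y 0x40162753)) (B 216 (B 232 (G 0x360745) (B 225 L L)) (B 225 (B 232 (G 0x560317) (Y
0x30125674)) (B 232 (Y 0x30125674) L)))))))) (B 184 (Y 0x01325467) (B 195 (Y 0x02613475) (B 209 (B
212 (G 0x460217) (B 216 (G 0x460317) (Y 0x20134675))) (B 212 (Y 0x20134675) (B 216 (B 232 (G
0x360745) (B 225 (Y 0x01325467) (B 228 (Y 0x23016745) L))) (B 225 (Y 0x01325467) (B 228 (B 232 (G
0x560723) (Y 0x01325467)) (B 232 (Y 0x01325467) L)))))))))))))))))))))) (B 153 (B 177 (G 0x041735)
(B 209 (G 0x041736) (B 154 (Y 0x01345276) (B 156 (G 0x340217) (B 184 (G 0x340517) (B 216 (G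
0x340617) (B 165 (B 166 (Y 0x01254376) (B 172 (G 0x250317) (B 180 (G 0x250417) (B 178 (Y 0x01254376)
(Y 0x01254376))))) (B 166 (B 198 (G 0x120756) (B 178 (G 0x150724) (B 226 (G 0x150726) (B 172 (G
0x250713) (B 180 (G 0x250714) (B 228 (G 0x250716) (B 210 (G 0x162457) (B 240 (G 0x450617) (B 195 (B
202 (G 0x160327) (B 212 (Y 0x01264735) (Y 0x01264735))) (B 202 (B 232 (G 0x360715) (B 212 (Y
0x02346175) (B 225 (Y 0x03561274) L))) (B 212 (Y 0x02346175) (B 225 (Y 0x10254376) (B 232 L
L))))))))))))) (B 172 (B 180 (G 0x250734) (B 228 (G 0x250736) (B 232 (G 0x350726) (B 178 (Y
0x01345276) (B 210 (G 0x140657) (B 226 (G 0x150647) (B 240 (G 0x450617) (B 195 (B 198 (G 0x160247)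
(B 202 (G 0x160347) (B 212 (Y 0x01264735) (Y 0x01264735)))) (B 198 (B 202 (G 0x160723) (B 212 (G
0x260714) (B 225 (Y 0x03561274) L))) (B 202 (B 225 (Y 0x03561274) (Y 0x30165274)) (B 212 (Y
0x02346175) (B 225 (Y 0x03561274) L)))))))))))) (B 178 (Y 0x01345276) (B 210 (G 0x140657) (B 226 (G
0x150647) (B 240 (G 0x450617) (B 180 (B 212 (G 0x240756) (B 228 (G 0x250746) (B 195 (B 198 (G
0x160247) (B 202 (G 0x160347) (Y 0x01264735))) (B 198 (Y 0x12460753) (B 202 (Y 0x04132756) (B 225 (B
232 (G 0x560317) L) (B 232 L L))))))) (B 195 (B 198 (G 0x160247) (B 202 (G 0x160347) (B 212 (Y
0x01264735) (Y 0x01264735)))) (B 198 (B 202 (G 0x160723) (B 212 (G 0x260714) (Y 0x02431675))) (B 202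
(B 232 (G 0x360715) (B 212 (Y 0x02346175) (B 225 (Y 0x03561274) (B 228 (Y 0x31706542) L)))) (B 212
(Y 0x02346175) (B 225 (B 228 (G 0x560217) (B 232 (G 0x560317) L)) (B 228 (B 232 (G 0x560723) L) (B
232 L L))))))))))))))))))))) (B 154 (B 178 (G 0x140735) (B 165 (Y 0x01325467) (B 166 (B 172 (G
0x250713) (B 180 (G 0x250714) (B 177 (Y 0x01452376) (Y 0x10254376)))) (B 177 (B 180 (G 0x450217) (Y
0x01452376)) (Y 0x10543267))))) (B 156 (B 172 (G 0x230745) (B 180 (G 0x240735) (B 212 (G 0x240736)
(B 184 (G 0x340725) (B 216 (G 0x340726) (B 165 (Y 0x01325467) (B 166 (Y 0x01325467) (B 177 (B 178 (G
0x450127) (Y 0x04152736)) (B 178 (Y 0x10452367) (B 210 (G 0x140657) (B 226 (G 0x150647) (B 240 (G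
0x450617) (B 195 (B 209 (G 0x061427) (B 198 (G 0x160247) (B 202 (G 0x160347) (Y 0x02164375)))) (B
198 (B 202 (G 0x160723) (B 209 (Y 0x02461375) (Y 0x20164375))) (B 202 (B 232 (G 0x360715) (B 209 (Y
0x02461375) (B 225 (Y 0x03561274) (B 228 (Y 0x32670415) L)))) (B 209 (Y 0x02461375) (B 225 (B 228 (G
0x560217) (B 232 (G 0x560317) L)) (B 228 (B 232 (G 0x560723) L) (B 232 L L))))))))))))))))))) (B 165
(Y 0x01325467) (B 166 (Y 0x01325467) (B 172 (Y 0x01325467) (B 177 (B 178 (Y 0x01452376) (Y
0x10452367)) (B 178 (Y 0x10452367) (B 210 (G 0x140657) (B 226 (G 0x150647) (B 240 (G 0x450617) (B
180 (Y 0x10452367) (B 184 (Y 0x01325467) (B 195 (B 209 (G 0x061427) (B 225 (G 0x061527) (B 198 (G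
0x160247) (B 202 (G 0x160347) (B 212 (Y 0x01264735) (B 216 (Y 0x06213745) (B 228 (B 232 (G 0x560723)
(Y 0x01325467)) (B 232 (Y 0x01325467) L)))))))) (B 198 (B 202 (G 0x160723) (B 212 (G 0x260714) (B
228 (G 0x260715) (B 209 (Y 0x02461375) (B 216 (Y 0x26013745) (B 225 (B 232 (G 0x560317) L) (B 232 L
L))))))) (B 202 (Y 0x01325467) (B 209 (Y 0x10452367) (B 212 (B 228 (G 0x260745) (B 216 (G 0x460723)
(B 225 (Y 0x01325467) (B 232 L L)))) (B 216 (B 232 (G 0x360745) (B 225 (Y 0x01325467) (B 228 L L)))
(B 225 (Y 0x01325467) (B 228 (B 232 (G 0x560723) (Y 0x01325467)) (B 232 (Y 0x01325467)
L))))))))))))))))))))))))))))))))))))) (B 116 (Y 0x02134657) (B 120 (Y 0x01325467) (B 135 (Y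
0x01234576) (B 147 (G 0x012734) (B 149 (G 0x021734) (B 150 (G 0x120734) (B 139 (Y 0x01234576) (B 163
(G 0x012537) (B 169 (G 0x031725) (B 170 (G 0x130725) (B 141 (Y 0x02134657) (B 197 (G 0x021637) (B
201 (G 0x031627) (B 204 (G 0x230716) (B 142 (B 166 (G 0x120735) (B 198 (G 0x120736) (B 154 (G
0x130724) (B 202 (G 0x130726) (B 156 (G 0x230714) (B 172 (G 0x230715) (B 153 (Y 0x01432576) (B 165
(Y 0x01325467) (B 177 (B 178 (Y 0x01452376) (B 180 (G 0x450217) (B 184 (G 0x450317) (Y
0x01452376)))) (B 178 (Y 0x10234576) (B 180 (Y 0x10234576) (B 184 (Y 0x01325467) (B 195 (Y
0x02134657) (B 209 (Y 0x02134657) (B 210 (B 212 (G 0x460712) (Y 0x02134657)) (B 212 (Y 0x02134657)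
(B 216 (Y 0x02134657) (B 225 (Y 0x01325467) (B 226 (Y 0x01325467) (B 228 (B 232 (G 0x560723) (Y
0x01325467)) (B 232 (Y 0x01325467) (B 240 L L)))))))))))))))))))))) (B 153 (B 177 (G 0x041735) (B
209 (G 0x041736) (B 154 (Y 0x01345276) (B 156 (G 0x340217) (B 184 (G 0x340517) (B 216 (G 0x340617)
(B 165 (B 166 (Y 0x01254376) (B 172 (G 0x250317) (B 180 (G 0x250417) (B 178 (Y 0x01254376) (Y
0x01254376))))) (B 166 (B 178 (G 0x150724) (Y 0x01345276)) (B 172 (B 178 (Y 0x01345276) (Y
0x01345276)) (B 178 (Y 0x01345276) (B 180 (Y 0x01345276) (B 195 (Y 0x02134657) (B 198 (Y 0x02134657)
(B 202 (Y 0x02134657) (B 210 (Y 0x01432576) (B 212 (Y 0x02134657) (B 225 (B 226 (B 232 (Y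
0x03561274) (G 0x560137)) (B 228 (G 0x560217) (B 232 (G 0x560317) (B 240 (G 0x560417) L)))) (B 226
(B 228 (G 0x560712) (B 232 (G 0x560713) (B 240 (G 0x560714) L))) (B 228 (Y 0x02134657) (B 232 (B 240
(G 0x560734) L) (B 240 (Y 0x01432576) L))))))))))))))))))))) (B 154 (B 202 (G 0x130746) (B 178 (G
0x140735) (B 210 (G 0x140736) (B 156 (G 0x340712) (B 184 (G 0x340715) (B 216 (G 0x340716) (B 165 (Y
0x01325467) (B 166 (B 172 (G 0x250713) (B 180 (G 0x250714) (B 177 (Y 0x01452376) (Y 0x10254376))))
(B 172 (B 180 (G 0x250734) (B 177 (Y 0x01452376) (Y 0x10345276))) (B 177 (B 180 (G 0x450217) (Y
0x01452376)) (B 180 (Y 0x10345276) (B 195 (Y 0x02316457) (B 198 (Y 0x02316457) (B 209 (B 212 (G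
0x460217) (Y 0x02461375)) (B 212 (Y 0x20461375) (B 225 (B 226 (B 232 (Y 0x03561274) (G 0x560137)) (B
228 (G 0x560217) (B 232 (G 0x560317) (B 240 (G 0x560417) L)))) (B 226 (Y 0x10432576) (B 228 (B 232
(G 0x560723) (B 240 (G 0x560724) L)) (B 232 (B 240 (G 0x560734) L) (B 240 (Y 0x10432576)
L)))))))))))))))))))) (B 156 (Y 0x02134657) (B 165 (Y 0x01325467) (B 166 (Y 0x01325467) (B 172 (Y
0x01325467) (B 177 (B 209 (G 0x041756) (B 225 (G 0x051746) (B 178 (Y 0x01452376) (B 180 (G 0x450217)
(B 184 (G 0x450317) (B 240 (G 0x450617) (B 195 (Y 0x02134657) (B 198 (Y 0x02134657) (B 202 (Y
0x01325467) (B 210 (Y 0x01452376) (B 212 (B 216 (G 0x460723) (Y 0x24061735)) (B 216 (B 232 (G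
0x360745) (B 226 (Y 0x01325467) (B 228 (Y 0x62370541) L))) (B 226 (Y 0x01325467) (B 228 (B 232 (G
0x560723) (Y 0x01325467)) (B 232 (Y 0x01325467) L))))))))))))))) (B 178 (B 210 (G 0x140756) (B 226
(G 0x150746) (B 180 (G 0x450712) (B 184 (G 0x450713) (B 240 (G 0x450716) (B 195 (Y 0x02134657) (B
198 (Y 0x02134657) (B 202 (Y 0x01325467) (B 209 (Y 0x02134657) (B 212 (B 228 (G 0x260745) (B 216 (G
0x460723) (B 225 (Y 0x01325467) (B 232 L L)))) (B 216 (B 232 (G 0x360745) (B 225 (Y 0x01325467) (B
228 L L))) (B 225 (Y 0x01325467) (B 228 (B 232 (G 0x560723) (Y 0x01325467)) (B 232 (Y 0x01325467)
L)))))))))))))) (B 180 (B 212 (G 0x240756) (B 228 (G 0x250746) (B 184 (G 0x450723) (B 240 (G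
0x450726) (B 195 (Y 0x02134657) (B 198 (Y 0x02134657) (B 202 (Y 0x02134657) (B 209 (Y 0x02134657) (B
210 (B 226 (G 0x160745) (B 216 (G 0x460713) (B 225 (Y 0x03125647) (B 232 (Y 0x03125647) L)))) (B 216
(B 232 (G 0x360745) (B 225 (Y 0x02316457) (B 226 L L))) (B 225 (Y 0x03125647) (B 226 (B 232 (G
0x560713) (Y 0x03125647)) (B 232 (Y 0x03125647) L))))))))))))) (B 184 (Y 0x01325467) (B 195 (Y
0x02134657) (B 198 (Y 0x02134657) (B 202 (Y 0x01325467) (B 209 (Y 0x02134657) (B 210 (B 212 (G
0x460712) (Y 0x02134657)) (B 212 (Y 0x02134657) (B 216 (Y 0x02134657) (B 225 (Y 0x01325467) (B 226
(Y 0x01325467) (B 228 (B 232 (G 0x560723) (Y 0x01325467)) (B 232 (Y 0x01325467) (B 240 L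
L)))))))))))))))))))))))))))))))))))))))))))))) (B 78 (Y 0x10234567) (B 89 (Y 0x01345267) (B 90 (Y
0x01345267) (B 92 (B 108 (G 0x230645) (B 116 (G 0x240635) (B 120 (G 0x340625) (B 101 (Y 0x01254367)
(B 102 (Y 0x01254367) (B 113 (Y 0x01254367) (B 114 (Y 0x01254367) (B 135 (Y 0x01234576) (B 147 (G
0x012734) (B 149 (G 0x021734) (B 150 (G 0x120734) (B 139 (Y 0x01234576) (B 163 (G 0x012537) (B 169
(G 0x031725) (B 170 (G 0x130725) (B 141 (Y 0x01234576) (B 142 (Y 0x01234576) (B 153 (Y 0x01234576)
(B 154 (Y 0x01234576) (B 156 (Y 0x23406715) (B 204 (G 0x230647) (B 212 (G 0x240637) (B 216 (G
0x340627) (B 165 (Y 0x01254376) (B 166 (Y 0x01254376) (B 172 (B 180 (G 0x250734) (B 228 (G 0x250736)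
(B 184 (G 0x350724) (B 232 (G 0x350726) (B 177 (Y 0x01254376) (B 178 (Y 0x01254376) (B 195 (B 197 (Y
0x01264735) (B 201 (G 0x061327) (B 209 (G 0x061427) (B 225 (G 0x061527) (B 198 (Y 0x01264735) (B 202
(G 0x160327) (B 210 (G 0x160427) (B 226 (G 0x160527) (B 240 (Y 0x23456701) L))))))))) (B 197 (Y
0x24031657) (B 198 (Y 0x10234567) (B 201 (Y 0x01325476) (B 202 (Y 0x01325476) (B 209 (B 210 (G
0x460127) (Y 0x04162735)) (B 210 (Y 0x10234567) (B 225 (Y 0x01325476) (B 226 (Y 0x01325476) (B 240
(Y 0x23456701) L)))))))))))))))) (B 177 (Y 0x01254376) (B 178 (Y 0x01254376) (B 180 (B 228 (G
0x250746) (B 184 (G 0x450723) (B 240 (G 0x450726) (B 195 (B 197 (Y 0x01264735) (B 201 (G 0x061327)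
(B 209 (G 0x061427) (B 225 (G 0x061527) (B 198 (Y 0x01264735) (B 202 (G 0x160327) (B 210 (G
0x160427) (B 226 (G 0x160527) (B 232 (Y 0x01365724) L))))))))) (B 197 (Y 0x24031657) (B 198 (Y
0x10234567) (B 201 (B 209 (G 0x061734) (Y 0x24031657)) (B 202 (Y 0x10234567) (B 209 (Y 0x01432567)
(B 210 (Y 0x01432567) (B 225 (Y 0x01254376) (B 226 (Y 0x01254376) (B 232 (Y 0x24356701)
L))))))))))))) (B 184 (Y 0x01345276) (B 195 (B 197 (Y 0x01264735) (B 201 (G 0x061327) (B 209 (G
0x061427) (B 198 (Y 0x01264735) (B 210 (G 0x160427) (Y 0x24031657)))))) (B 197 (Y 0x24031657) (B 198
(Y 0x10234567) (B 201 (B 209 (G 0x061734) (Y 0x24031657)) (B 202 (Y 0x10234567) (B 209 (Y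
0x01432567) (B 210 (Y 0x01432567) (B 225 (B 226 (Y 0x05163724) (B 228 (G 0x560217) (B 232 (G
0x560317) (B 240 (G 0x560417) L)))) (B 226 (Y 0x10234567) (B 228 (Y 0x24031657) (B 232 (B 240 (G
0x560734) L) (B 240 (Y 0x01432567) L)))))))))))))))))))))))))))))))))))))))))) (B 101 (Y 0x01254367)
(B 102 (Y 0x01254367) (B 108 (Y 0x01325467) (B 113 (Y 0x01254367) (B 114 (Y 0x01254367) (B 116 (Y
0x01254367) (B 120 (Y 0x01325467) (B 135 (Y 0x01234576) (B 147 (G 0x012734) (B 149 (G 0x021734) (B
150 (G 0x120734) (B 139 (Y 0x01234576) (B 163 (G 0x012537) (B 169 (G 0x031725) (B 170 (G 0x130725)
(B 141 (Y 0x01234576) (B 142 (Y 0x01234576) (B 153 (Y 0x01234576) (B 154 (Y 0x01234576) (B 156 (Y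
0x01234576) (B 165 (Y 0x01234576) (B 166 (Y 0x01234576) (B 172 (Y 0x01234576) (B 177 (Y 0x01234576)
(B 178 (Y 0x01234576) (B 180 (Y 0x01234576) (B 184 (Y 0x01234576) (B 195 (B 197 (Y 0x01264735) (B
201 (G 0x061327) (B 209 (G 0x061427) (B 225 (G 0x061527) (B 198 (Y 0x01264735) (B 202 (G 0x160327)
(B 210 (G 0x160427) (B 226 (G 0x160527) (B 204 (B 212 (G 0x260734) (Y 0x01264735)) (B 212 (Y
0x01264735) (B 216 (Y 0x01264735) (B 228 (Y 0x01254367) (B 232 (Y 0x01325467) (B 240 (Y 0x01254367)
L)))))))))))))) (B 197 (B 201 (G 0x061723) (B 209 (G 0x061724) (B 225 (G 0x061725) (B 198 (Y
0x02164735) (B 204 (G 0x260317) (B 212 (G 0x260417) (B 228 (G 0x260517) (B 202 (B 210 (G 0x160734)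
(Y 0x02164735)) (B 210 (Y 0x02164735) (B 216 (Y 0x02164735) (B 226 (Y 0x01254367) (B 232 (Y
0x35061724) (B 240 (Y 0x01254367) L))))))))))))) (B 198 (Y 0x10234567) (B 201 (Y 0x01325467) (B 202
(Y 0x01325467) (B 204 (B 212 (G 0x260734) (B 228 (G 0x260735) (B 216 (G 0x360724) (B 232 (G
0x360725) (B 209 (Y 0x01345267) (B 210 (Y 0x01345267) (B 225 (Y 0x01254367) (B 226 (Y 0x01254367) (B
240 L L))))))))) (B 209 (Y 0x01345267) (B 210 (Y 0x01345267) (B 212 (B 228 (G 0x260745) (B 216 (G
0x460723) (B 240 (G 0x460725) (B 225 (Y 0x01254367) (B 226 (Y 0x01254367) (B 232 L L)))))) (B 216 (Y
0x01345267) (B 225 (Y 0x01254367) (B 226 (Y 0x01254367) (B 228 (Y 0x01254367) (B 232 (Y 0x01325467)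
(B 240 (Y 0x01254367) L)))))))))))))))))))))))))))))))))))))))))))))))))))))))))))) (B 45 (Y
0x02134567) (B 46 (Y 0x10234567) (B 57 (Y 0x01432567) (B 58 (Y 0x01432567) (B 60 (Y 0x02134567) (B
71 (Y 0x01234657) (B 83 (G 0x012634) (B 85 (G 0x021634) (B 86 (G 0x120634) (B 75 (Y 0x01234657) (B
77 (Y 0x01234657) (B 78 (Y 0x01234657) (B 89 (Y 0x01234657) (B 90 (Y 0x01234657) (B 92 (Y
0x01234657) (B 99 (Y 0x01254367) (B 101 (Y 0x01254367) (B 102 (Y 0x01254367) (B 105 (B 113 (G
0x051634) (B 106 (Y 0x03516247) (B 108 (G 0x350216) (B 120 (G 0x350416) (B 114 (Y 0x01254367) (B 116
(Y 0x01254367) (B 135 (Y 0x01234576) (B 147 (G 0x012734) (B 149 (G 0x021734) (B 150 (G 0x120734) (B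
139 (Y 0x01234576) (B 141 (Y 0x01234576) (B 142 (Y 0x01234576) (B 153 (Y 0x01234576) (B 154 (Y
0x01234576) (B 156 (Y 0x01234576) (B 163 (Y 0x01234576) (B 165 (Y 0x01234576) (B 166 (Y 0x01234576)
(B 169 (Y 0x03516247) (B 201 (G 0x031657) (B 225 (G 0x051637) (B 232 (G 0x350716) (B 170 (Y
0x03516247) (B 172 (Y 0x02134567) (B 177 (Y 0x01254367) (B 178 (Y 0x01254367) (B 180 (Y 0x01254367)
(B 184 (Y 0x01432567) (B 195 (Y 0x01234657) (B 197 (Y 0x01234657) (B 198 (Y 0x01234657) (B 202 (Y
0x01234657) (B 204 (Y 0x01234657) (B 209 (Y 0x01234657) (B 210 (Y 0x01234657) (B 212 (Y 0x01234657)
(B 216 (Y 0x01234657) (B 226 (Y 0x01254367) (B 228 (Y 0x01254367) (B 240 (Y 0x01254367)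
L))))))))))))))))))))))))))))))))))))))))) (B 106 (Y 0x10234567) (B 108 (Y 0x02134567) (B 113 (Y
0x01254367) (B 114 (Y 0x01254367) (B 116 (Y 0x01254367) (B 120 (Y 0x01432567) (B 135 (Y 0x01234576)
(B 147 (G 0x012734) (B 149 (G 0x021734) (B 150 (G 0x120734) (B 139 (Y 0x01234576) (B 141 (Y
0x01234576) (B 142 (Y 0x01234576) (B 153 (Y 0x01234576) (B 154 (Y 0x01234576) (B 156 (Y 0x01234576)
(B 163 (Y 0x01234576) (B 165 (Y 0x01234576) (B 166 (Y 0x01234576) (B 169 (Y 0x01234576) (B 170 (Y
0x01234576) (B 172 (Y 0x01234576) (B 177 (Y 0x01234576) (B 178 (Y 0x01234576) (B 180 (Y 0x01234576)
(B 184 (Y 0x01234576) (B 195 (Y 0x01234657) (B 197 (Y 0x01234657) (B 198 (Y 0x01234657) (B 201 (Y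
0x01234657) (B 202 (Y 0x01234657) (B 204 (Y 0x01234657) (B 209 (Y 0x01234657) (B 210 (Y 0x01234657)
(B 212 (Y 0x01234657) (B 216 (Y 0x01234657) (B 225 (Y 0x01254367) (B 226 (Y 0x01254367) (B 228 (Y
0x01254367) (B 232 (B 240 (G 0x560734) L) (B 240 (Y 0x01254367)
L)))))))))))))))))))))))))))))))))))))))))))))))))))))))))))))))))))) (B 27 (Y 0x01324567) (B 29 (Y
0x02134567) (B 30 (Y 0x10234567) (B 39 (Y 0x01235467) (B 43 (Y 0x01235467) (B 45 (Y 0x01235467) (B
46 (Y 0x01235467) (B 51 (Y 0x01243567) (B 53 (Y 0x01243567) (B 54 (Y 0x01243567) (B 57 (Y
0x01324567) (B 58 (Y 0x01324567) (B 60 (Y 0x02134567) (B 71 (Y 0x01234657) (B 75 (Y 0x01234657) (B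
77 (Y 0x01234657) (B 78 (Y 0x01234657) (B 83 (Y 0x01234657) (B 85 (Y 0x01234657) (B 86 (Y
0x01234657) (B 89 (Y 0x01234657) (B 90 (Y 0x01234657) (B 92 (Y 0x01234657) (B 99 (Y 0x01235467) (B
101 (Y 0x01235467) (B 102 (Y 0x01235467) (B 105 (Y 0x01235467) (B 106 (Y 0x01235467) (B 108 (Y
0x01235467) (B 113 (Y 0x01243567) (B 114 (Y 0x01243567) (B 116 (Y 0x01243567) (B 120 (Y 0x01324567)
(B 135 (Y 0x01234576) (B 139 (Y 0x01234576) (B 141 (Y 0x01234576) (B 142 (Y 0x01234576) (B 147 (Y
0x01234576) (B 149 (Y 0x01234576) (B 150 (Y 0x01234576) (B 153 (Y 0x01234576) (B 154 (Y 0x01234576)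
(B 156 (Y 0x01234576) (B 163 (Y 0x01234576) (B 165 (Y 0x01234576) (B 166 (Y 0x01234576) (B 169 (Y
0x01234576) (B 170 (Y 0x01234576) (B 172 (Y 0x01234576) (B 177 (Y 0x01234576) (B 178 (Y 0x01234576)
(B 180 (Y 0x01234576) (B 184 (Y 0x01234576) (B 195 (Y 0x01234657) (B 197 (Y 0x01234657) (B 198 (Y
0x01234657) (B 201 (Y 0x01234657) (B 202 (Y 0x01234657) (B 204 (Y 0x01234657) (B 209 (Y 0x01234657)
(B 210 (Y 0x01234657) (B 212 (Y 0x01234657) (B 216 (Y 0x01234657) (B 225 (Y 0x01235467) (B 226 (Y
0x01235467) (B 228 (Y 0x01235467) (B 232 (Y 0x01235467) (B 240 (Y 0x01243567)
L)))))))))))))))))))))))))))))))))))))))))))))))))))))))))))))))))))))%num.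

(** The entries follow the leaves of the certificate from left to right, each realizing the word at
    its leaf. The first four planes, a basis in canonical orderings, are the coordinate planes. *)
Definition configurations : seq configuration := [::
q 0x9988989898898977; q 0x998898989889897a; q 0x9988989898898996; q 0x9988989898898999; q
0x9988989898899777; q 0x9988989889898899; q 0x9988989889898897; q 0x9988989889899877; q
0x9988989889899879; q 0x9988989889899977; q 0x998898988989997a; q 0x9988989889899779; q
0x9988989897899879; q 0x99889898978998a9; q 0x9988989897899877; q 0x998898989a898979; q
0x9988989897898a67; q 0x998898989789897a; q 0x9988989897898aa7; q 0x9988989897898a77; q
0x9988989897898a79; q 0x9988989897898999; q 0x99889898978a8969; q 0x99889898978989a9; q
0x9988989897899777; q 0x998898989789a777; q 0x9988989889798977; q 0x998898988979899a; q
0x998898988979999a; q 0x998898988979997a; q 0x9988989889799977; q 0x99889898897999a7; q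
0x9988989889799967; q 0x9988989889799a67; q 0x9988989889799769; q 0x9988989889998997; q
0x99889898899989a7; q 0x998898988a99aa97; q 0x9988989889a999a7; q 0x9988989889999976; q
0x99889898899999a7; q 0x998898988999997a; q 0x998898988999a99a; q 0x99889898899a97a9; q
0x9988989889999779; q 0x9988989889999769; q 0x9988989889999a67; q 0x9988989897799777; q
0x998898989779a777; q 0x9988989897799677; q 0x9988989897799a67; q 0x9988979897898899; q
0x9988a998a989a899; q 0x9988979897899899; q 0x998897989789a8a9; q 0x998897989789989a; q
0x99889798978998a6; q 0x998897989789987a; q 0x9988979897899877; q 0x9988979897899777; q
0x9988979897899677; q 0x998897989a8988a9; q 0x998897989a898899; q 0x99889a9896899899; q
0x998897989a899899; q 0x9988979896899899; q 0x998897989a899897; q 0x9988979896899897; q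
0x998897989a89989a; q 0x998897989a89a867; q 0x998897989a89987a; q 0x9988979896899877; q
0x998897989a899876; q 0x998897989a899767; q 0x998897989a89a779; q 0x998897988899a8a9; q
0x9988979888999897; q 0x9988979888999879; q 0x998897988899a797; q 0x998897988899a979; q
0x9988979888999779; q 0x9988979888999679; q 0x998897989899a897; q 0x998897989899987a; q
0x99889a9898998a96; q 0x9988979898998979; q 0x998897989899897a; q 0x99889a9898998a97; q
0x99889a9898998a9a; w 0x9988989898998789 0x8888878888888878; q 0x9988979898998a76; q
0x9988979898998a7a; q 0x99889798989a8a79; q 0x9988979898998997; q 0x9988969898998a67; q
0x99889a9898998a67; q 0x99889a9898998979; q 0x998897989899899a; q 0x99889798989989a9; q
0x99889798a8a98a9a; q 0x9988979898998996; q 0x998897989899996a; q 0x998897989899aa76; q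
0x99889798989999a7; q 0x99889798989997a7; q 0x9988979898999767; q 0x998897989899a997; q
0x998897989899967a; q 0x9988979898799867; q 0x9988979898798967; q 0x9988979898798a96; q
0x9988979898798996; q 0x9988979898798999; q 0x998897989879899a; q 0x99889798a8798996; q
0x99889798987989a9; q 0x9988979898798966; q 0x998897a8987a8a77; q 0x9988979898798a99; q
0x9988979898a996a7; q 0x9988979898a996aa; q 0x998897989879a799; q 0x998897989879a796; q
0x9988969898799a9a; q 0x9988979898799a9a; q 0x998897989879a7a9; q 0x998897989879969a; q
0x9988979898799777; q 0x998897989879a677; q 0x9988979898799a7a; q 0x998897989869a777; q
0x998897989879a777; q 0x9988979897799777; q 0x99889798977997a7; q 0x998897989779a999; q
0x9988979897a99677; q 0x998897989a799a77; q 0x99889798a9999669; q 0x998897989a799aa7; q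
0x998897989a79a777; q 0x9988889997979a9a; q 0x99888899979aa9a6; q 0x9988889997979a7a; q
0x9988889997979a76; q 0x99889899987b8997; q 0x99889899987a8997; q 0x99889899987a8967; q
0x99889899987a8969; q 0x9988989a98678a97; q 0x99889899987a89a9; q 0x99889899987aa797; q
0x9988989989a799a9; q 0x99889899899799a9; q 0x9988989989979969; q 0x9988989989a79996; q
0x9988989989a7999a; q 0x998898998967aa79; q 0x998898998967997a; q 0x998898998997997a; q
0x9988989989a7a9a6; q 0x9988989989979a95; q 0x9988989989979a9a; q 0x9988989989979796; q
0x9988989989979676; q 0x99889899899796a7; q 0x99889899899a9967; q 0x9988989989969967; q
0x99889899899aaa97; q 0x998898998996a79a; q 0x99889899899aa96a; q 0x998898998aa7a77a; q
0x99889899899a9779; q 0x998898998a97a69a; q 0x998898998996a96a; q 0x99889899899a9769; q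
0x99889899899a9679; q 0x99889899899a9a69; q 0x99889899899aa979; q 0x9988989989a9977a; q
0x99889899899a9a67; q 0x99889899899aa967; q 0x99889899899aa696; q 0x9988989a89a99669; q
0x99889899899a96a7; q 0x99889899a7979676; q 0x998898999776a796; q 0x998898999767a776; q
0x99889899977696a6; q 0x9988989997769767; q 0x99889899977696a7; q 0x99889799977a97a7; q
0x9988979997a69667; q 0x998897999a7a9667; q 0x999897a89989978a; q 0x999897a899899786; q
0x999897a899899a87; q 0x9998a97899899899; q 0x999897a899899899; q 0x9998976899899899; q
0x999897689989a8a7; q 0x999897a89989989a; q 0x999897689989989a; q 0x97a8969879897879; q
0x9998a9789989a87a; q 0x999897a8998998a6; q 0x99989a789989987a; q 0x999897a8998998a7; q
0x999897a8998a98a7; q 0x999897a8998998aa; q 0x99989a68998998a9; q 0x999897a899899869; q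
0x999897689989987a; q 0x999897a89989987a; q 0x999897a899899867; q 0x99989768998998aa; q
0x9998976899899877; q 0x999897a899899877; q 0x999896789989a679; q 0x99989768998aa769; q
0x999897a89989a967; q 0x999897a899899a77; q 0x999897a89989a977; q 0x999897a89a89a789; q
0x999897a8a989a869; q 0x999897a89a899879; q 0x999897a8a7899866; q 0x999897a89a89a869; q
0x99989768a78a98a7; q 0x999897a89a89987a; q 0x999897a8a9899877; q 0x9998a9789a8aa867; q
0x999897a89a899876; q 0x99989678978999aa; q 0x999897a89a899977; q 0x999897a89a899a77; q
0x999897a89a899676; q 0x999897a8a979a79a; q 0x999897a89a79a976; q 0x9998998998998999; q
0x999899899899899a; q 0x9998998998998aa9; g 0x9998998998998998 0x8888888888888787; q
0x9998998a989a89a9; q 0x999899899899a999; q 0x999899899899baaa; q 0x9998998998999777; q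
0x9998998998999776; q 0x999899899899a997; q 0x999899899899a779; q 0x999899899899a796; q
0x9998998a989a9769; q 0x99989989989a899b; q 0x99989989989a8aa9; w 0x9998998998988979
0x8888888888898878; q 0x99989989989a8a9a; g 0x9998998998988989 0x8888888888898898; q
0x9998998998968a9a; q 0x99989989a8a78a7a; q 0x99989989989a89a9; q 0x99989989989a8a99; q
0x99989989989a897a; q 0x99989989989689a7; q 0x99989989a8a989aa; q 0x99989989989a8a77; q
0x99989989989a8a69; q 0x9998998998968967; q 0x9998998998969a7a; q 0x99989989989a9a7a; q
0x99989989989a97a7; q 0x999899899896ba7a; q 0x99989989989a9676; q 0x9998998998969676; q
0x99989989989a9a5a; q 0x99989989989a9a6a; q 0x99989989989a9767; q 0x99989989989aa797; q
0x99989989989a9769; q 0x99989989989bb9ab; q 0x99989989989aa67a; q 0x99989989a8a99a69; q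
0x99989989989a97a9; q 0x99989989989a9679; q 0x99989989989aa977; q 0x99989989989a9a77; q
0x99989989989aa967; q 0x99989989a8998a99; q 0x99989989987a897a; q 0x99989989987a89b6; g
0x9998998998988989 0x8888888878878778; q 0x99989989987a8a99; q 0x9998998998a78a69; q
0x99989989a8998977; q 0x99989989987a8ab6; q 0x99989989a8998a75; q 0x99989989a8998976; q
0x99989989987a8976; q 0x99989989987a89aa; q 0x99989989987a8a77; q 0x9998aa899879976a; q
0x99989989a8999577; q 0x99989989987aba96; q 0x99989989a8999a77; q 0x99989989a899a679; w
0x9998998998988999 0x8888888898897788; q 0x9998998998a79b77; q 0x99989989987a97aa; q
0x99989989987a97a6; q 0x9998998998778abb; q 0x9998998998778977; q 0x9998998998778976; q
0x99989989a87689aa; q 0x99989989a8768a96; q 0x9998998998768a96; q 0x99989989a8778a69; q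
0x9998998a987989a9; q 0x9998998998aa8a69; q 0x9998aa89987a8a67; q 0x9998998998778a96; q
0x9998998a98799697; q 0x999899899876979a; q 0x9998998998779697; q 0x9998998aa899a6a9; q
0x999899899877a9a6; q 0x999899899877a7a9; q 0x9998998998779a96; q 0x999899899877969a; q
0x9998aa89986aa96a; q 0x9998998998aaab99; q 0x99989989a896957a; q 0x999899899877a799; q
0x9998aa89a87aa76a; q 0x9998998998aa9b7a; q 0x9998998998769ab6; q 0x99989989987796a7; q
0x99989989987696a7; q 0x999899899877a977; q 0x99989989a8779766; q 0x9998998a9866a977; q
0x99989989a877a766; q 0x99989989987797aa; q 0x99989989a876a766; q 0x9998998998aa97ba; q
0x999899899867a976; q 0x9998998a98a99a79; q 0x9998998998779a67; q 0x999899899876a697; q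
0x99989989987697aa; q 0x9998998997a6976a; q 0x999899899a779a66; q 0x999899899a7797aa; q
0x999899899a77a977; q 0x9998998aa797a696; q 0x999899899a76a967; q 0x99989989a977ba56; q
0x999899899a77a679; q 0x9998998997a69a67; q 0x9998978998778979; q 0x99989789987789a6; q
0x99989a89a86989a6; q 0x9998978998778a79; q 0x9998a98998a68a96; q 0x9998978998aa8a67; q
0x9998978a987689a7; q 0x99989789a8778a67; q 0x99989789a877897a; q 0x99989789a877a997; q
0x9998978998779aa6; q 0x99989789a877a77a; q 0x9998978998779669; q 0x999897899877a669; q
0x9998a98998a6a99a; q 0x99989789a877a669; q 0x99989789a877a996; q 0x99989a89a8699699; q
0x9998978998779797; q 0x999896899867969a; q 0x999897899877a6a9; q 0x999897899866a7a7; q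
0x9998978998779a9a; q 0x999897899877a979; q 0x99989789987a89a9; q 0x99989689987a8977; q
0x9998978998a78a67; q 0x99989a89987a89a9; q 0x99989789987a8a77; q 0x99989789987a89aa; q
0x9998978a98a68969; q 0x99989a89987a9779; q 0x99989a89987a9669; q 0x99989789987a9aa9; q
0x9998978998a79777; q 0x9998978998a7a667; q 0x9998968998a7a779; q 0x99989789a87bb77a; q
0x9998978a98a6a999; q 0x9998978998a79aaa; q 0x99989689a899a667; q 0x9998968998a7a777; q
0x99989789987aa777; q 0x99989789987a9667; q 0x99989789987aaa69; q 0x9998978998a7aa67; q
0x9998968998a79976; q 0x99989789987a9966; q 0x99989789987aaa79; q 0x99989789987aa796; q
0x99989789987a9a6a; q 0x99989689987a9a6a; q 0x9998978998a79a77; q 0x99989a89986ba95b; q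
0x9998968998a79766; q 0x99989689987a9abb; q 0x99989789987a9ab7; q 0x99989789987a9a67; q
0x99989789b87689bb; q 0x9998978998768969; q 0x99989789986aa996; q 0x99989789a8679666; q
0x9998978998a69667; q 0x9998978998679aaa; q 0x99989789986aa7a7; q 0x999897899876a7a7; q
0x9998978998769697; q 0x999897899876a7a6; q 0x99989789986aa976; q 0x99989789a876a767; q
0x99989789a8759b6b; q 0x9998978998a69a7a; q 0x99989b89a89b957a; q 0x999897899867a97b; q
0x99989789987696a7; q 0x9998978aa8779a67; q 0x99989789a857b969; q 0x9998978a9867a979; q
0x9998978aa8799a67; q 0x999897899876a9bb; q 0x999897899876a979; q 0x9998978999aaa677; q
0x9998978999aaa697; q 0x9998978a99a99a67; q 0x9998978a99a99a77; q 0x9998978999a69a67; q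
0x9998978999aaa797; q 0x9998978999aaa979; q 0x9998978a9a79a797; q 0x99989789a9799676; q
0x99989789ab97ab66; q 0x999897899a779a6a; q 0x999897899a77a979; q 0x99989a899676a796; q
0x999897899a77a797; q 0x999897a9a969a796; q 0x999897a99677a595; q 0x999897a99677a979; q
0x999997a69a67967a]%num.

(** One evaluation shows both that every branch is closed and that the words left over are those of
    the configurations. *)
Lemma certificate_run : run certificate start [::] == Some (map word_of configurations).
Proof. by vm_compute. Qed.

Lemma configurations_octic :
  all (fun m => decided m && spanning (word_of m)) configurations.
Proof. by vm_compute. Qed.

(** Distinct invariants put the 455 words into distinct orbits, so the upper bound coming from the
    certificate is attained. *)
Lemma invariants_uniq : uniq (map invariant (map word_of configurations)).
Proof. by vm_compute. Qed.

Lemma size_configurations : size configurations = 455.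
Proof. by vm_compute. Qed.

Section Classification.
Variable K : numClosedFieldType.
Implicit Types P Q : 'I_8 -> subspace K.

(** A canonical reordering of P agrees with [start], so its word is found at some leaf. *)
Lemma classification P : octic_arrangement P ->
  exists s : 'S_8, word (P \o s) \in map word_of configurations.
Proof.
move=> oP; have [s can] := canonical_ex P; exists s.
have oPs := octic_comp s oP; have [_] := run_sound oPs can (eqP certificate_run).
by apply; apply: start_agrees.
Qed.

Lemma realization i : i < 455 -> exists P, octic_arrangement P /\
  word P = nth [::] (map word_of configurations) i.
Proof.
move=> i455; pose m := nth ((Z0, Z0), [::]) configurations i.
have mc : m \in configurations by rewrite mem_nth // size_configurations.
have /andP[dm sm] := allP configurations_octic m mc.
have [P oP wP] := realize K dm sm; exists P; split=> //.
by rewrite wP (nth_map ((Z0, Z0), [::])) // size_configurations.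
Qed.

Lemma minimal_word P Q : word P = word Q ->
  minimal_incidence_table P = minimal_incidence_table Q.
Proof.
move=> PQ; have PQs s := (incidence_table_word _ _).2 (word_comp s PQ).
apply/le_anti/andP; split.
  by have [s ->] := minimal_attained Q; rewrite -PQs minimal_le.
by have [s ->] := minimal_attained P; rewrite PQs minimal_le.
Qed.

(** Both minima are tables of reorderings; equal tables give equal words of these reorderings, whose
    invariants are those of P and Q. *)
Lemma minimal_invariant P Q : minimal_incidence_table P = minimal_incidence_table Q ->
  invariant (word P) = invariant (word Q).
Proof.
have [s ->] := minimal_attained P; have [t ->] := minimal_attained Q.
by move=> /incidence_table_word e; rewrite -(invariantP P s) e invariantP.
Qed.
End Classification.

Local Open Scope ring_scope.
Local Open Scope classical_set_scope.
Local Open Scope card_scope.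

Theorem proposition2p2 (R : realType) :
  minimal_incidence_tables R[i] #= `I_455.
Proof.
have /boolp.choice[P PW] : forall i : nat, exists P : 'I_8 -> subspace R[i],
    (i < 455)%N -> octic_arrangement P /\ word P = nth [::] (map word_of configurations) i.
  move=> i; case: (ltnP i 455) => [/(realization R[i])[P ?]|_]; first by exists P.
  (* A dummy family beyond the 455 indices makes the choice function total. *)
  by exists (fun=> 0%VS).
(* By the classification every arrangement has, after reordering, the word of one of the
   realizations, hence the same minimal table. *)
have -> : minimal_incidence_tables R[i] = (fun i => minimal_incidence_table (P i)) @` `I_455.
  apply/seteqP; split=> [_ [Q oQ <-]|_ [i /= i455 <-]]; last first.
    by exists (P i) => //; case: (PW i i455).
  have [s ws] := classification oQ; have [k] := nthP [::] ws.
  rewrite size_map size_configurations => k455 wk; exists k => //=.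
  rewrite -(minimal_comp Q s); apply: minimal_word.
  by case: (PW k k455) => _ ->.
(* Injectivity: equal minimal tables have equal invariants, and these are pairwise distinct over the
   455 words. *)
apply: inj_card_eq => i j; rewrite !in_setE /= => i455 j455 /minimal_invariant.
have [_ ->] := PW i i455; have [_ ->] := PW j j455.
have s455 : size (map word_of configurations) = 455%N by rewrite size_map size_configurations.
rewrite -!(nth_map _ N0) ?s455 // => /eqP.
by rewrite nth_uniq ?size_map ?size_configurations ?invariants_uniq // => /eqP.
Qed.
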